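(* Let $n\ge0$ be an integer and let $\vartheta$ be a nontrivial even probability measure on $\mathbb{R}/\mathbb{Z}$. Let $\varphi_{n+1}(z)=\varphi_{n+1}(z;d\vartheta)$ be the $(n+1)$-th orthonormal polynomial on the unit circle with respect to this measure, with associated $K_n$, $A_{n+1}$, $B_{n+1}$. Let $\mathcal{A}_{n+1}=\{\xi\in\mathbb{R}/\mathbb{Z}:A_{n+1}(e^{2\pi i\xi})=0\}$ and $\mathcal{B}_{n+1}=\{\xi\in\mathbb{R}/\mathbb{Z}:B_{n+1}(e^{2\pi i\xi})=0\}$. For a nonnegative Borel measure $\varsigma$ on $(0,\infty)$ let $h_\varsigma(\theta)=\int_0^\infty\{f_\lambda(\theta)-f_\lambda(\tfrac12)\}\,d\varsigma(\lambda)$. (i) Let $\varsigma$ satisfy $\int_0^\infty\lambda e^{-a\lambda}\,d\varsigma(\lambda)<\infty$ for every $a>0$. If $\ell\in\Lambda_n$ satisfies $\ell(\theta)\le h_\varsigma(\theta)$ for all $\theta\in\mathbb{R}$, then $$\int_{\mathbb{R}/\mathbb{Z}}\ell(\theta)\,d\vartheta(\theta)\le\sum_{\xi\in\mathcal{A}_{n+1}}\frac{h_\varsigma(\xi)}{K_n(e^{2\pi i\xi},e^{2\pi i\xi})}.$$ Moreover, there exists a unique trigonometric polynomial $\theta\mapsto\ell_\vartheta(n,\varsigma,\theta)\in\Lambda_n$ with $\ell_\vartheta(n,\varsigma,\theta)\le h_\varsigma(\theta)$ for all $\theta\in\mathbb{R}$ for which equality holds in this integral inequality. (ii) Let $\varsigma$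 satisfy $\int_0^\infty\frac{\lambda}{1+\lambda}\,d\varsigma(\lambda)<\infty$. If $m\in\Lambda_n$ satisfies $m(\theta)\ge h_\varsigma(\theta)$ for all $\theta\in\mathbb{R}$, then $$\int_{\mathbb{R}/\mathbb{Z}}m(\theta)\,d\vartheta(\theta)\ge\sum_{\xi\in\mathcal{B}_{n+1}}\frac{h_\varsigma(\xi)}{K_n(e^{2\pi i\xi},e^{2\pi i\xi})}.$$ Moreover, there exists a unique trigonometric polynomial $\theta\mapsto m_\vartheta(n,\varsigma,\theta)\in\Lambda_n$ with $m_\vartheta(n,\varsigma,\theta)\ge h_\varsigma(\theta)$ for all $\theta\in\mathbb{R}$ for which equality holds in this integral inequality.
   Context: $f_\lambda(\theta)=\dfrac{\cosh(\lambda(\theta-\lfloor\theta\rfloor-\frac12))}{\sinh(\lambda/2)}=\sum_{j\in\mathbb{Z}}e^{-\lambda|\theta+j|}$ for $\lambda>0$. Under the condition in (i), $h_\varsigma(\theta)$ is finite for $\theta\notin\mathbb{Z}$ and may be $+\infty$ for $\theta\in\mathbb{Z}$; under the condition in (ii) it is finite everywhere. $\Lambda_n$ is the space of trigonometric polynomials $\sum_{k=-n}^na_ke^{2\pi ik\theta}$, $a_k\in\mathbb{C}$. A measure is nontrivial if it does not have finite support. Measures on $\mathbb{R}/\mathbb{Z}$ are identified with measures on the unit circle $\partial\mathbb{D}$ via $\theta\mapsto e^{2\pi i\theta}$; $\vartheta$ is even if the corresponding measure on $\partial\mathbb{D}$ satisfies $\vartheta(S)=\vartheta(\overline S)$ for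 all Borel sets $S\subset\partial\mathbb{D}$. The monic orthogonal polynomials $\Phi_m(z)=z^m+\text{lower order terms}$ are determined by $\int_{\partial\mathbb{D}}\Phi_m(z)\overline z^{\,j}d\vartheta(z)=0$ for $0\le j<m$; the orthonormal polynomials are $\varphi_m=\Phi_m/\|\Phi_m\|_{L^2(\partial\mathbb{D},d\vartheta)}$. For a polynomial $P$ of exact degree $m$, $P^*(z)=z^m\,\overline{P(\overline z^{\,-1})}$. Then $$K_n(w,z)=\frac{\varphi_{n+1}^*(z)\overline{\varphi_{n+1}^*(w)}-\varphi_{n+1}(z)\overline{\varphi_{n+1}(w)}}{1-\overline wz}$$ (extended by continuity to $\overline wz=1$) is the reproducing kernel of the polynomials of degree at most $n$ with the inner product of $L^2(\partial\mathbb{D},d\vartheta)$, and $$A_{n+1}=\tfrac12\{\varphi_{n+1}^*+\varphi_{n+1}\},\qquad B_{n+1}=\tfrac i2\{\varphi_{n+1}^*-\varphi_{n+1}\}.$$ *)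

(* Defs.v *)
From HB Require Import structures.
From mathcomp Require Import all_boot all_order all_algebra.
From mathcomp Require Import complex.
From mathcomp Require Import all_classical all_reals all_analysis.

Set Implicit Arguments.
Unset Strict Implicit.
Unset Printing Implicit Defensive.

Import Order.TTheory GRing.Theory Num.Theory.
Import numFieldNormedType.Exports.

Local Open Scope classical_set_scope.
Local Open Scope complex_scope.
Local Open Scope ring_scope.

(* The complex numbers are [R[i]] for an arbitrary [R : realType]; their
   topology is the one of the numeric field, carried by the alias [R[i]^o].

   R/Z is represented by its fundamental domain [0, 1): a measure on R/Z is a
   Borel measure [theta] on R with [theta [set` `[0, 1[] = 1] (so that it charges
   nothing outside [0, 1)), and integrals over R/Z are integrals over [0, 1).
   A Borel measure on (0, oo) is represented by a Borel measure on R, of which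
   only the restriction to (0, oo) is ever used. *)

Section Circle.
Context {R : realType}.
Implicit Type theta : probability (measurableTypeR R) R.

Definition cexp (t : R) : R[i] := cos (2 * pi * t) +i* sin (2 * pi * t).

(* The measure on the unit circle, viewed inside the complex plane, that
   corresponds to theta. *)
Definition circle_measure theta (S : set R[i]) : \bar R :=
  theta (cexp @^-1` S).

Definition complex_borel (S : set R[i]) : Prop :=
  <<s [set U : set R[i]^o | open U] >> S.

Definition even_measure theta : Prop :=
  forall S : set R[i], complex_borel S -> S `<=` range cexp ->
    circle_measure theta S = circle_measure theta [set z | S z^*].

Definition circle_support theta : set R[i] :=
  [set z : R[i] | forall U : set R[i]^o,
     open U -> U z -> (0 < circle_measure theta U)%E].

Definition nontrivial_measure theta : Prop :=
  ~ finite_set (circle_support theta).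

(* Integral over the unit circle of a complex function that is bounded and
   measurable there. *)
Definition circle_integral theta (g : R[i] -> R[i]) : R[i] :=
  (\int[theta]_(t in `[0, 1[) complex.Re (g (cexp t))) +i*
  (\int[theta]_(t in `[0, 1[) complex.Im (g (cexp t))).

End Circle.

Section OrthogonalPolynomials.
Context {R : realType} (theta : probability (measurableTypeR R) R).

Definition is_monic_opuc (m : nat) (P : {poly R[i]}) : Prop :=
  [/\ P \is monic, size P = m.+1
    & forall j : nat, (j < m)%N ->
        circle_integral theta (fun z => P.[z] * z^* ^+ j) = 0].

(* The polynomial determined by the conditions above (it exists and is unique
   when theta is nontrivial). *)
Definition monic_opuc (m : nat) : {poly R[i]} :=
  xget 0 [set P | is_monic_opuc m P].

Definition circle_L2norm (P : {poly R[i]}) : R :=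
  Num.sqrt (\int[theta]_(t in `[0, 1[) (Normc.normc P.[cexp t]) ^+ 2).

Definition opuc (m : nat) : {poly R[i]} :=
  ((circle_L2norm (monic_opuc m))^-1)%:C *: monic_opuc m.

End OrthogonalPolynomials.

Section Kernel.
Context {R : realType}.

(* The polynomial P^*(z) = z^m conj(P(1/conj z)) with m = deg P (see
   reverse_polyE), given by its coefficients so as to be correct at z = 0. *)
Definition reverse_poly (P : {poly R[i]}) : {poly R[i]} :=
  \poly_(i < size P) (P`_((size P).-1 - i))^*.

Lemma reverse_polyE (P : {poly R[i]}) (z : R[i]) : z != 0 ->
  (reverse_poly P).[z] = z ^+ (size P).-1 * (P.[(z^*)^-1])^*.
Proof.
move=> z0; have [->|P0] := eqVneq P 0.
  by rewrite /reverse_poly size_poly0 horner_poly big_ord0 horner0 conjC0 mulr0.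
rewrite /reverse_poly horner_poly horner_coef rmorph_sum mulr_sumr /=.
rewrite (reindex_inj rev_ord_inj) /=; apply: eq_bigr => i _.
have iP : (i <= (size P).-1)%N by rewrite -ltnS prednK ?size_poly_gt0.
have -> : (size P - i.+1 = (size P).-1 - i)%N by rewrite -subn1 -subnDA add1n.
rewrite subKn // rmorphM rmorphXn /= fmorphV /= conjCK mulrCA; congr (_ * _).
by rewrite exprVn -expfB_cond ?(negbTE z0) ?add0n.
Qed.

Definition CD_quotient (phi : {poly R[i]}) (w z : R[i]) : R[i] :=
  ((reverse_poly phi).[z] * ((reverse_poly phi).[w])^* - phi.[z] * (phi.[w])^*)
    / (1 - w^* * z).

(* K_n, expressed through phi = phi_{n+1}.  Where 1 - conj(w) z vanishes, the
   value is the limit at z of the quotient, which is defined on a punctured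
   neighborhood of z. *)
Definition CD_kernel (phi : {poly R[i]}) (w z : R[i]) : R[i] :=
  if w^* * z == 1
  then lim ((CD_quotient phi w u : R[i]^o) @[u --> (z : R[i]^o)^'])
  else CD_quotient phi w z.

Definition companionA (phi : {poly R[i]}) : {poly R[i]} :=
  2^-1 *: (reverse_poly phi + phi).

Definition companionB (phi : {poly R[i]}) : {poly R[i]} :=
  ('i%C / 2) *: (reverse_poly phi - phi).

Definition circle_zeros (P : {poly R[i]}) : set R :=
  [set xi : R | 0 <= xi < 1 /\ P.[cexp xi] = 0].

End Kernel.

Section Subordination.
Context {R : realType}.
Implicit Type sigma : {measure set (measurableTypeR R) -> \bar R}.

Definition cosh (x : R) : R := (expR x + expR (- x)) / 2.
Definition sinh (x : R) : R := (expR x - expR (- x)) / 2.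

Definition f_ (lam t : R) : R :=
  cosh (lam * (t - (Num.floor t)%:~R - 2^-1)) / sinh (lam / 2).

(* The integrand is nonnegative, f_ lam being minimal at 1/2, so that the
   integral is always meaningful in [0, +oo]. *)
Definition h_ sigma (t : R) : \bar R :=
  (\int[sigma]_(lam in `]0%R, +oo[) (f_ lam t - f_ lam 2^-1)%:E)%E.

(* The space Lambda_n; [a k] is the coefficient of frequency [k - n]. *)
Definition trig_poly (n : nat) (g : R -> R[i]) : Prop :=
  exists a : 'I_(2 * n).+1 -> R[i],
    forall t, g t = \sum_(k < (2 * n).+1) a k * cexp ((k%:R - n%:R) * t).

(* The elements of Lambda_n that are real-valued, as is implied by an
   inequality with a real function. *)
Definition real_trig_poly (n : nat) (l : R -> R) : Prop :=
  trig_poly n (fun t => (l t)%:C).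

Definition minorant_trig_poly (n : nat) sigma (l : R -> R) : Prop :=
  real_trig_poly n l /\ forall t, ((l t)%:E <= h_ sigma t)%E.

Definition majorant_trig_poly (n : nat) sigma (l : R -> R) : Prop :=
  real_trig_poly n l /\ forall t, (h_ sigma t <= (l t)%:E)%E.

(* The sum of h(xi) / K_n(e(xi), e(xi)) over xi in Z; the values of K_n on the
   diagonal are real. *)
Definition quadrature (phi : {poly R[i]}) (Z : set R) sigma : \bar R :=
  (\sum_(xi \in Z)
     h_ sigma xi * ((complex.Re (CD_kernel phi (cexp xi) (cexp xi)))^-1)%:E)%E.

End Subordination.

(* Main.v *)
Require Import Defs.
From HB Require Import structures.
From mathcomp Require Import all_boot all_order all_algebra.
From mathcomp Require Import complex ring lra.
From mathcomp Require Import all_classical all_reals all_analysis measurable_realfun.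
Set Implicit Arguments.
Unset Strict Implicit.
Unset Printing Implicit Defensive.
Import Order.TTheory GRing.Theory Num.Theory.
Import numFieldNormedType.Exports.
Local Open Scope classical_set_scope.
Local Open Scope ring_scope.

(** Write e(t) = exp(2 pi i t) and x(t) = cos^2(pi t) = (1 + cos(2 pi t))/2,
    a coordinate with values in [0, 1] that equals 1 exactly at the integers.
    Even trigonometric polynomials of degree at most n are the polynomials of
    degree at most n in x.  The theorem rests on four facts.

    - h_sigma(t) is a power series in x(t) with nonnegative coefficients.
      Indeed cosh(a v) is a power series in sin^2 v with nonnegative
      coefficients for |v| <= pi/2 ([cvg_cosh_series]), and f_lambda(t) is
      cosh(lambda u)/sinh(lambda/2) with u in [-1/2, 1/2) and
      x(t) = sin^2(pi u).  The two hypotheses on sigma give convergence for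
      x < 1, respectively for x <= 1 ([h_power_series]).

    - If S is such a series and the nodes x_j lie in [0, 1), then
      S(x) = p(x) + S_b(x) prod_j (x - x_j), where p interpolates S and has
      degree less than the number of nodes, and b is again nonnegative
      ([newton_interpolation]).  One node may be 1 when S(1) is finite.

    - Let phi = phi_{n+1} and A_e = phi^* + e phi with e = 1 or e = -1; up to a
      constant these are A_{n+1} and B_{n+1}.  A_e is orthogonal to
      z, ..., z^n.  Hence it has n + 1 simple zeros e(xi), all on the unit circle
      ([para_opuc_roots]), and the reproducing kernels at these zeros form an
      orthogonal basis of the polynomials of degree at most n.  This is the
      quadrature formula with weights 1/K_n(e(xi), e(xi)), exact for all
      trigonometric polynomials of degree at most n ([quadrature_trig]).

    - Since theta is even, phi has real coefficients, and then
      e prod_xi (x(t) - x(xi)) = c |A_e(e(t))|^2 for some c > 0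
      ([nodal_product_sign]).

    By the last fact, interpolating h_sigma in x at the zeros of A gives a
    minorant, and at the zeros of B (one of which is e(0) = 1) a majorant.  As
    the quadrature formula is exact, the inequalities between integrals become
    sums of inequalities at the nodes.  In the equality case the competitor
    agrees with the extremal function at every node.  Away from the integers
    the two functions also differ by at most O(|A_e|^2) on one side, so their
    difference has a double zero at each node other than 0: at least 2n + 1
    zeros in all, too many for a nonzero element of Lambda_n
    ([extremal_uniqueness]). *)

(** * Power series with nonnegative coefficients and Newton interpolation *)

Section PowerSeries.
Context {R : realType}.
Implicit Types (a : nat -> R) (x y r : R).

(** The sum of the power series with coefficients [a] at the point [x]. *)
Definition power_series a x : R := limn (series (fun k => a k * x ^+ k)).

(** Nonnegative coefficients and convergence on [0, 1); nothing is required at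
    the point 1. *)
Definition nonneg_power_series a : Prop :=
  (forall k, 0 <= a k) /\
  (forall x, 0 <= x < 1 -> cvgn (series (fun k => a k * x ^+ k))).

(** The Horner tail is the sum of [a (i + k) * y ^+ i] over [i].  The quotient of
    [power_series a x - power_series a y] by [x - y] is the power series whose
    coefficients are the tails of index [k.+1]. *)
Definition horner_tail a y k : R := power_series (fun i => a (i + k)%N) y.
Definition horner_quotient a y k : R := horner_tail a y k.+1.

Lemma seriesSl (u : nat -> R) n :
  series u n.+1 = u 0%N + series (fun k => u k.+1) n.
Proof. by rewrite /series /= big_nat_recl. Qed.

Section Step.
Variables (a : nat -> R) (y r : R).
Hypotheses (a0 : forall k, 0 <= a k) (y0 : 0 <= y) (yr : y <= r) (r0 : 0 < r).
Hypothesis cr : cvgn (series (fun k => a k * r ^+ k)).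

Lemma cvg_shift_series k :
  cvgn (series (fun i => a (i + k)%N * r ^+ (i + k))).
Proof.
elim: k => [|k IH]; first by under eq_fun do rewrite addn0.
move: IH; set u := (fun i => _); set v := (fun i => _) => /cvg_ex [l hl].
apply/cvg_ex; exists (l - u 0%N).
have -> : series v = (fun n => series u n.+1 - u 0%N).
  apply/funext => n; rewrite seriesSl addrC addKr.
  by congr (series _ n); apply/funext => i; rewrite /v /u addSnnS.
by apply: cvgB; [rewrite cvg_shiftS | exact: cvg_cst].
Qed.

Lemma cvg_horner_tail k : cvgn (series (fun i => a (i + k)%N * y ^+ i)).
Proof.
have h := @cvg_shift_series k.
apply: (@series_le_cvg _ _ (fun i => (r ^- k) *: (a (i + k)%N * r ^+ (i + k)))).
- by move=> i; rewrite mulr_ge0// exprn_ge0.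
- move=> i; rewrite /GRing.scale /= mulr_ge0 ?invr_ge0 ?exprn_ge0 ?(ltW r0)//.
  by rewrite mulr_ge0// exprn_ge0// ltW.
- move=> i; rewrite /GRing.scale /= exprD mulrCA mulrA -mulrA ler_wpM2l//.
  have -> : r ^- k * (r ^+ i * r ^+ k) = r ^+ i.
    by rewrite mulrC mulfK// expf_neq0// gt_eqF.
  by rewrite lerXn2r// nnegrE// ltW.
- by apply: is_cvg_seriesZ.
Qed.

Lemma horner_tail_ge0 k : 0 <= horner_tail a y k.
Proof.
apply: limr_ge; first exact: cvg_horner_tail.
by apply: nearW => n; apply: sumr_ge0 => i _; rewrite mulr_ge0// exprn_ge0.
Qed.

Lemma horner_tailS k : horner_tail a y k = a k + y * horner_tail a y k.+1.
Proof.
apply/cvg_lim => //; rewrite -cvg_shiftS.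
have -> : [sequence series (fun i => a (i + k)%N * y ^+ i) n.+1]_n =
   (fun n => a k + y * series (fun i => a (i + k.+1)%N * y ^+ i) n).
  apply/funext => n; rewrite /= seriesSl add0n expr0 mulr1; congr (_ + _).
  rewrite /series /= mulr_sumr; apply: eq_bigr => i _.
  by rewrite addSnnS exprS mulrCA.
apply: cvgD; first exact: cvg_cst.
by apply: cvgM; [exact: cvg_cst | exact: cvg_horner_tail].
Qed.

(** Partial sums of the quotient, from the recursion
    [horner_tail a y k = a k + y * horner_tail a y k.+1]. *)
Lemma horner_telescope x N :
  (x - y) * series (fun k => horner_quotient a y k * x ^+ k) N =
  horner_tail a y N * x ^+ N - power_series a y + series (fun k => a k * x ^+ k) N.
Proof.
elim: N => [|N IH].
  rewrite /series /= !big_nil mulr0 expr0 mulr1 /horner_tail.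
  by under [X in power_series X]eq_fun do rewrite addn0; rewrite addr0 subrr.
rewrite /series /= !big_nat_recr//= mulrDr.
move: IH; rewrite /series /= => ->.
rewrite /horner_quotient [in RHS]exprS (horner_tailS N).
by ring.
Qed.

(** The boundary term of the telescoping vanishes in the limit: it is bounded by
    the tail of the series at [r]. *)
Lemma cvg_horner_tail0 x : 0 <= x <= r ->
  horner_tail a y N * x ^+ N @[N --> \oo] --> 0.
Proof.
move=> /andP[x0 xr].
pose S := power_series a r.
have hS : (fun N => S - series (fun k => a k * r ^+ k) N) @ \oo --> 0.
  rewrite -(subrr S); apply: cvgB; first exact: cvg_cst.
  exact: cr.
apply: (@squeeze_cvgr _ _ _ _ (fun=> 0) _ _ _ 0); last 2 first.
- exact: cvg_cst.
- exact: hS.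
apply: nearW => N; rewrite mulr_ge0 ?horner_tail_ge0 ?exprn_ge0//=.
have xrN : x ^+ N <= r ^+ N by rewrite lerXn2r// nnegrE// ltW.
apply: le_trans (ler_wpM2l (horner_tail_ge0 N) xrN) _.
have -> : horner_tail a y N * r ^+ N =
    limn (series (r ^+ N *: (fun i => a (i + N)%N * y ^+ i))).
  rewrite [LHS]mulrC; apply/esym.
  exact: (lim_seriesZ (r ^+ N) (@cvg_horner_tail N)).
apply: limr_le; first by apply: is_cvg_seriesZ; exact: cvg_horner_tail.
apply: nearW => n.
have le1 : series (r ^+ N *: (fun i => a (i + N)%N * y ^+ i)) n <=
   \sum_(0 <= i < n) a (i + N)%N * r ^+ (i + N).
  rewrite /series /=; apply: ler_sum => i _; rewrite fctE /GRing.scale /=.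
  rewrite mulrCA ler_wpM2l// exprD mulrC ler_wpM2r ?exprn_ge0 ?(ltW r0)//.
  by rewrite lerXn2r// nnegrE// ltW.
apply: (le_trans le1); rewrite lerBrDr addrC.
have -> : series (fun k => a k * r ^+ k) N +
    \sum_(0 <= i < n) a (i + N)%N * r ^+ (i + N) =
    series (fun k => a k * r ^+ k) (n + N)%N.
  rewrite /series /= [RHS](@big_cat_nat _ _ _ N)//= ?leq_addl//; congr (_ + _).
  by rewrite -[in RHS](add0n N) big_addn add0n addnK.
apply: nondecreasing_cvgn_le => //.
by apply/nondecreasing_seqP => i; rewrite /series /= big_nat_recr//= lerDl mulr_ge0// exprn_ge0// ltW.
Qed.

Lemma cvg_horner_quotient x : 0 <= x <= r -> x != y ->
  series (fun k => horner_quotient a y k * x ^+ k) @ \oo -->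
    (power_series a x - power_series a y) / (x - y).
Proof.
move=> x0r xy; have xy0 : x - y != 0 by rewrite subr_eq0.
have -> : series (fun k => horner_quotient a y k * x ^+ k) = (fun N =>
  (horner_tail a y N * x ^+ N - power_series a y + series (fun k => a k * x ^+ k) N) / (x - y)).
  by apply/funext => N; rewrite -horner_telescope mulrC mulKf.
apply: cvgM; last exact: cvg_cst.
have -> : power_series a x - power_series a y =
    (0 - power_series a y) + power_series a x by rewrite sub0r addrC.
case/andP: (x0r) => x0 xr.
apply: cvgD; first by apply: cvgB; [exact: (cvg_horner_tail0 x0r)|exact: cvg_cst].
apply: (@series_le_cvg _ _ (fun k => a k * r ^+ k)) => //.
- by move=> i; rewrite mulr_ge0// exprn_ge0.
- by move=> i; rewrite mulr_ge0// exprn_ge0// ltW.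
- by move=> i; rewrite ler_wpM2l// lerXn2r// nnegrE// ltW.
Qed.

End Step.

(** One step of Newton interpolation: dividing by [x - y] stays within the
    power series with nonnegative coefficients. *)
Lemma horner_step a y : nonneg_power_series a -> 0 <= y < 1 ->
  nonneg_power_series (horner_quotient a y) /\
  forall x, 0 <= x < 1 ->
    power_series a x = power_series a y + (x - y) * power_series (horner_quotient a y) x.
Proof.
move=> [a0 ca] /andP[y0 y1].
have key x : 0 <= x < 1 -> x != y ->
    series (fun k => horner_quotient a y k * x ^+ k) @ \oo -->
    (power_series a x - power_series a y) / (x - y).
  move=> /andP[x0 x1] xy; pose r := Num.max x y.
  have r0 : 0 < r.
    rewrite /r lt_max; move: xy; rewrite neq_lt => /orP[h|h].
      by rewrite (le_lt_trans x0 h) orbT.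
    by rewrite (le_lt_trans y0 h).
  apply: (@cvg_horner_quotient _ _ r) => //.
  - by rewrite /r le_max lexx orbT.
  - by apply: ca; rewrite (ltW r0) /r gt_max x1 y1.
  - by rewrite x0 /r le_max lexx.
have q0 k : 0 <= horner_quotient a y k.
  pose r := (1 + y) / 2.
  apply: (@horner_tail_ge0 _ _ r) => //; rewrite /r; [lra|lra|].
  by apply: ca; lra.
split; first split => // x /andP[x0 x1].
  pose x' := (1 + Num.max x y) / 2.
  have hx : x <= Num.max x y by rewrite le_max lexx.
  have hy : y <= Num.max x y by rewrite le_max lexx orbT.
  have h1 : Num.max x y < 1 by rewrite gt_max x1 y1.
  have x'0 : x < x' by rewrite /x'; lra.
  have y'0 : y < x' by rewrite /x'; lra.
  apply: (@series_le_cvg _ _ (fun k => horner_quotient a y k * x' ^+ k)) => //.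
  - by move=> i; rewrite mulr_ge0// exprn_ge0.
  - by move=> i; rewrite mulr_ge0// exprn_ge0// (le_trans x0)// ltW.
  - move=> i; rewrite ler_wpM2l// lerXn2r// ?nnegrE// ?(ltW x'0)//.
    by rewrite (le_trans x0)// ltW.
  - apply/cvg_ex; eexists; apply: key; last by rewrite gt_eqF.
    by rewrite (le_trans x0 (ltW x'0)) /x' /=; lra.
move=> x hx; have [->|xy] := eqVneq x y; first by rewrite subrr mul0r addr0.
have -> : power_series (horner_quotient a y) x = (power_series a x - power_series a y) / (x - y).
  by apply/cvg_lim => //; exact: key.
by rewrite mulrC divfK ?subr_eq0// addrC subrK.
Qed.

(** The same step at the node 1, where convergence has to be assumed. *)
Lemma horner_step1 a : (forall k, 0 <= a k) ->
  cvgn (series (fun k => a k * 1 ^+ k)) ->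
  nonneg_power_series (horner_quotient a 1) /\
  forall x, 0 <= x < 1 ->
    power_series a x = power_series a 1 + (x - 1) * power_series (horner_quotient a 1) x.
Proof.
move=> a0 ca.
have key x : 0 <= x < 1 ->
    series (fun k => horner_quotient a 1 k * x ^+ k) @ \oo -->
    (power_series a x - power_series a 1) / (x - 1).
  move=> /andP[x0 x1].
  by apply: (@cvg_horner_quotient _ _ 1) => //; rewrite ?x0 ?ltW// lt_eqF.
split; first split => [k|x hx].
- by apply: (@horner_tail_ge0 _ _ 1).
- by apply/cvg_ex; eexists; exact: key.
move=> x hx.
have -> : power_series (horner_quotient a 1) x = (power_series a x - power_series a 1) / (x - 1).
  by apply/cvg_lim => //; exact: key.
have x1 : x - 1 != 0 by rewrite subr_eq0 lt_eqF//; case/andP: hx.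
by rewrite mulrC divfK// [RHS]addrC subrK.
Qed.

Lemma power_series_ge0 a x : nonneg_power_series a -> 0 <= x < 1 ->
  0 <= power_series a x.
Proof.
move=> [a0 ca] hx; apply: limr_ge; first exact: ca.
apply: nearW => n; apply: sumr_ge0 => i _; rewrite mulr_ge0// exprn_ge0//.
by case/andP: hx.
Qed.

Lemma power_series_le a x z : nonneg_power_series a -> 0 <= x -> x <= z -> z < 1 ->
  power_series a x <= power_series a z.
Proof.
move=> [a0 ca] x0 xz z1; apply: lim_series_le.
- by apply: ca; rewrite x0 (le_lt_trans xz).
- by apply: ca; rewrite (le_trans x0 xz).
- by move=> n; rewrite ler_wpM2l// lerXn2r ?nnegrE// (le_trans x0).
Qed.

(** Newton's formula with remainder.  Repeated nodes are allowed and express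
    Hermite interpolation; the remainder has nonnegative coefficients. *)
Lemma newton_interpolation (s : seq R) a : nonneg_power_series a ->
  all (fun y => 0 <= y < 1) s ->
  exists p : {poly R}, exists b, [/\ (size p <= size s)%N, nonneg_power_series b &
    forall x, 0 <= x < 1 ->
      power_series a x = p.[x] + (\prod_(y <- s) (x - y)) * power_series b x].
Proof.
elim: s a => [|y s IH] a ha /=.
  move=> _; exists 0, a; split => //; first by rewrite size_poly0.
  by move=> x _; rewrite horner0 add0r big_nil mul1r.
move=> /andP[hy hs]; have [hq eqq] := horner_step ha hy.
have [p [b [sp hb eqb]]] := IH _ hq hs.
exists ((power_series a y)%:P + ('X - y%:P) * p), b; split => //.
  apply: leq_trans (size_polyD _ _) _; rewrite geq_max; apply/andP; split.
    exact: leq_trans (size_polyC_leq1 _) _.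
  apply: leq_trans (size_polyMleq _ _) _.
  by rewrite size_XsubC /=.
move=> x hx; rewrite eqq// eqb// big_cons !hornerE; ring.
Qed.

End PowerSeries.

(** * The expansion of cosh(a v) in powers of sin^2 v *)

Section CoshSeries.
Context {R : realType}.
Implicit Types (a v : R).

Lemma nondecreasing_from0 (F F' : R -> R) (V : R) :
  (forall v, is_derive v 1 F (F' v)) ->
  (forall v, 0 <= v <= V -> 0 <= F' v) ->
  forall v, 0 <= v <= V -> F 0 <= F v.
Proof.
move=> dF F'0 v /andP[v0 vV].
apply: (@ger0_derive1_ndecr _ F 0 v) => //.
- move=> x; rewrite in_itv/= => /andP[x0 xv].
  by rewrite derive1E (@derive_val _ _ _ _ _ _ _ (dF x)) F'0// (ltW x0) (le_trans (ltW xv)).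
- apply: continuous_subspaceT => x.
  by apply: differentiable_continuous; apply/derivable1_diffP;
    apply: (@ex_derive _ _ _ _ _ _ _ (dF x)).
Qed.

(** A function with f'' >= a^2 f and f(0) = f'(0) = 0 is nonnegative: factor
    D^2 - a^2 as (D - a)(D + a) and integrate twice. *)
Lemma subsolution_ge0 a (f f' f'' : R -> R) (V : R) :
  (forall v, is_derive v 1 f (f' v)) ->
  (forall v, is_derive v 1 f' (f'' v)) ->
  f 0 = 0 -> f' 0 = 0 ->
  (forall v, 0 <= v <= V -> a ^+ 2 * f v <= f'' v) ->
  forall v, 0 <= v <= V -> 0 <= f v.
Proof.
move=> df df' f0 f'0 h.
have Y0 v : 0 <= v <= V -> 0 <= f' v + a * f v.
  move=> hv; have := @nondecreasing_from0 (fun v => expR (- a * v) * (f' v + a * f v))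
     (fun v => expR (- a * v) * (f'' v - a ^+ 2 * f v)) V _ _ v hv.
  rewrite f'0 f0 !mulr0 addr0 mulr0 pmulr_rge0 ?expR_gt0//; apply.
    move=> x; have := df x; have := df' x => d1 d2.
    apply: is_derive_eq; rewrite /GRing.scale /=; ring.
  by move=> x hx; rewrite mulr_ge0 ?expR_ge0// subr_ge0 h.
move=> v hv; have := @nondecreasing_from0 (fun v => expR (a * v) * f v)
     (fun v => expR (a * v) * (f' v + a * f v)) V _ _ v hv.
rewrite f0 !mulr0 pmulr_rge0 ?expR_gt0//; apply.
  move=> x; have := df x => d1.
  apply: is_derive_eq; rewrite /GRing.scale /=; ring.
by move=> x hx; rewrite mulr_ge0 ?expR_ge0// Y0.
Qed.

(** The coefficients c_k in cosh(a v) = sum_k c_k sin(v)^(2k); the recursion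
    c_(k+1) (2k+1)(2k+2) = c_k (4k^2 + a^2) expresses that the series solves
    y'' = a^2 y. *)
Fixpoint cosh_coef a (k : nat) : R :=
  if k is j.+1 then
    cosh_coef a j * ((j.*2)%:R ^+ 2 + a ^+ 2) / ((j.*2.+1)%:R * (j.*2.+2)%:R)
  else 1.

Lemma cosh_coef_ge0 a k : 0 <= cosh_coef a k.
Proof.
elim: k => [|k IH] /=; first exact: ler01.
by rewrite divr_ge0 ?mulr_ge0 ?ler0n// addr_ge0// sqr_ge0.
Qed.

Lemma cosh_coefS a k : cosh_coef a k.+1 * ((k.*2.+1)%:R * (k.*2.+2)%:R) =
  cosh_coef a k * ((k.*2)%:R ^+ 2 + a ^+ 2).
Proof. by rewrite /= divfK// mulf_neq0// pnatr_eq0. Qed.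

Arguments cosh_coef : simpl never.

(* The partial sum up to sin^(2N) and its first two derivatives.  The constant
   term is kept apart so that no exponent is a truncated subtraction. *)
Let S a N v := 1 + \sum_(0 <= k < N) cosh_coef a k.+1 * sin v ^+ (k.*2.+2).
Let S' a N v := \sum_(0 <= k < N) cosh_coef a k.+1 *
  ((k.*2.+2)%:R * sin v ^+ (k.*2.+1) * cos v).
Let S'' a N v := \sum_(0 <= k < N) cosh_coef a k.+1 *
  ((k.*2.+2)%:R * ((k.*2.+1)%:R * sin v ^+ k.*2 * cos v ^+ 2 - sin v ^+ k.*2.+2)).

Lemma is_derive_sum_nat (F F' : nat -> R -> R) N v :
  (forall k, is_derive v 1 (F k) (F' k v)) ->
  is_derive v 1 (fun v => \sum_(0 <= k < N) F k v) (\sum_(0 <= k < N) F' k v).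
Proof.
move=> h; elim: N => [|N IH].
  rewrite big_nil; have -> : (fun v => \sum_(0 <= k < 0) F k v) = cst (0 : R).
    by apply/funext => w; rewrite big_nil.
  exact: is_derive_cst.
rewrite (@big_nat_recr _ _ _ N 0 (fun k => F' k v))//=.
have -> : (fun v => \sum_(0 <= k < N.+1) F k v) =
    (fun v => \sum_(0 <= k < N) F k v) + F N.
  by apply/funext => w; rewrite (@big_nat_recr _ _ _ N 0 (fun k => F k w)).
exact: is_deriveD.
Qed.

Lemma is_derive_sinX n v :
  is_derive v 1 (fun w : R => sin w ^+ n.+1) (n.+1%:R * sin v ^+ n * cos v).
Proof.
have -> : (fun w : R => sin w ^+ n.+1) = sin ^+ n.+1.
  by apply/funext => w; rewrite fctE.
by apply: is_derive_eq; rewrite /GRing.scale /=.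
Qed.

Lemma is_derive_S a N v : is_derive v 1 (S a N) (S' a N v).
Proof.
rewrite /S /S' -[X in is_derive _ _ _ X]add0r; apply: is_deriveD.
apply: (@is_derive_sum_nat (fun k v => cosh_coef a k.+1 * sin v ^+ (k.*2.+2))
  (fun k v => cosh_coef a k.+1 * (k.*2.+2%:R * sin v ^+ k.*2.+1 * cos v))) => k.
have d := is_derive_sinX k.*2.+1 v.
apply: is_derive_eq; rewrite /GRing.scale /=; ring.
Qed.

Lemma is_derive_S' a N v : is_derive v 1 (S' a N) (S'' a N v).
Proof.
rewrite /S' /S''.
apply: (@is_derive_sum_nat (fun k v => cosh_coef a k.+1 *
   (k.*2.+2%:R * sin v ^+ k.*2.+1 * cos v))
  (fun k v => cosh_coef a k.+1 * (k.*2.+2%:R *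
    (k.*2.+1%:R * sin v ^+ k.*2 * cos v ^+ 2 - sin v ^+ k.*2.+2)))) => k.
have d := is_derive_sinX k.*2 v; move: (cosh_coef a k.+1) => c.
apply: is_derive_eq; rewrite /GRing.scale /= !exprS; ring.
Qed.

(** Applied to a partial sum, D^2 - a^2 leaves a single term; the others
    telescope by the recursion for the coefficients. *)
Lemma S_ode a N v : S'' a N v - a ^+ 2 * S a N v =
  - (cosh_coef a N.+1 * ((N.*2.+1)%:R * (N.*2.+2)%:R)) * sin v ^+ N.*2.
Proof.
elim: N => [|N IH].
  by rewrite cosh_coefS /S'' /S !big_nil /= /cosh_coef double0 mulr0n expr0; ring.
have -> : S'' a N.+1 v - a ^+ 2 * S a N.+1 v = (S'' a N v - a ^+ 2 * S a N v) +
  cosh_coef a N.+1 * ((N.*2.+2)%:R * ((N.*2.+1)%:R * sin v ^+ N.*2 * cos v ^+ 2 - sin v ^+ N.*2.+2)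
   - a ^+ 2 * sin v ^+ N.*2.+2).
  by rewrite /S'' /S !big_nat_recr//=; ring.
rewrite IH (cosh_coefS a N.+1) doubleS cos2sin2.
move: (cosh_coef a N.+1) => c; rewrite !exprS -!natr1; ring.
Qed.

Let cosh_is_derive a v : is_derive v 1 (fun v => cosh (a * v)) (a * sinh (a * v)).
Proof.
rewrite /cosh /sinh; apply: is_derive_eq; rewrite /GRing.scale /=; ring.
Qed.

Let sinh_is_derive a v : is_derive v 1 (fun v => a * sinh (a * v)) (a ^+ 2 * cosh (a * v)).
Proof.
rewrite /cosh /sinh; apply: is_derive_eq; rewrite /GRing.scale /=; ring.
Qed.

Lemma cosh0 : cosh (0 : R) = 1.
Proof. by rewrite /cosh oppr0 expR0; lra. Qed.
Lemma sinh0 : sinh (0 : R) = 0.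
Proof. by rewrite /sinh oppr0 expR0; lra. Qed.

Let S0 a N : S a N 0 = 1.
Proof. by rewrite /S sin0 big1 ?addr0// => i _; rewrite expr0n mulr0. Qed.
Let S'0 a N : S' a N 0 = 0.
Proof. by rewrite /S' sin0 big1// => i _; rewrite expr0n/= mulr0 mul0r mulr0. Qed.

(** The partial sums stay below cosh(a v), as the remainder satisfies the
    hypotheses of [subsolution_ge0]. *)
Lemma S_le_cosh a N v : 0 <= v <= pi / 2 -> S a N v <= cosh (a * v).
Proof.
move=> hv; rewrite -subr_ge0.
apply: (@subsolution_ge0 a (fun v => cosh (a * v) - S a N v)
  (fun v => a * sinh (a * v) - S' a N v)
  (fun v => a ^+ 2 * cosh (a * v) - S'' a N v) (pi / 2) _ _ _ _ _ v hv).
- move=> x; apply: is_deriveB; [exact: cosh_is_derive | exact: is_derive_S].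
- move=> x; apply: is_deriveB; [exact: sinh_is_derive | exact: is_derive_S'].
- by rewrite mulr0 cosh0 S0 subrr.
- by rewrite mulr0 sinh0 S'0 mulr0 subrr.
move=> x hx; rewrite mulrBr lerD2l lerN2 -subr_le0 S_ode mulNr oppr_le0.
apply: mulr_ge0; first by rewrite mulr_ge0 ?cosh_coef_ge0.
by rewrite exprn_even_ge0//= odd_double.
Qed.

(** The remainder is at most the solution M (cosh(a v) - 1)/a^2 of
    y'' - a^2 y = M, where M bounds on [0, V] the term left by [S_ode]. *)
Lemma cosh_le_S a N v V : a != 0 -> 0 <= v <= V -> V <= pi / 2 ->
  cosh (a * v) - S a N v <=
  (cosh_coef a N.+1 * ((N.*2.+1)%:R * (N.*2.+2)%:R)) * sin V ^+ N.*2 *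
  ((cosh (a * v) - 1) / a ^+ 2).
Proof.
move=> a0 hv hV; rewrite -subr_ge0; set M := _ * sin V ^+ _.
apply: (@subsolution_ge0 a
  (fun v => M * ((cosh (a * v) - 1) / a ^+ 2) - (cosh (a * v) - S a N v))
  (fun v => M / a ^+ 2 * (a * sinh (a * v)) - (a * sinh (a * v) - S' a N v))
  (fun v => M * cosh (a * v) - (a ^+ 2 * cosh (a * v) - S'' a N v)) V _ _ _ _ _ v hv).
- move=> x; have h1 := cosh_is_derive a x; have h2 := is_derive_S a N x.
  by apply: is_derive_eq; rewrite /GRing.scale /=; field.
- move=> x; have h1 := sinh_is_derive a x; have h2 := is_derive_S' a N x.
  by apply: is_derive_eq; rewrite /GRing.scale /=; field.
- by rewrite mulr0 cosh0 S0 !subrr mul0r mulr0 subrr.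
- by rewrite mulr0 sinh0 S'0 !mulr0 !subrr.
move=> x /andP[x0 xV].
have -> : a ^+ 2 * (M * ((cosh (a * x) - 1) / a ^+ 2) - (cosh (a * x) - S a N x)) =
  M * (cosh (a * x) - 1) - a ^+ 2 * cosh (a * x) + a ^+ 2 * S a N x.
  by field.
rewrite -subr_ge0.
have -> : M * cosh (a * x) - (a ^+ 2 * cosh (a * x) - S'' a N x) -
  (M * (cosh (a * x) - 1) - a ^+ 2 * cosh (a * x) + a ^+ 2 * S a N x) =
  M + (S'' a N x - a ^+ 2 * S a N x) by ring.
have pi0 := pi_gt0 R.
rewrite S_ode mulNr subr_ge0 /M; apply: ler_wpM2l.
  by rewrite mulr_ge0 ?cosh_coef_ge0// mulr_ge0.
rewrite lerXn2r// ?nnegrE ?sin_ge0_pi//; try lra.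
by rewrite leNgt ltr_sin ?in_itv/= -?leNgt//; lra.
Qed.

Lemma natmul_geometric_le (t : R) n : 0 <= t < 1 -> n.+1%:R * t ^+ n <= (1 - t)^-1.
Proof.
move=> /andP[t0 t1].
have d : 0 < 1 - t by rewrite subr_gt0.
rewrite -[_^-1]mul1r ler_pdivlMr//.
have h : n.+1%:R * t ^+ n <= \sum_(i < n.+1) t ^+ i.
  rewrite -[n.+1 in X in X <= _]card_ord -sum1_card natr_sum mulr_suml.
  apply: ler_sum => i _; rewrite mul1r ler_wiXn2l// ?(ltW t1)//.
  by rewrite -ltnS.
apply: le_trans (ler_wpM2r (ltW d) h) _.
rewrite mulrC -[1 - t]opprB mulNr -subrX1 opprB lerBlDr lerDl.
by rewrite exprn_ge0.
Qed.

Let S_series a v N : S a N v = series (fun k => cosh_coef a k * (sin v ^+ 2) ^+ k) N.+1.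
Proof.
rewrite /S /series /= big_nat_recl//= expr0 mul1r; congr (_ + _).
by apply: eq_bigr => i _; rewrite -exprM mul2n doubleS.
Qed.

(** For v < pi/2 the remainder is O(N^2 sin(v)^(2N)), which tends to 0 since the
    coefficients c_k are bounded by cosh(a pi/2). *)
Lemma cvg_cosh_series_lt a v : a != 0 -> 0 <= v < pi / 2 ->
  series (fun k => cosh_coef a k * (sin v ^+ 2) ^+ k) @ \oo --> cosh (a * v).
Proof.
move=> a0 /andP[v0 v1]; rewrite -cvg_shiftS.
pose K := cosh (a * (pi / 2)).
have cK k : cosh_coef a k.+1 <= K.
  have pi2 : (0 : R) <= (pi / 2 : R) <= pi / 2 by have := pi_ge0 R; lra.
  apply: le_trans (S_le_cosh a k.+1 pi2).
  rewrite /S sin_pihalf big_nat_recr//= expr1n mulr1 addrA lerDr.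
  by rewrite addr_ge0// sumr_ge0// => i _; rewrite expr1n mulr1 cosh_coef_ge0.
have s0 : 0 <= sin v by rewrite sin_ge0_pi// v0; have := pi_gt0 R; lra.
have s1 : sin v < 1.
  rewrite -sin_pihalf ltr_sin// in_itv/=; have := pi_gt0 R; lra.
(* With t^2 = sin v, the factor sin(v)^(2N) is t^(4N): two factors t^N absorb
   the polynomial growth, a third one gives the decay. *)
pose t := Num.sqrt (sin v).
have t2 : t ^+ 2 = sin v by rewrite sqr_sqrtr.
have t0 : 0 <= t by exact: sqrtr_ge0.
have t1 : t < 1 by rewrite -(@ltr_pXn2r _ 2)// ?nnegrE// t2 expr1n.
pose C := K * 4 * (1 - t)^-1 ^+ 2 * ((cosh (a * v) - 1) / a ^+ 2).
have ch : 0 <= (cosh (a * v) - 1) / a ^+ 2.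
  rewrite divr_ge0 ?exprn_even_ge0// subr_ge0.
  have := @S_le_cosh a 0 v; rewrite /S big_nil addr0; apply.
  by rewrite v0 ltW.
have bnd N : cosh (a * v) - S a N v <= C * t ^+ N.
  apply: le_trans (@cosh_le_S a N v v a0 _ _) _; rewrite ?v0 ?lexx ?(ltW v1)//.
  rewrite /C -[leRHS]mulrAC ler_wpM2r// -[leLHS]mulrA -[leRHS]mulrA -[leRHS]mulrA.
  rewrite ler_pM ?cosh_coef_ge0 ?mulr_ge0 ?exprn_ge0// ?cK//.
  have e : sin v ^+ N.*2 = t ^+ N * t ^+ N * (t ^+ N * t ^+ N).
    by rewrite -t2 -exprM mul2n -!exprD !addnn.
  have h := @natmul_geometric_le t N; rewrite t0 t1 in h; have {}h := h isT.
  have tN : 0 <= t ^+ N by rewrite exprn_ge0.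
  have tN1 : t ^+ N <= 1 by rewrite exprn_ile1// ltW.
  have n1 : (N.*2.+1%:R : R) <= 2 * N.+1%:R by rewrite -natrM ler_nat mul2n doubleS ltnW.
  have n2 : (N.*2.+2%:R : R) = 2 * N.+1%:R by rewrite -natrM mul2n doubleS.
  rewrite e n2; set A := t ^+ N in h tN tN1 *; set n := N.+1%:R in h n1 *.
  have n0 : 0 <= n by rewrite ler0n.
  have D0 : 0 <= n * A by rewrite mulr_ge0.
  apply: (@le_trans _ _ (4 * (n * A) ^+ 2 * A)).
    have -> : N.*2.+1%:R * (2 * n) * (A * A * (A * A)) =
      (N.*2.+1%:R * A) * (2 * (n * A) * A) * A by ring.
    apply: ler_wpM2r => //.
    have -> : 4 * (n * A) ^+ 2 = (2 * n * A) * (2 * (n * A) * 1) by ring.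
    apply: ler_pM => //; rewrite ?mulr_ge0//.
      by rewrite ler_wpM2r.
    by rewrite ler_wpM2l// mulr_ge0.
  rewrite [leRHS]mulrA; apply: ler_wpM2r => //; apply: ler_wpM2l => //.
  by rewrite lerXn2r// ?nnegrE// invr_ge0; lra.
apply: (@squeeze_cvgr _ _ _ _ (fun N => cosh (a * v) - C * t ^+ N) (fun=> cosh (a * v))).
- apply: nearW => N /=; rewrite -S_series S_le_cosh ?v0 ?(ltW v1)// andbT.
  by have := bnd N; rewrite lerBlDr lerBlDr addrC.
- rewrite -[X in _ --> X]subr0; apply: cvgB; first exact: cvg_cst.
  rewrite -(mulr0 C); apply: cvgM; first exact: cvg_cst.
  by apply: cvg_expr; rewrite ger0_norm.
- exact: cvg_cst.
Qed.

(** At the endpoint pi/2 the sum is the limit of the sums at v < pi/2, since all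
    terms are nonnegative and increase with v. *)
Lemma cvg_cosh_series a v : a != 0 -> 0 <= v <= pi / 2 ->
  series (fun k => cosh_coef a k * (sin v ^+ 2) ^+ k) @ \oo --> cosh (a * v).
Proof.
move=> a0 /andP[v0]; rewrite le_eqVlt => /predU1P[->{v v0}|v1]; last first.
  by apply: cvg_cosh_series_lt => //; rewrite v0.
have pi0 := pi_gt0 R.
set u := series _.
have nd : {homo u : n m / (n <= m)%N >-> n <= m}.
  apply/nondecreasing_seqP => n; rewrite /u /series /= big_nat_recr//= lerDl.
  by rewrite mulr_ge0 ?cosh_coef_ge0// exprn_ge0// exprn_even_ge0.
have ub N : u N <= cosh (a * (pi / 2)).
  apply: le_trans (nd _ _ (leqnSn N)) _.
  by rewrite /u -S_series S_le_cosh//; lra.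
have cu : cvgn u.
  by apply: nondecreasing_is_cvgn => //; exists (cosh (a * (pi / 2))) => _ [N _ <-].
suff -> : cosh (a * (pi / 2)) = limn u by [].
apply/eqP; rewrite eq_le; apply/andP; split; last first.
  by apply: limr_le => //; exact: nearW.
have cc : continuous (fun v : R => cosh (a * v)).
  move=> x; apply: differentiable_continuous; apply/derivable1_diffP.
  exact: (@ex_derive _ _ _ _ _ _ _ (cosh_is_derive a x)).
have cl : cosh (a * w) @[w --> (pi / 2)^'-] --> cosh (a * (pi / 2)).
  exact: cvg_at_left_filter (cc _).
rewrite -(cvg_lim _ cl)//; apply: limr_le; first by apply/cvg_ex; eexists; exact: cl.
near=> w.
have w1 : w < pi / 2 by near: w; exact: nbhs_left_lt.
have w0 : 0 < w by near: w; apply: nbhs_left_gt; rewrite divr_gt0.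
have hw := @cvg_cosh_series_lt a w a0; rewrite (ltW w0) w1 in hw.
have {}hw := hw isT.
rewrite -(cvg_lim _ hw)//; apply: lim_series_le => //.
  by apply/cvg_ex; eexists; exact: hw.
move=> k; rewrite ler_wpM2l ?cosh_coef_ge0// lerXn2r ?nnegrE ?exprn_even_ge0//.
rewrite lerXn2r ?nnegrE ?sin_ge0_pi//; try lra.
by rewrite sin_pihalf sin_le1.
Unshelve. all: by end_near. Qed.

End CoshSeries.

(** * The function h as a power series in the coordinate x *)

Section Subordination.
Context {R : realType}.
Implicit Types (lam t : R).

(** The coordinate x(t) = cos^2(pi t): the real part of e(t), rescaled to
    [0, 1]. *)
Definition circle_abscissa t : R := (1 + cos (2 * pi * t)) / 2.

Lemma circle_abscissa_itv t : 0 <= circle_abscissa t <= 1.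
Proof.
rewrite /circle_abscissa; have := cos_le1 (2 * pi * t).
have := cos_geN1 (2 * pi * t); lra.
Qed.

Lemma circle_abscissa_onto x : 0 <= x <= 1 -> exists t, circle_abscissa t = x.
Proof.
move=> hx; exists (acos (2 * x - 1) / (2 * pi)).
have pi0 : 2 * pi != 0 :> R by rewrite mulf_neq0// gt_eqF// pi_gt0.
rewrite /circle_abscissa [2 * pi * _]mulrC divfK// acosK ?in_itv/=; lra.
Qed.

Lemma cosD2pin (x : R) (n : nat) : cos (x + 2 * pi * n%:R) = cos x.
Proof.
rewrite -[RHS](periodicn (@cosD2pi R) n); congr (cos (_ + _)).
by rewrite -[RHS]mulr_natr mulr_natl.
Qed.

Lemma cosD2piz (x : R) (m : int) : cos (x + 2 * pi * m%:~R) = cos x.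
Proof.
case: (intP m) => [|n|n]; first by rewrite mulr0z mulr0 addr0.
  by rewrite -pmulrn cosD2pin.
by rewrite mulrNz mulrN -pmulrn -[LHS](cosD2pin _ n.+1) subrK.
Qed.

(** The fractional part of [t], centered: the argument of cosh in [f_]. *)
Definition centered_frac t : R := t - (Num.floor t)%:~R - 2^-1.

Lemma centered_frac_le t : `|centered_frac t| <= 2^-1.
Proof.
have := floor_itv t; rewrite intrD ler_norml /centered_frac => /andP[h1 h2]; lra.
Qed.

Lemma circle_abscissa_sin t : circle_abscissa t = sin (pi * `|centered_frac t|) ^+ 2.
Proof.
have -> : circle_abscissa t = (1 - cos (2 * (pi * centered_frac t))) / 2.
  rewrite /circle_abscissa -[in LHS](subrK (Num.floor t)%:~R t) mulrDr cosD2piz.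
  rewrite /centered_frac.
  have -> : 2 * pi * (t - (Num.floor t)%:~R) =
     2 * (pi * (t - (Num.floor t)%:~R - 2^-1)) + pi by field.
  by rewrite cosDpi.
have -> : sin (pi * `|centered_frac t|) ^+ 2 = sin (pi * centered_frac t) ^+ 2.
  have [_|_] := ger0P (centered_frac t) => //.
  by rewrite mulrN sinN sqrrN.
rewrite mulr_natl cos_mulr2n cos2sin2; lra.
Qed.

Lemma coshN (x : R) : cosh (- x) = cosh x.
Proof. by rewrite /cosh opprK addrC. Qed.

Lemma cosh_norm (x : R) : cosh `|x| = cosh x.
Proof. by have [_|_] := ger0P x => //; rewrite coshN. Qed.

Lemma sinh_gt0 (x : R) : 0 < x -> 0 < sinh x.
Proof.
by move=> x0; rewrite /sinh divr_gt0// subr_gt0 ltr_expR; lra.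
Qed.

Lemma continuous_cosh : continuous (@cosh R).
Proof.
move=> x; apply: cvgM; last exact: cvg_cst.
apply: cvgD; first exact: continuous_expR.
by apply: (@continuous_comp _ _ _ -%R expR); [exact: opp_continuous|exact: continuous_expR].
Qed.

Lemma continuous_sinh : continuous (@sinh R).
Proof.
move=> x; apply: cvgM; last exact: cvg_cst.
apply: cvgB; first exact: continuous_expR.
by apply: (@continuous_comp _ _ _ -%R expR); [exact: opp_continuous|exact: continuous_expR].
Qed.

(** The coefficient of x^(k+1) in f_lambda(t) - f_lambda(1/2).  The constant
    term cancels, as x vanishes at 1/2. *)
Definition f_coef lam k : R := cosh_coef (lam / pi) k.+1 / sinh (lam / 2).

Lemma f_coef_ge0 lam k : 0 < lam -> 0 <= f_coef lam k.
Proof.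
move=> l0; rewrite divr_ge0 ?cosh_coef_ge0// ltW// sinh_gt0//; lra.
Qed.

Lemma f_half lam : f_ lam 2^-1 = (sinh (lam / 2))^-1.
Proof.
rewrite /f_; have -> : Num.floor (2^-1 : R) = 0.
  by apply/eqP; rewrite floor_eq; apply/andP; split; rewrite ?add0r; lra.
by rewrite mulr0z subr0 subrr mulr0 cosh0 mul1r.
Qed.

Lemma cvg_f_series lam t : 0 < lam ->
  series (fun k => f_coef lam k * circle_abscissa t ^+ k.+1) @ \oo -->
  f_ lam t - f_ lam 2^-1.
Proof.
move=> l0; set s := sinh (lam / 2).
have pi0 := pi_gt0 R.
have u0 : 0 <= `|centered_frac t| by [].
have a0 : lam / pi != 0 by rewrite mulf_neq0// ?invr_eq0 gt_eqF.
have hv : 0 <= pi * `|centered_frac t| <= pi / 2.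
  apply/andP; split; first by rewrite mulr_ge0// ltW.
  by apply: ler_wpM2l; [exact: ltW|exact: centered_frac_le].
have := cvg_cosh_series a0 hv; rewrite -circle_abscissa_sin.
have -> : lam / pi * (pi * `|centered_frac t|) = `|lam * centered_frac t|.
  by rewrite normrM (gtr0_norm l0) mulrA divfK// gt_eqF.
rewrite cosh_norm -cvg_shiftS => h.
have -> : series (fun k => f_coef lam k * circle_abscissa t ^+ k.+1) =
  (fun n => (series (fun k => cosh_coef (lam / pi) k * circle_abscissa t ^+ k) n.+1 - 1) / s).
  apply/funext => n; rewrite seriesSl expr0 mulr1 /= {1}/cosh_coef addrC addKr.
  rewrite /series /= mulr_suml; apply: eq_bigr => i _.
  by rewrite /f_coef mulrAC.
have -> : f_ lam t - f_ lam 2^-1 = (cosh (lam * centered_frac t) - 1) / s.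
  by rewrite f_half /f_ mulrBl mul1r.
apply: cvgM; last exact: cvg_cst.
by apply: cvgB; [exact: h|exact: cvg_cst].
Qed.

Lemma f_sub_half_ge0 lam t : 0 < lam -> 0 <= f_ lam t - f_ lam 2^-1.
Proof.
move=> l0; have h := cvg_f_series (t := t) l0.
rewrite -(cvg_lim _ h)//; apply: limr_ge; first by apply/cvg_ex; eexists; exact: h.
apply: nearW => n; apply: sumr_ge0 => i _; rewrite mulr_ge0 ?f_coef_ge0// exprn_ge0//.
by case/andP: (circle_abscissa_itv t).
Qed.

Let D : set (measurableTypeR R) := `]0%R, +oo[%classic.

Lemma measurable_pos_ray : measurable D. Proof. exact: measurable_itv. Qed.

Lemma measurable_fun_pos_ray (g : R -> R) :
  (forall lam, 0 < lam -> {for lam, continuous g}) ->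
  measurable_fun D (g : measurableTypeR R -> R).
Proof.
move=> h; apply: open_continuous_measurable_fun; first exact: interval_open.
by move=> x; rewrite inE /D /= in_itv/= andbT => x0; exact: h.
Qed.

Lemma continuous_sinh_halfV lam : 0 < lam -> {for lam, continuous (fun l : R => (sinh (l / 2))^-1)}.
Proof.
move=> l0; apply: cvgV; first by rewrite gt_eqF// sinh_gt0//; lra.
apply: (@continuous_comp _ _ _ (fun l : R => l / 2) sinh); last exact: continuous_sinh.
exact: mulrr_continuous.
Qed.

Lemma measurable_f_coef k : measurable_fun D (fun lam : measurableTypeR R => f_coef lam k).
Proof.
apply: measurable_fun_pos_ray => lam l0; apply: cvgM; last exact: continuous_sinh_halfV.
elim: k.+1 => [|j IH]; first exact: cvg_cst.
rewrite /cosh_coef -/cosh_coef; apply: cvgM; last exact: cvg_cst.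
apply: cvgM; first exact: IH.
apply: cvgD; first exact: cvg_cst.
have c : l / pi @[l --> lam] --> lam / pi by apply: cvgM; [exact: cvg_id|exact: cvg_cst].
by under eq_fun do rewrite expr2; rewrite expr2; apply: cvgM.
Qed.

Lemma measurable_f_sub_half t :
  measurable_fun D (fun lam : measurableTypeR R => f_ lam t - f_ lam 2^-1).
Proof.
have -> : (fun lam => f_ lam t - f_ lam 2^-1) =
    (fun lam => (cosh (lam * centered_frac t) - 1) * (sinh (lam / 2))^-1).
  by apply/funext => l; rewrite f_half /f_ mulrBl mul1r.
apply: measurable_fun_pos_ray => lam l0; apply: cvgM; last exact: continuous_sinh_halfV.
apply: cvgB; last exact: cvg_cst.
apply: (@continuous_comp _ _ _ (fun l : R => l * centered_frac t) cosh);
  last exact: continuous_cosh.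
exact: mulrr_continuous.
Qed.

Variable sigma : {measure set (measurableTypeR R) -> \bar R}.

(** The coefficient of x^(k+1) in h_sigma, possibly infinite. *)
Definition h_coef k : \bar R := (\int[sigma]_(lam in D) (f_coef lam k)%:E)%E.

Lemma h_coef_ge0 k : (0 <= h_coef k)%E.
Proof.
apply: integral_ge0 => x; rewrite /D /= in_itv/= andbT => x0.
by rewrite lee_fin f_coef_ge0.
Qed.

Lemma cvg_EFin_seq (u : nat -> R) l :
  u @ \oo --> l -> (fun n => (u n)%:E) @ \oo --> l%:E.
Proof. by move=> h; apply: cvg_EFin; [exact: nearW | exact: h]. Qed.

(** Monotone convergence: the series may be integrated term by term. *)
Lemma h_series t : h_ sigma t =
  (\sum_(0 <= k <oo) h_coef k * (circle_abscissa t ^+ k.+1)%:E)%E.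
Proof.
have x0 : 0 <= circle_abscissa t by case/andP: (circle_abscissa_itv t).
transitivity (\int[sigma]_(lam in D)
   (\sum_(0 <= k <oo) (f_coef lam k * circle_abscissa t ^+ k.+1)%:E))%E.
  apply: eq_integral => lam; rewrite inE /D /= in_itv/= andbT => l0.
  apply/esym/cvg_lim => //.
  have h := cvg_EFin_seq (cvg_f_series (t := t) l0).
  by under eq_fun do rewrite sumEFin; exact: h.
rewrite integral_nneseries//.
- apply: eq_eseriesr => k _; under eq_integral do rewrite EFinM muleC.
  rewrite ge0_integralZl_EFin ?exprn_ge0//; first by rewrite muleC.
  + exact: measurable_pos_ray.
  + by move=> x; rewrite /D /= in_itv/= andbT => l0; rewrite lee_fin f_coef_ge0.
  + by apply/measurable_EFinP; exact: measurable_f_coef.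
- exact: measurable_pos_ray.
- move=> k; apply/measurable_EFinP; apply: measurable_funM => //; exact: measurable_f_coef.
- move=> k x; rewrite /D /= in_itv/= andbT => l0.
  by rewrite lee_fin mulr_ge0 ?f_coef_ge0 ?exprn_ge0.
Qed.

(** The real coefficients of h_sigma, starting with the zero constant term; they
    are meaningful once h_sigma is finite at some point where x > 0. *)
Definition h_power_coef k : R := if k is j.+1 then fine (h_coef j) else 0.

Lemma h_power_coef_ge0 k : 0 <= h_power_coef k.
Proof. by case: k => [|k]//=; rewrite fine_ge0// h_coef_ge0. Qed.

Section Finite.
Variable t0 : R.
Hypotheses (t0pos : 0 < circle_abscissa t0) (ht0 : (h_ sigma t0 < +oo)%E).

Lemma h_coef_fin k : h_coef k = (h_power_coef k.+1)%:E.
Proof.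
rewrite /h_power_coef fineK// ge0_fin_numE ?h_coef_ge0// ltey.
apply/eqP => hk; move: ht0; rewrite h_series.
rewrite (@nneseries_pinfty _ _ _ k)//.
  by move=> n _; rewrite mule_ge0 ?h_coef_ge0// lee_fin exprn_ge0// ltW.
by rewrite hk gt0_mulye// lte_fin exprn_gt0.
Qed.

Lemma h_partial_sum t N :
  ((series (fun k => h_power_coef k * circle_abscissa t ^+ k) N)%:E <= h_ sigma t)%E.
Proof.
have x0 : 0 <= circle_abscissa t by case/andP: (circle_abscissa_itv t).
rewrite h_series; apply: (@le_trans _ _
   (\sum_(0 <= k < N) h_coef k * (circle_abscissa t ^+ k.+1)%:E)%E); last first.
  by apply: nneseries_lim_ge => n _ _; rewrite mule_ge0 ?h_coef_ge0// lee_fin exprn_ge0.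
under eq_bigr do rewrite h_coef_fin -EFinM.
rewrite sumEFin lee_fin; case: N => [|N]; first by rewrite /series /= !big_nil.
rewrite seriesSl mul0r add0r /series /= big_nat_recr//= lerDl.
by rewrite mulr_ge0 ?exprn_ge0//; exact: (h_power_coef_ge0 N.+1).
Qed.

Lemma h_power_series t : (h_ sigma t < +oo)%E ->
  cvgn (series (fun k => h_power_coef k * circle_abscissa t ^+ k)) /\
  h_ sigma t = (power_series h_power_coef (circle_abscissa t))%:E.
Proof.
move=> ht.
have x0 : 0 <= circle_abscissa t by case/andP: (circle_abscissa_itv t).
have h0 : (0 <= h_ sigma t)%E.
  apply: integral_ge0 => x; rewrite /= in_itv/= andbT => l0.
  by rewrite lee_fin f_sub_half_ge0.
have hfin : h_ sigma t \is a fin_num by rewrite ge0_fin_numE.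
set u := series _.
have cu : cvgn u.
  apply: nondecreasing_is_cvgn.
    apply/nondecreasing_seqP => n; rewrite /u /series /= big_nat_recr//= lerDl.
    by rewrite mulr_ge0 ?h_power_coef_ge0// exprn_ge0.
  exists (fine (h_ sigma t)) => _ [N _ <-].
  by rewrite -lee_fin fineK//; exact: h_partial_sum.
split => //.
rewrite /power_series -/u -EFin_lim// h_series; apply/cvg_lim => //.
have c : (u n.+1)%:E @[n --> \oo] --> limn (EFin \o u).
  by rewrite (EFin_lim cu); apply: cvg_EFin_seq; rewrite cvg_shiftS.
rewrite (_ : (fun n => _) = (fun n => (u n.+1)%:E))//.
apply/funext => n; rewrite /u seriesSl mul0r add0r /series /= -sumEFin.
by apply: eq_bigr => i _; rewrite h_coef_fin EFinM.
Qed.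

End Finite.

End Subordination.

(** * Finiteness and one-sided interpolation of h *)

Section Interpolation.
Context {R : realType}.
Variable sigma : {measure set (measurableTypeR R) -> \bar R}.
Implicit Types (lam t : R).

Lemma circle_abscissa0 : circle_abscissa (0 : R) = 1.
Proof. by rewrite /circle_abscissa mulr0 cos0; lra. Qed.

Lemma expRN_le (z : R) : 1 - expR (- z) <= z.
Proof. by have := expR_ge1Dx (- z); lra. Qed.

(** Integrability bound away from the integers: with w < 1/2 the distance of t
    to the nearest half-integer, the numerator cosh(lambda w) - 1 is
    O(lambda^2 e^(lambda w)) and 1/sinh(lambda/2) is
    O(e^(- lambda/2) (1 + lambda)/lambda). *)
Lemma f_sub_half_le_exp t : circle_abscissa t < 1 ->
  exists a C : R, [/\ 0 < a, 0 <= C & forall lam, 0 < lam ->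
    f_ lam t - f_ lam 2^-1 <= C * (lam * expR (- (a * lam)))].
Proof.
move=> xt; set w := `|centered_frac t|.
have w0 : 0 <= w by exact: normr_ge0.
have w1 : w < 2^-1.
  rewrite lt_neqAle centered_frac_le andbT; apply/eqP => wE.
  by move: xt; rewrite circle_abscissa_sin -/w wE sin_pihalf expr1n ltxx.
pose a := (2^-1 - w) / 2; have a0 : 0 < a by rewrite /a; lra.
exists a, ((1 + a^-1) / 4); split => //.
  by rewrite divr_ge0// addr_ge0// invr_ge0 ltW.
move=> lam l0.
have -> : f_ lam t - f_ lam 2^-1 = (cosh (lam * w) - 1) / sinh (lam / 2).
  rewrite f_half /f_ mulrBl mul1r; congr (_ / _ - _).
  by rewrite -[in LHS]cosh_norm normrM (gtr0_norm l0).
have s0 : 0 < sinh (lam / 2) by rewrite sinh_gt0//; lra.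
rewrite ler_pdivrMr//.
have hc : cosh (lam * w) - 1 <= (lam ^+ 2 / 4) * expR (lam * w) / 2.
  have y0 : 0 <= lam * w by rewrite mulr_ge0// ltW.
  have y1 : lam * w <= lam / 2 by rewrite ler_pM2l// ltW.
  have e1 : cosh (lam * w) - 1 = expR (lam * w) * (1 - expR (- (lam * w))) ^+ 2 / 2.
    rewrite /cosh expRN; set E := expR _; have E0 : E != 0 by rewrite gt_eqF ?expR_gt0.
    by field.
  rewrite e1 ler_wpM2r// mulrC ler_wpM2r ?expR_ge0//.
  have -> : lam ^+ 2 / 4 = (lam / 2) ^+ 2 by field.
  have h1 := expRN_le (lam * w).
  have h2 : expR (- (lam * w)) <= 1 by rewrite -expR0 ler_expR oppr_le0.
  by rewrite lerXn2r ?nnegrE//; lra.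
apply: le_trans hc _.
have hs : lam * expR (lam / 2) <= 2 * (1 + lam) * sinh (lam / 2).
  rewrite /sinh.
  have e2 : expR (- (lam / 2)) = expR (lam / 2) * expR (- lam).
    by rewrite -expRD; congr expR; lra.
  have h : (1 + lam) * expR (- lam) <= 1.
    by rewrite expRN ler_pdivrMr ?expR_gt0// mul1r expR_ge1Dx.
  have E0 := expR_gt0 (lam / 2).
  rewrite e2; set E := expR (lam / 2) in E0 *; set F := expR (- lam) in h *.
  have -> : 2 * (1 + lam) * ((E - E * F) / 2) = E * (1 + lam - (1 + lam) * F) by field.
  by rewrite mulrC ler_pM2l//; lra.
have ha : 1 + lam <= (1 + a^-1) * expR (a * lam).
  have h := expR_ge1Dx (a * lam).
  have : (1 + a^-1) * (1 + a * lam) <= (1 + a^-1) * expR (a * lam).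
    by rewrite ler_wpM2l// addr_ge0// invr_ge0 ltW.
  apply: le_trans.
  have -> : (1 + a^-1) * (1 + a * lam) = 1 + lam + (a^-1 + a * lam).
    by field; rewrite gt_eqF.
  rewrite lerDl; apply: addr_ge0; first by rewrite invr_ge0 ltW.
  by apply: mulr_ge0; exact: ltW.
have e3 : expR (lam * w) = expR (lam / 2) * expR (- (a * lam)) * expR (- (a * lam)).
  by rewrite -!expRD; congr expR; rewrite /a; field.
have e4 : expR (a * lam) * expR (- (a * lam)) = 1 by rewrite -expRD subrr expR0.
rewrite e3; set E := expR (lam / 2) in hs *; set F := expR (- (a * lam)) in e4 *.
set G := expR (a * lam) in ha e4; set S := sinh _ in hs s0 *.
have F0 : 0 <= F by rewrite expR_ge0.
apply: (@le_trans _ _ (lam / 4 * (1 + lam) * S * (F * F))).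
  have -> : lam ^+ 2 / 4 * (E * F * F) / 2 = lam / 8 * (F * F) * (lam * E) by field.
  have -> : lam / 4 * (1 + lam) * S * (F * F) = lam / 8 * (F * F) * (2 * (1 + lam) * S) by field.
  apply: ler_wpM2l => //; apply: mulr_ge0; last exact: mulr_ge0.
  by rewrite divr_ge0// ltW.
have -> : (1 + a^-1) / 4 * (lam * F) * S = lam / 4 * S * F * ((1 + a^-1) * (G * F)).
  by rewrite e4; field; rewrite gt_eqF.
have -> : lam / 4 * (1 + lam) * S * (F * F) = lam / 4 * S * F * ((1 + lam) * F) by field.
apply: ler_wpM2l.
  by apply: mulr_ge0 => //; apply: mulr_ge0; [rewrite divr_ge0// ltW|exact: ltW].
by rewrite mulrA ler_wpM2r.
Qed.

(** The bound valid at every point: f_lambda(t) - f_lambda(1/2) is largest at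
    t = 0, where it equals tanh(lambda/4). *)
Lemma f_sub_half_le_frac lam t : 0 < lam ->
  f_ lam t - f_ lam 2^-1 <= 2 * (lam / (1 + lam)).
Proof.
move=> l0.
have h1 := cvg_f_series (t := t) l0; have h2 := cvg_f_series (t := 0) l0.
apply: (@le_trans _ _ (f_ lam 0 - f_ lam 2^-1)).
  rewrite -(cvg_lim _ h1)// -(cvg_lim _ h2)//.
  apply: lim_series_le; try by apply/cvg_ex; eexists; eassumption.
  move=> n; rewrite ler_wpM2l ?f_coef_ge0// circle_abscissa0 expr1n.
  by case/andP: (circle_abscissa_itv t) => x0 x1; rewrite exprn_ile1.
have -> : f_ lam 0 - f_ lam 2^-1 = (cosh (lam / 2) - 1) / sinh (lam / 2).
  rewrite f_half /f_ floor0 mulr0z subr0 sub0r mulrN coshN; ring.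
set z := lam / 2; have z0 : 0 < z by rewrite /z; lra.
have E0 := expR_gt0 (- z); have E1 : expR (- z) < 1 by rewrite -expR0 ltr_expR; lra.
have h3 := expRN_le z.
have -> : (cosh z - 1) / sinh z = (1 - expR (- z)) / (1 + expR (- z)).
  rewrite /cosh /sinh -[expR z]invrK -expRN; set E := expR (- z) in E0 E1 *.
  have Ene : E != 0 by rewrite gt_eqF.
  have : 1 - E ^+ 2 != 0.
    have -> : 1 - E ^+ 2 = (1 - E) * (1 + E) by ring.
    by rewrite mulf_neq0// gt_eqF//; lra.
  rewrite expr2 -mulNr => ne; field; rewrite Ene ne andbT/= gt_eqF//; lra.
apply: (@le_trans _ _ (1 - expR (- z))).
  rewrite ler_pdivrMr; last lra.
  by rewrite mulrDr mulr1 lerDl mulr_ge0//; lra.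
rewrite mulrA ler_pdivlMr; last lra.
rewrite mulrDr mulr1.
have : (1 - expR (- z)) * lam <= 1 * lam by rewrite ler_wpM2r//; lra.
rewrite /z in h3 *; lra.
Qed.

Lemma h_lty_of_exp t :
  (forall a : R, 0 < a -> (\int[sigma]_(lam in `]0%R, +oo[) (lam * expR (- (a * lam)))%:E < +oo)%E) ->
  circle_abscissa t < 1 -> (h_ sigma t < +oo)%E.
Proof.
move=> hs /f_sub_half_le_exp[a [C [a0 C0 hC]]].
apply: (@le_lt_trans _ _ (\int[sigma]_(lam in `]0%R, +oo[) (C * (lam * expR (- (a * lam))))%:E)%E).
  apply: ge0_le_integral.
  - exact: measurable_pos_ray.
  - by move=> x /=; rewrite in_itv/= andbT => l0; rewrite lee_fin f_sub_half_ge0.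
  - by apply/measurable_EFinP; exact: measurable_f_sub_half.
  - apply/measurable_EFinP.
    apply: measurable_fun_pos_ray => lam l0; apply: cvgM; first exact: cvg_cst.
    apply: cvgM; first exact: cvg_id.
    apply: (@continuous_comp _ _ _ (fun l : R => - (a * l)) expR); last exact: continuous_expR.
    by apply: cvgN; apply: cvgM; [exact: cvg_cst|exact: cvg_id].
  - by move=> x /=; rewrite in_itv/= andbT => l0; rewrite lee_fin hC.
under eq_integral do rewrite EFinM.
rewrite ge0_integralZl_EFin//.
- by rewrite lte_mul_pinfty// ?lee_fin// hs.
- by move=> x /=; rewrite in_itv/= andbT => l0; rewrite lee_fin mulr_ge0 ?expR_ge0// ltW.
- apply/measurable_EFinP; apply: measurable_fun_pos_ray => lam l0.
  apply: cvgM; first exact: cvg_id.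
  apply: (@continuous_comp _ _ _ (fun l : R => - (a * l)) expR); last exact: continuous_expR.
  by apply: cvgN; apply: cvgM; [exact: cvg_cst|exact: cvg_id].
Qed.

Lemma h_lty_of_frac t :
  (\int[sigma]_(lam in `]0%R, +oo[) (lam / (1 + lam))%:E < +oo)%E ->
  (h_ sigma t < +oo)%E.
Proof.
move=> hs.
have cf lam : 0 < lam -> {for lam, continuous (fun l : R => l / (1 + l))}.
  move=> l0; apply: cvgM; first exact: cvg_id.
  apply: cvgV; first by rewrite gt_eqF//; lra.
  by apply: cvgD; [exact: cvg_cst|exact: cvg_id].
apply: (@le_lt_trans _ _ (\int[sigma]_(lam in `]0%R, +oo[) (2 * (lam / (1 + lam)))%:E)%E).
  apply: ge0_le_integral.
  - exact: measurable_pos_ray.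
  - by move=> x /=; rewrite in_itv/= andbT => l0; rewrite lee_fin f_sub_half_ge0.
  - by apply/measurable_EFinP; exact: measurable_f_sub_half.
  - apply/measurable_EFinP.
    apply: measurable_fun_pos_ray => lam l0; apply: cvgM; first exact: cvg_cst.
    exact: cf.
  - by move=> x /=; rewrite in_itv/= andbT => l0; rewrite lee_fin f_sub_half_le_frac.
under eq_integral do rewrite EFinM.
rewrite ge0_integralZl_EFin//.
- by rewrite lte_mul_pinfty// lee_fin.
- by move=> x /=; rewrite in_itv/= andbT => l0; rewrite lee_fin divr_ge0//; lra.
- by apply/measurable_EFinP; apply: measurable_fun_pos_ray => lam l0; exact: cf.
Qed.


Lemma circle_abscissa_mid : exists t : R, circle_abscissa t = 2^-1.
Proof. by apply: circle_abscissa_onto; lra. Qed.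

Lemma nonneg_power_series_h :
  (forall t, circle_abscissa t < 1 -> (h_ sigma t < +oo)%E) ->
  nonneg_power_series (h_power_coef sigma).
Proof.
move=> hfin; split => [k|x /andP[x0 x1]]; first exact: h_power_coef_ge0.
have [t0 ht0] := circle_abscissa_mid.
have t0pos : 0 < circle_abscissa t0 by rewrite ht0; lra.
have [t ht] : exists t, circle_abscissa t = x by apply: circle_abscissa_onto; lra.
have f0 : (h_ sigma t0 < +oo)%E by apply: hfin; rewrite ht0; lra.
have ft : (h_ sigma t < +oo)%E by apply: hfin; rewrite ht.
by have [] := h_power_series t0pos f0 ft; rewrite ht.
Qed.

(** If the nodal product is nonnegative, the interpolating polynomial stays below
    h_sigma at the integers too, by monotonicity of the series and continuity
    of the polynomial. *)
Lemma lower_interpolation (s : seq R) :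
  (forall t, circle_abscissa t < 1 -> (h_ sigma t < +oo)%E) ->
  all (fun xi => circle_abscissa xi < 1) s ->
  (forall t, 0 <= \prod_(xi <- s) (circle_abscissa t - circle_abscissa xi)) ->
  exists (p : {poly R}) (b : nat -> R), [/\ (size p <= size s)%N, nonneg_power_series b,
    (forall t, circle_abscissa t < 1 -> h_ sigma t = (p.[circle_abscissa t] +
       (\prod_(xi <- s) (circle_abscissa t - circle_abscissa xi)) *
       power_series b (circle_abscissa t))%:E) &
    (forall t, circle_abscissa t = 1 -> (p.[1]%:E <= h_ sigma t)%E)].
Proof.
move=> hfin hs hw.
have hA := nonneg_power_series_h hfin.
have [t0 ht0] := circle_abscissa_mid.
have t0pos : 0 < circle_abscissa t0 by rewrite ht0; lra.
have f0 : (h_ sigma t0 < +oo)%E by apply: hfin; rewrite ht0; lra.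
have [] := @newton_interpolation R (map circle_abscissa s) _ hA.
  rewrite all_map; apply: sub_all hs => t /= ->.
  by case/andP: (circle_abscissa_itv t) => ->.
move=> p [b [sp hb eqp]]; exists p, b.
rewrite size_map in sp; split => //.
  move=> t ht; have [_ ->] := h_power_series t0pos f0 (hfin t ht).
  rewrite eqp; last by case/andP: (circle_abscissa_itv t) => ->.
  by rewrite big_map.
move=> t ht.
have ple x : 0 <= x < 1 -> (p.[x]%:E <= h_ sigma t)%E.
  move=> hx; have [tx htx] : exists t, circle_abscissa t = x.
    by apply: circle_abscissa_onto; lra.
  apply: (@le_trans _ _ (power_series (h_power_coef sigma) x)%:E).
    rewrite lee_fin eqp// lerDl mulr_ge0//; last exact: power_series_ge0.
    by rewrite big_map -htx.
  have cx : cvgn (series (fun k => h_power_coef sigma k * x ^+ k)) by apply: hA.2.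
  have [->|hne] := eqVneq (h_ sigma t) +oo%E; first exact: leey.
  have ht2 : (h_ sigma t < +oo)%E by rewrite ltey.
  have [ct ->] := h_power_series t0pos f0 ht2.
  rewrite lee_fin ht; rewrite ht in ct; apply: lim_series_le => //.
  move=> k; rewrite ler_wpM2l ?hA.1// expr1n exprn_ile1//; lra.
have [->|hne] := eqVneq (h_ sigma t) +oo%E; first exact: leey.
have h0 : h_ sigma t \is a fin_num.
  rewrite ge0_fin_numE ?ltey//; apply: integral_ge0 => x; rewrite /= in_itv/= andbT => l0.
  by rewrite lee_fin f_sub_half_ge0.
rewrite -(fineK h0) lee_fin.
have cp : p.[x] @[x --> (1 : R)^'-] --> p.[1].
  exact: cvg_at_left_filter (@continuous_horner _ p 1).
rewrite -(cvg_lim _ cp)//; apply: limr_le; first by apply/cvg_ex; eexists; exact: cp.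
near=> x; rewrite -lee_fin fineK//; apply: ple; apply/andP; split.
  by near: x; apply: nbhs_left_ge; lra.
by near: x; exact: nbhs_left_lt.
Unshelve. all: by end_near. Qed.

(** The version with the additional node 0, where x = 1. *)
Lemma upper_interpolation (s : seq R) :
  (forall t, (h_ sigma t < +oo)%E) ->
  all (fun xi => circle_abscissa xi < 1) s ->
  exists (p : {poly R}) (b : nat -> R), [/\ (size p <= (size s).+1)%N, nonneg_power_series b,
    (forall t, circle_abscissa t < 1 -> h_ sigma t = (p.[circle_abscissa t] +
       (\prod_(xi <- 0 :: s) (circle_abscissa t - circle_abscissa xi)) *
       power_series b (circle_abscissa t))%:E) &
    (forall t, circle_abscissa t = 1 -> h_ sigma t = p.[1]%:E)].
Proof.
move=> hfin hs.
have t1 : 0 < circle_abscissa (0 : R) by rewrite circle_abscissa0.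
have f1 := hfin 0.
have [c1 _] := h_power_series t1 f1 f1; rewrite circle_abscissa0 in c1.
have [hq eqq] := horner_step1 (h_power_coef_ge0 sigma) c1.
have [] := @newton_interpolation R (map circle_abscissa s) _ hq.
  rewrite all_map; apply: sub_all hs => t /= ->.
  by case/andP: (circle_abscissa_itv t) => ->.
move=> p [b [sp hb eqp]]; rewrite size_map in sp.
exists ((power_series (h_power_coef sigma) 1)%:P + ('X - 1%:P) * p), b; split => //.
- apply: leq_trans (size_polyD _ _) _; rewrite geq_max; apply/andP; split.
    exact: leq_trans (size_polyC_leq1 _) _.
  apply: leq_trans (size_polyMleq _ _) _.
  by rewrite size_XsubC /=.
- move=> t ht; have [_ ->] := h_power_series t1 f1 (hfin t).
  have hx : 0 <= circle_abscissa t < 1 by rewrite ht andbT; case/andP: (circle_abscissa_itv t).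
  rewrite eqq// eqp// big_cons big_map circle_abscissa0 !hornerE; congr (_%:E); ring.
- move=> t ht; have [_ ->] := h_power_series t1 f1 (hfin t).
  by rewrite ht !hornerE subrr mul0r addr0.
Qed.

End Interpolation.

(** * The parametrization of the unit circle *)

Section ComplexArithmetic.
Context {R : realType}.
Implicit Types (z w : R[i]).

Lemma cReD z w : complex.Re (z + w) = complex.Re z + complex.Re w.
Proof. by case: z w => a b [c d]. Qed.
Lemma cImD z w : complex.Im (z + w) = complex.Im z + complex.Im w.
Proof. by case: z w => a b [c d]. Qed.
Lemma cReM z w : complex.Re (z * w) =
  complex.Re z * complex.Re w - complex.Im z * complex.Im w.
Proof. by case: z w => a b [c d]. Qed.
Lemma cImM z w : complex.Im (z * w) =
  complex.Re z * complex.Im w + complex.Im z * complex.Re w.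
Proof. by case: z w => a b [c d]. Qed.
Lemma cRe_conj z : complex.Re z^* = complex.Re z.
Proof. by case: z. Qed.
Lemma cIm_conj z : complex.Im z^* = - complex.Im z.
Proof. by case: z. Qed.
Lemma eq_ReIm z w : complex.Re z = complex.Re w -> complex.Im z = complex.Im w -> z = w.
Proof. by case: z w => a b [c d] /= -> ->. Qed.

Lemma conj_real (x : R) : (x%:C)%C^* = (x%:C)%C.
Proof. by apply: eq_ReIm; rewrite ?cRe_conj ?cIm_conj //= oppr0. Qed.

Lemma cexpD (s t : R) : cexp (s + t) = cexp s * cexp t.
Proof.
by apply: eq_ReIm; rewrite ?cReM ?cImM /= mulrDr ?cosD ?sinD//; ring.
Qed.

Lemma cexpN (t : R) : cexp (- t) = (cexp t)^*.
Proof. by apply: eq_ReIm; rewrite ?cRe_conj ?cIm_conj /= mulrN ?cosN ?sinN. Qed.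

Lemma cexp0 : cexp (0 : R) = 1.
Proof. by apply: eq_ReIm; rewrite /= mulr0 ?cos0 ?sin0. Qed.

Lemma cexpMn (t : R) n : cexp (n%:R * t) = cexp t ^+ n.
Proof.
elim: n => [|n IH]; first by rewrite mul0r cexp0 expr0.
by rewrite -natr1 mulrDl mul1r cexpD IH exprSr.
Qed.

Lemma cexp_mul_conj (t : R) : cexp t * (cexp t)^* = 1.
Proof. by rewrite -cexpN -cexpD subrr cexp0. Qed.

Lemma cexp_neq0 (t : R) : cexp t != 0.
Proof.
by apply/eqP => h; have := cexp_mul_conj t; rewrite h mul0r => /esym/eqP; rewrite oner_eq0.
Qed.

Lemma conj_cexp (t : R) : (cexp t)^* = (cexp t)^-1.
Proof.
by apply: (mulfI (cexp_neq0 t)); rewrite cexp_mul_conj divff// cexp_neq0.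
Qed.

Lemma cexp_onto z : z * z^* = 1 -> exists2 t, 0 <= t < 1 & cexp t = z.
Proof.
move=> hz.
have h : complex.Re z ^+ 2 + complex.Im z ^+ 2 = 1.
  have := congr1 (@complex.Re R) hz; rewrite cReM cRe_conj cIm_conj /=; lra.
have pi0 := pi_gt0 R.
have hx : -1 <= complex.Re z <= 1.
  by rewrite -ler_norml -(@expr_le1 _ 2)// -normrX ger0_norm ?sqr_ge0//;
    have := sqr_ge0 (complex.Im z); lra.
pose a := acos (complex.Re z).
have a0 : 0 <= a by exact: acos_ge0.
have api : a <= pi by exact: acos_lepi.
have ca : cos a = complex.Re z by apply: acosK; rewrite in_itv.
have sa : sin a = `|complex.Im z|.
  rewrite sin_acos// -sqrtr_sqr; congr Num.sqrt; lra.
have dv (x : R) : 2 * pi * (x / (2 * pi)) = x :> R.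
  by rewrite mulrC divfK// mulf_neq0// gt_eqF.
have [im0|im0] := leP 0 (complex.Im z).
  exists (a / (2 * pi)).
    rewrite divr_ge0 ?mulr_ge0 ?(ltW pi0)//= ltr_pdivrMr; lra.
  by apply: eq_ReIm; rewrite /= dv ?ca// sa ger0_norm.
have apos : 0 < a.
  rewrite lt_neqAle a0 andbT; apply/eqP => a00.
  by move: sa; rewrite -a00 sin0 => /esym/eqP; rewrite normr_eq0 lt_eqF.
exists (1 - a / (2 * pi)).
  have : 0 < a / (2 * pi) by rewrite divr_gt0// mulr_gt0.
  have : a / (2 * pi) <= 1 by rewrite ler_pdivrMr; lra.
  lra.
have -> : cexp (1 - a / (2 * pi)) = (cexp (a / (2 * pi)))^*.
  rewrite cexpD -cexpN.
  suff -> : cexp (1 : R) = 1 by rewrite mul1r.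
  by apply: eq_ReIm; rewrite /= mulr1 mulr_natl ?cos2pi ?sin2pi.
by apply: eq_ReIm; rewrite ?cRe_conj ?cIm_conj /= dv ?ca// sa ltr0_norm// opprK.
Qed.

Lemma cexp_inj (s t : R) : 0 <= s < 1 -> 0 <= t < 1 -> cexp s = cexp t -> s = t.
Proof.
have pi0 := pi_gt0 R.
wlog : s t / s <= t => [H hs ht e|].
  by have [st|/ltW st] := leP s t; [exact: H|apply/esym/H].
move=> st /andP[s0 s1] /andP[t0 t1] e.
have h : cexp (t - s) = 1.
  by rewrite cexpD cexpN -e cexp_mul_conj.
have c1 : cos (2 * pi * (t - s)) = 1 by have := congr1 (@complex.Re R) h.
have inj0 (x : R) : 0 <= x -> 2 * x <= 1 -> cos (2 * pi * x) = 1 -> x = 0.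
  move=> x0 x1 cx.
  have h0 : 2 * pi * x \in `[0, pi].
    rewrite in_itv /=; apply/andP; split.
      by rewrite !mulr_ge0// pi_ge0.
    by rewrite mulrAC ler_piMl// pi_ge0.
  have h1 : (0 : R) \in `[0, pi] by rewrite in_itv /= lexx pi_ge0.
  have := cos_inj h0 h1; rewrite cx cos0 => /(_ erefl)/eqP.
  by rewrite !mulf_eq0 (gt_eqF pi0) pnatr_eq0/= => /eqP.
have [le|gt] := leP (2 * (t - s)) 1.
  have := inj0 (t - s); rewrite subr_ge0 => /(_ st le c1); lra.
have c2 : cos (2 * pi * (1 - (t - s))) = 1.
  rewrite mulrBr mulr1 cosB; have -> : 2 * pi = pi *+ 2 :> R by rewrite mulr_natl.
  by rewrite cos2pi sin2pi mul1r mul0r addr0 -mulr_natl.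
have := inj0 (1 - (t - s)) _ _ c2; lra.
Qed.

End ComplexArithmetic.

(** * Integrals of bounded complex functions *)

Section CircleIntegral.
Context {R : realType} (theta : probability (measurableTypeR R) R).
Implicit Types (g h : R -> R[i]) (z w : R[i]).

Let I : set (measurableTypeR R) := `[0%R, 1%R[%classic.
Let mI : measurable I. Proof. exact: measurable_itv. Qed.

(** Measurable real and imaginary parts with a common bound: a class closed under
    the operations used below, on which the integral is linear. *)
Definition bounded_measurable g : Prop :=
  [/\ measurable_fun setT (@complex.Re R \o g : measurableTypeR R -> R),
      measurable_fun setT (@complex.Im R \o g : measurableTypeR R -> R) &
      exists M, forall t, `|complex.Re (g t)| <= M /\ `|complex.Im (g t)| <= M].

Lemma bounded_measurable_cst z : bounded_measurable (fun=> z).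
Proof.
split; try exact: measurable_cst.
exists (Num.max `|complex.Re z| `|complex.Im z|) => t.
by rewrite !le_max !lexx orbT.
Qed.

Lemma bounded_measurableD g h : bounded_measurable g -> bounded_measurable h ->
  bounded_measurable (fun t => g t + h t).
Proof.
move=> [g1 g2 [M gM]] [h1 h2 [N hN]]; split.
- rewrite (_ : _ \o _ = (@complex.Re R \o g) \+ (@complex.Re R \o h)); first exact: measurable_funD.
  by apply/funext => t /=; rewrite cReD.
- rewrite (_ : _ \o _ = (@complex.Im R \o g) \+ (@complex.Im R \o h)); first exact: measurable_funD.
  by apply/funext => t /=; rewrite cImD.
- exists (M + N) => t; rewrite cReD cImD; have [? ?] := gM t; have [? ?] := hN t.
  by split; apply: le_trans (ler_normD _ _) _; apply: lerD.
Qed.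

Lemma bounded_measurableM g h : bounded_measurable g -> bounded_measurable h ->
  bounded_measurable (fun t => g t * h t).
Proof.
move=> [g1 g2 [M gM]] [h1 h2 [N hN]]; split.
- rewrite (_ : _ \o _ = ((@complex.Re R \o g) \* (@complex.Re R \o h)) \-
     ((@complex.Im R \o g) \* (@complex.Im R \o h))); first by apply: measurable_funB; exact: measurable_funM.
  by apply/funext => t /=; rewrite cReM.
- rewrite (_ : _ \o _ = ((@complex.Re R \o g) \* (@complex.Im R \o h)) \+
     ((@complex.Im R \o g) \* (@complex.Re R \o h))); first by apply: measurable_funD; exact: measurable_funM.
  by apply/funext => t /=; rewrite cImM.
- exists (M * N + M * N) => t; rewrite cReM cImM; have [? ?] := gM t; have [? ?] := hN t.
  by split; apply: le_trans (ler_normD _ _) _; rewrite ?normrN !normrM; apply: lerD; apply: ler_pM.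
Qed.

Lemma bounded_measurable_conj g : bounded_measurable g ->
  bounded_measurable (fun t => (g t)^*).
Proof.
move=> [g1 g2 [M gM]]; split.
- by rewrite (_ : _ \o _ = @complex.Re R \o g)//; apply/funext => t /=; rewrite cRe_conj.
- rewrite (_ : _ \o _ = \- (@complex.Im R \o g)); first exact: measurable_funN.
  by apply/funext => t /=; rewrite cIm_conj.
- by exists M => t; rewrite cRe_conj cIm_conj normrN; exact: gM.
Qed.

Lemma bounded_measurable_cexp : bounded_measurable (@cexp R).
Proof.
split.
- apply: continuous_measurable_fun => t.
  apply: (@continuous_comp _ _ _ (fun t : R => 2 * pi * t) cos); last exact: continuous_cos.
  exact: mulrl_continuous.
- apply: continuous_measurable_fun => t.
  apply: (@continuous_comp _ _ _ (fun t : R => 2 * pi * t) sin); last exact: continuous_sin.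
  exact: mulrl_continuous.
- by exists 1 => t /=; rewrite cos_max sin_max.
Qed.

Lemma bounded_measurable_horner (P : {poly R[i]}) :
  bounded_measurable (fun t => P.[cexp t]).
Proof.
elim/poly_ind: P => [|P c IH].
  by under eq_fun do rewrite horner0; exact: bounded_measurable_cst.
under eq_fun do rewrite hornerMXaddC.
apply: bounded_measurableD; last exact: bounded_measurable_cst.
by apply: bounded_measurableM => //; exact: bounded_measurable_cexp.
Qed.

Let thetaI : (theta I < +oo)%E.
Proof. by rewrite (le_lt_trans (probability_le1 theta mI))// ltry. Qed.

Lemma integrable_Re g : bounded_measurable g ->
  theta.-integrable I (EFin \o (@complex.Re R \o g)).
Proof.
move=> [g1 g2 [M gM]]; apply: measurable_bounded_integrable => //.
  exact: measurable_funS g1.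
by exists M; split; [exact: num_real|] => N hN t _ /=; have [h _] := gM t;
  rewrite (le_trans h)// ltW.
Qed.

Lemma integrable_Im g : bounded_measurable g ->
  theta.-integrable I (EFin \o (@complex.Im R \o g)).
Proof.
move=> [g1 g2 [M gM]]; apply: measurable_bounded_integrable => //.
  exact: measurable_funS g2.
by exists M; split; [exact: num_real|] => N hN t _ /=; have [_ h] := gM t;
  rewrite (le_trans h)// ltW.
Qed.

(** The integral over [0, 1) of a complex function of the parameter [t]. *)
Definition cintegral g : R[i] :=
  ((\int[theta]_(t in I) complex.Re (g t)) +i*
   (\int[theta]_(t in I) complex.Im (g t)))%C.

Lemma circle_integralE (f : R[i] -> R[i]) :
  circle_integral theta f = cintegral (fun t => f (cexp t)).
Proof. by []. Qed.

Lemma cintegralD g h : bounded_measurable g -> bounded_measurable h ->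
  cintegral (fun t => g t + h t) = cintegral g + cintegral h.
Proof.
move=> hg hh; apply: eq_ReIm; rewrite ?cReD ?cImD /=.
- under eq_Rintegral do rewrite cReD.
  by rewrite RintegralD//; exact: integrable_Re.
- under eq_Rintegral do rewrite cImD.
  by rewrite RintegralD//; exact: integrable_Im.
Qed.

Lemma cintegralZ z g : bounded_measurable g ->
  cintegral (fun t => z * g t) = z * cintegral g.
Proof.
move=> hg; have ir := integrable_Re hg; have ii := integrable_Im hg.
have irZ a : theta.-integrable I (EFin \o (fun t => a * complex.Re (g t))).
  rewrite (_ : _ \o _ = (fun t => a%:E * (EFin \o (@complex.Re R \o g)) t)%E)//.
  exact: integrableZl.
have iiZ a : theta.-integrable I (EFin \o (fun t => a * complex.Im (g t))).
  rewrite (_ : _ \o _ = (fun t => a%:E * (EFin \o (@complex.Im R \o g)) t)%E)//.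
  exact: integrableZl.
apply: eq_ReIm; rewrite ?cReM ?cImM /=.
- under eq_Rintegral do rewrite cReM.
  by rewrite RintegralB// !RintegralZl.
- under eq_Rintegral do rewrite cImM.
  by rewrite RintegralD// !RintegralZl.
Qed.

Lemma cintegral_conj g : bounded_measurable g ->
  cintegral (fun t => (g t)^*) = (cintegral g)^*.
Proof.
move=> hg; apply: eq_ReIm; rewrite ?cRe_conj ?cIm_conj /=.
- by under eq_Rintegral do rewrite cRe_conj.
- under eq_Rintegral do rewrite cIm_conj -mulN1r.
  by rewrite RintegralZl ?mulN1r//; exact: integrable_Im.
Qed.

Lemma cintegral_sum n (g : 'I_n -> R -> R[i]) :
  (forall i, bounded_measurable (g i)) ->
  bounded_measurable (fun t => \sum_(i < n) g i t) /\
  cintegral (fun t => \sum_(i < n) g i t) = \sum_(i < n) cintegral (g i).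
Proof.
elim: n g => [|n IH] g hg.
  under eq_fun do rewrite big_ord0; rewrite big_ord0.
  split; first exact: bounded_measurable_cst.
  rewrite -[RHS](mul0r (cintegral (fun=> 0))) -cintegralZ; last exact: bounded_measurable_cst.
  by under [in RHS]eq_fun do rewrite mul0r.
under eq_fun do rewrite big_ord_recr; rewrite big_ord_recr /=.
have [h1 h2] := IH (fun i => g (widen_ord (leqnSn n) i)) (fun i => hg _).
by split; [exact: bounded_measurableD | rewrite cintegralD// h2].
Qed.

End CircleIntegral.

(** * Continuity on the complex plane *)

Section ComplexTopology.
Context {R : realType}.

Lemma continuous_cpoly (K : numFieldType) (P : {poly K}) :
  continuous (fun z : K => P.[z]).
Proof.
elim/poly_ind: P => [|P c IH].
  have -> : (fun z : K => (0 : {poly K}).[z]) = cst 0.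
    by apply/funext => z; rewrite horner0.
  exact: cst_continuous.
have -> : (fun z : K => (P * 'X + c%:P).[z]) = (fun z : K => P.[z] * z + c).
  by apply/funext => z; rewrite hornerMXaddC.
move=> z; apply: (@continuousD K K K (fun z => P.[z] * z) (cst c) z).
  by apply: (@continuousM K K (horner P) id z); [exact: IH | exact: cvg_id].
exact: cst_continuous.
Qed.

Lemma continuous_Re : continuous (fun z : R[i]^o => complex.Re z).
Proof.
move=> z; apply/(@cvgrPdist_lt _ _ _ (nbhs (z : R[i]^o))) => e e0.
have e0' : 0 < (e%:C)%C by rewrite ltcR.
have := nbhsx_ballx (z : R[i]^o) _ e0'.
apply: (@filterS _ (nbhs (z : R[i]^o))) => w; rewrite -ball_normE /=; rewrite normc_def ltcR;
  apply: le_lt_trans.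
rewrite -sqrtr_sqr ler_wsqrtr//.
by case: z w => a b [c d] /=; rewrite lerDl sqr_ge0.
Qed.

Lemma continuous_Im : continuous (fun z : R[i]^o => complex.Im z).
Proof.
move=> z; apply/(@cvgrPdist_lt _ _ _ (nbhs (z : R[i]^o))) => e e0.
have e0' : 0 < (e%:C)%C by rewrite ltcR.
have := nbhsx_ballx (z : R[i]^o) _ e0'.
apply: (@filterS _ (nbhs (z : R[i]^o))) => w; rewrite -ball_normE /=; rewrite normc_def ltcR;
  apply: le_lt_trans.
rewrite -sqrtr_sqr ler_wsqrtr//.
by case: z w => a b [c d] /=; rewrite lerDr sqr_ge0.
Qed.

Lemma open_cpoly_neq0 (P : {poly R[i]}) :
  open ([set z | P.[z] != 0] : set R[i]^o).
Proof.
have -> : [set z | P.[z] != 0] = (fun z : R[i]^o => P.[z] : R[i]^o) @^-1` [set z | z != 0].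
  by [].
apply: open_comp; last first.
  have -> : [set z | z != 0] = ~` [set (0 : R[i]^o)].
    by apply/seteqP; split => z /= /eqP.
  apply: closed_openC; apply: accessible_closed_set1.
  by apply: hausdorff_accessible; exact: norm_hausdorff.
by move=> z _; exact: (@continuous_cpoly R[i]).
Qed.

End ComplexTopology.

(** * The inner product of polynomials and the monic orthogonal polynomials *)

Section InnerProduct.
Context {R : realType} (theta : probability (measurableTypeR R) R).
Implicit Types (P Q : {poly R[i]}) (z w : R[i]).

Let I : set (measurableTypeR R) := `[0%R, 1%R[%classic.
Let mI : measurable I. Proof. exact: measurable_itv. Qed.

(** The inner product of L^2(theta) on the unit circle, conjugate linear in the
    second argument. *)
Definition ip P Q : R[i] := cintegral theta (fun t => P.[cexp t] * (Q.[cexp t])^*).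

Lemma bounded_measurable_ip P Q :
  bounded_measurable (fun t : R => P.[cexp t] * (Q.[cexp t])^*).
Proof.
apply: bounded_measurableM; first exact: bounded_measurable_horner.
by apply: bounded_measurable_conj; exact: bounded_measurable_horner.
Qed.
Local Hint Resolve bounded_measurable_ip : core.

Lemma ip_ext P Q P' Q' :
  (forall t : R, P.[cexp t] * (Q.[cexp t])^* = P'.[cexp t] * (Q'.[cexp t])^*) ->
  ip P Q = ip P' Q'.
Proof. by move=> h; congr cintegral; apply/funext. Qed.

Lemma ipDl P P' Q : ip (P + P') Q = ip P Q + ip P' Q.
Proof.
by rewrite /ip -cintegralD//; congr cintegral; apply/funext => t; rewrite hornerD mulrDl.
Qed.

Lemma ipZl z P Q : ip (z *: P) Q = z * ip P Q.
Proof.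
by rewrite /ip -cintegralZ//; congr cintegral; apply/funext => t; rewrite hornerZ mulrA.
Qed.

Lemma ipC P Q : ip Q P = (ip P Q)^*.
Proof.
rewrite /ip -cintegral_conj//; congr cintegral; apply/funext => t.
by rewrite rmorphM /= conjCK mulrC.
Qed.

Lemma ipZr z P Q : ip P (z *: Q) = z^* * ip P Q.
Proof. by rewrite ipC ipZl rmorphM /= -ipC. Qed.

Lemma ip0l Q : ip 0 Q = 0.
Proof. by rewrite -[0](scale0r (0 : {poly R[i]})) ipZl mul0r. Qed.

Lemma ipBl P P' Q : ip (P - P') Q = ip P Q - ip P' Q.
Proof. by rewrite ipDl -scaleN1r ipZl mulN1r. Qed.

Lemma ipBr P Q Q' : ip P (Q - Q') = ip P Q - ip P Q'.
Proof. by rewrite ipC ipBl rmorphB /= -!ipC. Qed.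

Lemma ip_suml (J : Type) (r : seq J) (F : J -> {poly R[i]}) Q :
  ip (\sum_(j <- r) F j) Q = \sum_(j <- r) ip (F j) Q.
Proof.
elim: r => [|j r IH]; first by rewrite !big_nil ip0l.
by rewrite !big_cons ipDl IH.
Qed.

(** Multiplication by z is an isometry, as |z| = 1 on the circle. *)
Lemma ip_mulX P Q : ip ('X * P) ('X * Q) = ip P Q.
Proof.
apply: ip_ext => t; rewrite !hornerM hornerX rmorphM /=.
by rewrite mulrACA cexp_mul_conj mul1r.
Qed.

Lemma ip_coefr P Q N : (size Q <= N)%N ->
  ip P Q = \sum_(j < N) (Q`_j)^* * ip P 'X^j.
Proof.
move=> sQ; rewrite -[in LHS](coefK Q) poly_def ipC ip_suml rmorph_sum /=.
rewrite (big_ord_widen N (fun j => (ip (Q`_j *: 'X^j) P)^*))//.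
rewrite [RHS](bigID (fun j : 'I_N => (j < size Q)%N)) /= [X in _ = _ + X]big1 ?addr0.
  by apply: eq_bigr => j _; rewrite ipZl rmorphM /= -ipC.
by move=> j; rewrite -leqNgt => /(nth_default 0) ->; rewrite conjC0 mul0r.
Qed.

Lemma normc_sqrE z : Normc.normc z ^+ 2 = complex.Re (z * z^*).
Proof.
rewrite cReM cRe_conj cIm_conj; case: z => a b /=.
by rewrite sqr_sqrtr ?addr_ge0 ?sqr_ge0//; ring.
Qed.

Lemma ip_norm P : ip P P =
  ((\int[theta]_(t in I) (Normc.normc P.[cexp t]) ^+ 2)%:C)%C.
Proof.
have e t : P.[cexp t] * (P.[cexp t])^* = ((Normc.normc P.[cexp t] ^+ 2)%:C)%C.
  case: (P.[_]) => a b; apply: eq_ReIm; rewrite ?cReM ?cImM ?cRe_conj ?cIm_conj /=; last ring.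
  rewrite sqr_sqrtr ?addr_ge0 ?sqr_ge0//; ring.
apply: eq_ReIm => /=.
  by apply: eq_Rintegral => t _; rewrite e.
under eq_Rintegral do rewrite e /=.
by rewrite Rintegral_cst// mul0r.
Qed.

Lemma normc_sqr_eq0 z : Normc.normc z ^+ 2 = 0 -> z = 0.
Proof. by move=> /eqP; rewrite sqrf_eq0 => /eqP/Normc.eq0_normc. Qed.

Lemma measurable_normc_sqr P :
  measurable_fun setT (fun t : measurableTypeR R => (Normc.normc P.[cexp t]) ^+ 2).
Proof.
have [h1 h2 _] := bounded_measurable_ip P P.
rewrite (_ : (fun t => _) = complex.Re (R:=R) \o (fun t => P.[cexp t] * (P.[cexp t])^*))//.
by apply/funext => t; rewrite normc_sqrE.
Qed.

Hypothesis theta01 : theta [set` `[0%R, 1%R[] = 1%E.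
Hypothesis theta_nontrivial : nontrivial_measure theta.

Lemma theta_outside (A : set (measurableTypeR R)) : measurable A ->
  theta (A `&` I) = theta A.
Proof.
move=> mA; have h : theta (~` I) = 0%E.
  by rewrite probability_setC// theta01 subee.
rewrite [RHS](measureDI _ mA mI)//.
rewrite [X in _ = (X + _)%E](_ : _ = 0%E) ?add0e//.
apply: (@subset_measure0 _ _ _ theta _ (~` I)) => //.
- exact: measurableD.
- exact: measurableC.
Qed.

(** Definiteness.  If P is nonzero, the infinite support of theta contains a point
    that is not a zero of P, and a neighborhood of it, of positive measure, where
    P does not vanish. *)
Lemma ip_eq0 P : ip P P = 0 -> P = 0.
Proof.
move=> h; apply/eqP; apply: contrapT => /negP P0.
apply: theta_nontrivial.
have [r hr] := closed_field_poly_normal P.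
apply: (@sub_finite_set _ _ [set` r]); last exact: finite_seq.
move=> z hz /=; apply: contrapT => zr.
have Pz : P.[z] != 0.
  rewrite hr hornerZ mulf_neq0 ?lead_coef_eq0// -rootE root_prod_XsubC.
  exact/negP.
pose f := fun t : measurableTypeR R => (Normc.normc P.[cexp t]) ^+ 2.
have mf : measurable_fun setT f by exact: measurable_normc_sqr.
pose A := [set t : measurableTypeR R | f t != 0].
have mA : measurable A.
  have -> : A = ~` (f @^-1` [set 0]).
    by apply/seteqP; split => t /=; [move/eqP|move/eqP].
  by apply: measurableC; rewrite -[X in measurable X]setTI; exact: mf.
have AE : A = cexp @^-1` [set u | P.[u] != 0].
  apply/seteqP; split => t; rewrite /A /f /=.
    by apply: contra => /eqP ->; rewrite Normc.normc0 expr0n.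
  by apply: contra => /eqP/normc_sqr_eq0 ->.
have := hz _ (@open_cpoly_neq0 R P) Pz; rewrite /circle_measure -AE.
rewrite -theta_outside//.
suff -> : theta (A `&` I) = 0%E by rewrite ltxx.
have hi : (\int[theta]_(t in I) `|(f t)%:E|)%E = 0%E.
  have h1 := ip_norm P; rewrite h in h1.
  have h2 : \int[theta]_(t in I) f t = 0 by have := congr1 (@complex.Re R) h1.
  have hbm := bounded_measurable_ip P P.
  have fi : theta.-integrable I (EFin \o f).
    apply: eq_integrable (integrable_Re theta hbm) => //.
    by move=> t _; rewrite /= /f normc_sqrE.
  rewrite -[RHS]/((0 : R)%:E) -h2 fineK; last exact: integrable_fin_num.
  by apply: eq_integral => t _; rewrite gee0_abs// lee_fin /f sqr_ge0.
have [N [mN N0 hN]] : ae_eq theta I (EFin \o f) (cst 0%E).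
  apply/ae_eq_integral_abs => //.
  by apply/measurable_EFinP; exact: measurable_funS mf.
apply: (@subset_measure0 _ _ _ theta _ N) => //; first exact: measurableI.
move=> t [At It]; apply: hN => /= /(_ It) [] /eqP ft0.
by move: At; rewrite /A /= ft0.
Qed.

Lemma ip_ge0 P : 0 <= ip P P.
Proof.
by rewrite ip_norm lecR; apply: Rintegral_ge0 => t _; rewrite sqr_ge0.
Qed.

Lemma ip_gt0 P : P != 0 -> 0 < ip P P.
Proof.
by move=> P0; rewrite lt_neqAle ip_ge0 andbT eq_sym; apply: contra P0 => /eqP/ip_eq0 ->.
Qed.

Lemma is_monic_opucE m P : is_monic_opuc theta m P <->
  [/\ P \is monic, size P = m.+1 & forall j, (j < m)%N -> ip P 'X^j = 0].
Proof.
have e j : circle_integral theta (fun z => P.[z] * z^* ^+ j) = ip P 'X^j.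
  rewrite circle_integralE; congr cintegral; apply/funext => t.
  by rewrite hornerXn rmorphXn.
by split=> -[h1 h2 h3]; split => // j hj; rewrite -(h3 j hj) e.
Qed.

Lemma monic_opuc_unique m P Q : is_monic_opuc theta m P -> is_monic_opuc theta m Q -> P = Q.
Proof.
move=> /is_monic_opucE[Pm Ps Po] /is_monic_opucE[Qm Qs Qo].
apply/eqP; rewrite -subr_eq0; apply/eqP/ip_eq0.
have sD : (size (P - Q)%R <= m)%N.
  apply/leq_sizeP => j; rewrite leq_eqVlt => /predU1P[<-|mj].
    rewrite coefB; move: Pm Qm; rewrite !monicE /lead_coef Ps Qs /= => /eqP -> /eqP ->.
    by rewrite subrr.
  by rewrite coefB !nth_default ?subrr ?Ps ?Qs.
rewrite [LHS](ip_coefr _ sD) big1// => j _.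
by rewrite ipBl Po// Qo// subrr mulr0.
Qed.

(** The Gram matrix of 1, ..., z^(m-1) is invertible by definiteness, so z^m has an
    orthogonal projection. *)
Lemma monic_opuc_exists m : exists P, is_monic_opuc theta m P.
Proof.
pose G := \matrix_(i < m, j < m) ip ('X^i : {poly R[i]}) 'X^j.
have hG (v : 'rV_m) (j : 'I_m) : (v *m G) 0 j = ip (rVpoly v) 'X^j.
  rewrite mxE [rVpoly v]poly_def ip_suml; apply: eq_bigr => i _.
  by rewrite mxE valK ipZl.
have Gu : G \in unitmx.
  rewrite -row_free_unit; apply: inj_row_free => v vG0.
  have : rVpoly v = 0.
    apply: ip_eq0; rewrite [LHS](ip_coefr _ (size_poly _ _)) big1// => j _.
    by rewrite -hG vG0 mxE mulr0.
  by move=> h; rewrite -[v]rVpolyK h linear0.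
pose b := \row_(j < m) ip ('X^m : {poly R[i]}) 'X^j.
pose v := b *m invmx G.
have sv : (size (rVpoly v) <= m)%N by exact: size_poly.
exists ('X^m - rVpoly v); apply/is_monic_opucE.
have sz : size ('X^m - rVpoly v) = m.+1.
  by rewrite size_polyDl size_polyXn// size_polyN ltnS.
split => //.
  by rewrite monicE lead_coefDl ?lead_coefXn// size_polyN size_polyXn ltnS.
move=> j jm; rewrite ipBl.
have := hG v (Ordinal jm); rewrite /= => <-.
by rewrite mulmxKV// mxE subrr.
Qed.

Lemma monic_opucP m : is_monic_opuc theta m (monic_opuc theta m).
Proof.
have [P hP] := monic_opuc_exists m.
exact: (@xgetPex _ 0 [set P | is_monic_opuc theta m P] (ex_intro _ P hP)).
Qed.

End InnerProduct.

(** * Even measures have real orthogonal polynomials *)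

Section Even.
Context {R : realType} (theta : probability (measurableTypeR R) R).
Hypothesis theta01 : theta [set` `[0%R, 1%R[] = 1%E.
Hypothesis theta_nontrivial : nontrivial_measure theta.
Hypothesis theta_even : even_measure theta.

Lemma complex_borel_preimage (X : R[i] -> R) (E : set (measurableTypeR R)) :
  continuous (X : R[i]^o -> R) -> measurable E -> complex_borel (X @^-1` E).
Proof.
move=> cX mE.
pose G := image_set_system setT X (@complex_borel R).
have sG : sigma_algebra setT G.
  by apply: sigma_algebra_image; exact: smallest_sigma_algebra.
have GE : G E.
  have : (RGenOpens.G (R:=R)).-sigma.-measurable E by rewrite -RGenOpens.measurableE.
  apply: smallest_sub => // _ [x [y ->]].
  rewrite /G /image_set_system /= setTI; apply: sub_sigma_algebra => /=.
  apply: open_comp; last exact: interval_open.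
  by move=> z _; exact: cX.
by move: GE; rewrite /G /image_set_system /= setTI.
Qed.

Lemma complex_borelI (A B : set R[i]) :
  complex_borel A -> complex_borel B -> complex_borel (A `&` B).
Proof.
exact: (@measurableI _ (g_sigma_algebraType [set U : set R[i]^o | open U]) A B).
Qed.

Lemma range_cexp : range (@cexp R) = (fun z : R[i] => complex.Re z ^+ 2 + complex.Im z ^+ 2) @^-1` [set 1].
Proof.
apply/seteqP; split => [z [t _ <-]|z /= hz]; first by rewrite /= cos2Dsin2.
suff : z * z^* = 1 by move=> /cexp_onto[t _ tz]; exists t.
apply: eq_ReIm; rewrite ?cReM ?cImM cRe_conj cIm_conj /=; last by rewrite /=; ring.
by rewrite -hz; ring.
Qed.

Lemma complex_borel_range_cexp : complex_borel (range (@cexp R)).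
Proof.
rewrite range_cexp; apply: complex_borel_preimage => //.
have c (f : R[i]^o -> R) : continuous f -> continuous (fun z : R[i]^o => f z ^+ 2).
  by move=> cf z; apply: (@continuousM _ _ f f z); exact: cf.
move=> z; apply: (@continuousD _ _ _ (fun z : R[i]^o => complex.Re z ^+ 2)).
  exact: c continuous_Re z.
exact: c continuous_Im z.
Qed.

(** The moments of an even measure are real: Im e(t)^k and its opposite have the
    same distribution, since every event about Im z^k on the circle is a Borel
    set of the plane. *)
Lemma moment_real k : complex.Im (cintegral theta (fun t => cexp t ^+ k)) = 0.
Proof.
pose f (t : measurableTypeR R) : measurableTypeR R := complex.Im (cexp t ^+ k).
have bmk : bounded_measurable (fun t : R => cexp t ^+ k).
  by have := bounded_measurable_horner ('X^k : {poly R[i]}); under eq_fun do rewrite hornerXn.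
have [_ mf [M hM]] := bmk.
have mI : measurable (`[0%R, 1%R[%classic : set (measurableTypeR R)) by exact: measurable_itv.
have mN : measurable_fun setT (fun t => - f t : measurableTypeR R).
  exact: (measurable_funN mf).
have int_f (g : measurableTypeR R -> R) : measurable_fun setT g ->
    (forall t, `|g t| <= M) -> theta.-integrable setT (EFin \o g).
  move=> mg gM; apply: measurable_bounded_integrable => //.
    by rewrite (le_lt_trans (probability_le1 theta measurableT))// ltry.
  by exists M; split; [exact: num_real|] => r hr t _ /=; rewrite (le_trans (gM t))// ltW.
have i1 : theta.-integrable setT (EFin \o f) by apply: int_f => // t; have [] := hM t.
have i2 : theta.-integrable setT (EFin \o (fun t => - f t)).
  by apply: int_f => // t; rewrite normrN; have [] := hM t.
have mE : measurable_fun setT (EFin : measurableTypeR R -> \bar R).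
  exact: measurable_realfun.EFin_measurable.
pose fN (t : measurableTypeR R) : measurableTypeR R := - f t.
have h1 := @integral_pushforward _ _ (measurableTypeR R) (measurableTypeR R) R f mf
  theta setT EFin mE i1 measurableT.
have h2 := @integral_pushforward _ _ (measurableTypeR R) (measurableTypeR R) R fN mN
  theta setT EFin mE i2 measurableT.
have e12 : (\int[theta]_t (f t)%:E = \int[theta]_t (- f t)%:E)%E.
  apply: etrans (esym h1) _; apply: etrans h2.
  apply: eq_measure_integral => E mE' _.
  rewrite /pushforward.
  pose S := [set z : R[i] | E (complex.Im (z ^+ k))] `&` range (@cexp R).
  have bS : complex_borel S.
    apply: complex_borelI; last exact: complex_borel_range_cexp.
    apply: (@complex_borel_preimage (fun z => complex.Im (z ^+ k))) => // z.
    apply: (@continuous_comp _ _ _ (fun z : R[i]^o => z ^+ k : R[i]^o) (fun z : R[i]^o => complex.Im z)); last exact: continuous_Im.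
    have := @continuous_cpoly R[i] 'X^k z.
    by under eq_fun do rewrite hornerXn.
  have := theta_even bS (@subIsetr _ _ _); rewrite /circle_measure.
  have -> : cexp @^-1` S = f @^-1` E.
    by apply/seteqP; split => t /=; [case|split => //; exists t].
  have -> // : cexp @^-1` [set z | S z^*] = (fun t => - f t) @^-1` E.
  have e t : complex.Im ((cexp t)^* ^+ k) = - f t by rewrite -rmorphXn /= cIm_conj.
  apply/seteqP; split => t; rewrite /S /=; first by case; rewrite e.
  by move=> h; split; [rewrite e|exists (- t) => //; rewrite cexpN].
have tN : theta (~` `[0%R, 1%R[%classic) = 0%E.
  by rewrite probability_setC// theta01 subee.
have eI : (\int[theta]_(t in `[0%R, 1%R[) (f t)%:E = \int[theta]_t (f t)%:E)%E.
  rewrite [RHS](@negligible_integral _ _ _ theta setT (~` `[0%R, 1%R[%classic))//.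
  - by rewrite setTD setCK.
  - exact: measurableC.
rewrite /cintegral /= /Rintegral eI.
have ff : (\int[theta]_t (f t)%:E)%E \is a fin_num by exact: integrable_fin_num.
have : (\int[theta]_t (- f t)%:E = - \int[theta]_t (f t)%:E)%E.
  rewrite -integralN; first by apply: eq_integral.
  exact: integrable_add_def.
rewrite -e12 -(fineK ff) => -[] h.
suff : forall x : R, x = - x -> x = 0 by apply.
by move=> x; lra.
Qed.

Lemma ip_Xn_real i j : (ip theta 'X^i 'X^j)^* = ip theta 'X^i 'X^j.
Proof.
have mX d p q : ip theta ('X^(d + p)) ('X^(d + q)) = ip theta 'X^p 'X^q.
  elim: d => // d IH; rewrite !addSn !exprS ip_mulX; exact: IH.
have r0 p : (ip theta 'X^p 'X^0)^* = ip theta 'X^p 'X^0.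
  have -> : ip theta 'X^p 'X^0 = cintegral theta (fun t => cexp t ^+ p).
    congr cintegral; apply/funext => t.
    by rewrite expr0 hornerC hornerXn conjC1 mulr1.
  by apply: eq_ReIm; rewrite ?cRe_conj// cIm_conj moment_real oppr0.
wlog ij : i j / (j <= i)%N => [H|].
  by have [|/ltnW] := leqP j i => h; [|rewrite [in RHS]ipC ipC H//]; exact: H.
by have := mX j (i - j)%N 0%N; rewrite subnKC// addn0 => ->.
Qed.

(** Conjugating the coefficients preserves the orthogonality relations, because
    the Gram matrix is real; conclude by uniqueness. *)
Lemma monic_opuc_real m :
  map_poly Num.conj (monic_opuc theta m) = monic_opuc theta m.
Proof.
have hP := monic_opucP theta01 theta_nontrivial m.
apply: (monic_opuc_unique theta01 theta_nontrivial _ hP).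
move: hP => /is_monic_opucE[Pm Ps Po]; apply/is_monic_opucE; split.
- by rewrite map_monic.
- by rewrite size_map_poly.
move=> j jm; set P := monic_opuc theta m in Pm Ps Po *.
have -> : map_poly Num.conj P = \sum_(i < size P) (P`_i)^* *: 'X^i.
  rewrite -[X in map_poly _ X]coefK poly_def rmorph_sum /=; apply: eq_bigr => i _.
  by rewrite map_polyZ /= map_polyXn.
rewrite ip_suml; have := Po _ jm; rewrite -[X in ip theta X _]coefK poly_def ip_suml => h.
have e : \sum_(i < size P) ip theta ((P`_i)^* *: 'X^i) 'X^j =
    (\sum_(i < size P) ip theta (P`_i *: 'X^i) 'X^j)^*.
  rewrite [RHS]rmorph_sum /=; apply: eq_bigr => i _.
  by rewrite !ipZl rmorphM /= ip_Xn_real.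
by rewrite e h conjC0.
Qed.

End Even.

(** * The polynomials phi^* + e phi and their zeros *)

Section ParaOrthogonal.
Context {R : realType} (theta : probability (measurableTypeR R) R).
Hypothesis theta01 : theta [set` `[0%R, 1%R[] = 1%E.
Hypothesis theta_nontrivial : nontrivial_measure theta.
Variable n : nat.
Implicit Types (P Q p r k : {poly R[i]}) (z w : R[i]).

Local Notation ip := (ip theta).
Local Notation phi := (opuc theta n.+1).

(** The leading coefficient of phi_{n+1}, the inverse of the norm of Phi_{n+1}. *)
Definition opuc_scale : R := (circle_L2norm theta (monic_opuc theta n.+1))^-1.
Local Notation kappa := (opuc_scale%:C)%C.

Lemma opucE : phi = kappa *: monic_opuc theta n.+1.
Proof. by []. Qed.

Let mP := monic_opucP theta01 theta_nontrivial n.+1.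

Lemma monic_opuc_neq0 : monic_opuc theta n.+1 != 0.
Proof. by case: mP => /monic_neq0. Qed.

Lemma opuc_scale_gt0 : 0 < opuc_scale.
Proof.
rewrite invr_gt0 sqrtr_gt0; have := ip_gt0 theta01 theta_nontrivial monic_opuc_neq0.
by rewrite ip_norm ltcR.
Qed.

Let kappa_neq0 : kappa != 0.
Proof. by rewrite -[0]/((0 : R)%:C)%C (inj_eq (@complexI R)) gt_eqF// opuc_scale_gt0. Qed.

Lemma ip_opuc_norm : ip phi phi = 1.
Proof.
rewrite opucE ipZl ipZr conj_real ip_norm -!rmorphM /=; congr (_%:C)%C.
rewrite /opuc_scale /circle_L2norm; set S := Rintegral _ _ _.
have S0 : 0 < S.
  by have := ip_gt0 theta01 theta_nontrivial monic_opuc_neq0; rewrite ip_norm ltcR.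
rewrite mulrA -expr2 exprVn sqr_sqrtr ?ltW// mulVf// gt_eqF//.
Qed.

Lemma size_opuc : size phi = n.+2.
Proof. by rewrite opucE size_scale//; case: mP. Qed.

Lemma coef_opuc : phi`_n.+1 = kappa.
Proof.
rewrite opucE coefZ; case: mP => /monicP; rewrite /lead_coef => + sP _.
by rewrite sP /= => ->; rewrite mulr1.
Qed.

Lemma ip_opuc_Xn j : (j < n.+1)%N -> ip phi 'X^j = 0.
Proof.
move=> jn; rewrite opucE ipZl; have /is_monic_opucE[_ _ ->] := mP => //.
by rewrite mulr0.
Qed.

Lemma ip_opuc_small P : (size P <= n.+1)%N -> ip phi P = 0.
Proof.
move=> sP; rewrite (ip_coefr _ _ sP) big1// => j _.
by rewrite ip_opuc_Xn ?mulr0.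
Qed.

Lemma ip_opuc_Xn1 : ip phi 'X^(n.+1) = kappa^-1.
Proof.
have := ip_opuc_norm; rewrite (@ip_coefr _ _ _ _ n.+2) ?size_opuc//.
rewrite big_ord_recr /= big1 ?add0r => [|j _]; last by rewrite ip_opuc_Xn ?mulr0.
rewrite coef_opuc conj_real => h.
by apply: (mulfI kappa_neq0); rewrite h divff.
Qed.

Local Notation phis := (reverse_poly phi).

Lemma size_reverse_opuc : (size phis <= n.+2)%N.
Proof. by rewrite /reverse_poly size_opuc size_poly. Qed.

Lemma horner_reverse_opuc z : z != 0 ->
  phis.[z] = z ^+ n.+1 * (phi.[(z^*)^-1])^*.
Proof. by move=> z0; rewrite reverse_polyE// size_opuc. Qed.

Lemma horner_reverse_opuc_cexp (t : R) :
  phis.[cexp t] = cexp t ^+ n.+1 * (phi.[cexp t])^*.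
Proof. by rewrite horner_reverse_opuc ?cexp_neq0// conj_cexp invrK. Qed.

Lemma ip_reverse_opuc_Xn j : (j <= n.+1)%N ->
  ip phis 'X^j = (ip phi 'X^(n.+1 - j))^*.
Proof.
move=> jn; rewrite -ipC; apply: ip_ext => t.
have eX : cexp t ^+ n.+1 = cexp t ^+ (n.+1 - j) * cexp t ^+ j.
  by rewrite -exprD subnK.
rewrite horner_reverse_opuc_cexp !hornerXn eX -!mulrA; congr (_ * _).
by rewrite mulrCA rmorphXn /= -exprMn cexp_mul_conj expr1n mulr1.
Qed.

Section Sign.
Variable e : R.
Hypothesis e2 : e * e = 1.
Local Notation eps := (e%:C)%C.

Let eps2 : eps * eps = 1. Proof. by rewrite -rmorphM /= e2. Qed.
Let eps0 : eps != 0.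
Proof. by apply/eqP => h; have := eps2; rewrite h mul0r => /esym/eqP; rewrite oner_eq0. Qed.

(** The para-orthogonal polynomial phi^* + e phi: a multiple of A_{n+1} when
    e = 1 and of B_{n+1} when e = -1. *)
Definition para_opuc : {poly R[i]} := phis + eps *: phi.
Local Notation A := para_opuc.

Lemma horner_para_opuc z : A.[z] = phis.[z] + eps * phi.[z].
Proof. by rewrite hornerD (hornerZ eps phi). Qed.

Lemma size_para_opuc_le : (size A <= n.+2)%N.
Proof.
apply: leq_trans (size_polyD _ _) _; rewrite geq_max size_reverse_opuc.
by apply: leq_trans (size_scale_leq _ _) _; rewrite size_opuc.
Qed.

Lemma ip_para_opuc_Xn j : (0 < j < n.+1)%N -> ip A 'X^j = 0.
Proof.
move=> /andP[j0 jn]; rewrite ipDl ipZl ip_opuc_Xn// mulr0 addr0.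
by rewrite ip_reverse_opuc_Xn ?(ltnW jn)// ip_opuc_Xn ?conjC0// ltn_subrL j0.
Qed.

Lemma ip_para_opuc_Xn1 : ip A 'X^(n.+1) = eps / kappa.
Proof.
by rewrite ipDl ipZl ip_opuc_Xn1 ip_reverse_opuc_Xn// subnn ip_opuc_Xn// conjC0 add0r.
Qed.

(** Orthogonality to z, ..., z^n: against z r only the top coefficient of r
    counts. *)
Lemma ip_para_opuc_mulX r : (size r <= n.+1)%N ->
  ip A ('X * r) = (r`_n)^* * (eps / kappa).
Proof.
move=> sr; rewrite (@ip_coefr _ _ _ _ n.+2); last first.
  by apply: leq_trans (size_polyMleq _ _) _; rewrite size_polyX /=.
rewrite big_ord_recr big_ord_recl /= coefXM /= conjC0 mul0r add0r big1 ?add0r.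
  by rewrite coefXM /= ip_para_opuc_Xn1.
move=> j _; rewrite /bump /= add1n ip_para_opuc_Xn ?mulr0//=.
by have := ltn_ord j.
Qed.

Lemma ip_para_opuc_mulX0 r : (size r <= n)%N -> ip A ('X * r) = 0.
Proof.
move=> sr; rewrite ip_para_opuc_mulX ?(leq_trans sr)//.
by rewrite nth_default// conjC0 mul0r.
Qed.

(** The zeros are symmetric with respect to the unit circle. *)
Lemma horner_para_opuc_conj z : z != 0 ->
  A.[(z^*)^-1] = (z^*)^-1 ^+ n.+1 * eps * (A.[z])^*.
Proof.
move=> z0; have zc0 : z^* != 0 by rewrite conjC_eq0.
rewrite !horner_para_opuc [X in _ = _ * X]rmorphD rmorphM /= conj_real.
rewrite !horner_reverse_opuc ?invr_eq0//.
rewrite fmorphV /= conjCK invrK rmorphM rmorphXn /= conjCK.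
rewrite mulrDr -!mulrA [eps * (eps * _)]mulrA eps2 mul1r addrC; congr (_ + _).
by rewrite [RHS]mulrCA [_ ^+ _ * (_ * _)]mulrA -exprMn mulVf// expr1n mul1r.
Qed.

Lemma horner_para_opuc_cexp (t : R) :
  A.[cexp t] = cexp t ^+ n.+1 * eps * (A.[cexp t])^*.
Proof.
by have := horner_para_opuc_conj (cexp_neq0 t); rewrite conj_cexp invrK.
Qed.

Lemma para_opuc_neq0 : A != 0.
Proof.
apply/eqP => A0; have := ip_para_opuc_Xn1; rewrite A0 ip0l => /esym/eqP.
by rewrite mulf_eq0 invr_eq0 (negbTE eps0) (negbTE kappa_neq0).
Qed.

Lemma coef_para_opuc_lead : A`_n.+1 = eps * (A`_0)^*.
Proof.
have AE i : A`_i = phis`_i + eps * phi`_i by rewrite coefD (coefZ eps phi).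
rewrite !AE /reverse_poly !coef_poly size_opuc ltnSn /= subnn subn0.
by rewrite rmorphD rmorphM /= conjCK conj_real mulrDr [eps * (eps * _)]mulrA eps2 mul1r addrC.
Qed.

(** If A vanished at 0, it would be of the form z g with g of degree less than n,
    hence orthogonal to itself. *)
Lemma para_opuc_coef0_neq0 : A`_0 != 0.
Proof.
apply/eqP => A0.
have AE : A = 'X * \poly_(i < n) A`_i.+1.
  apply/polyP => -[|i]; rewrite coefXM//= coef_poly.
  case: ltnP => // ni; move: ni; rewrite leq_eqVlt => /predU1P[<-|ni].
    by rewrite coef_para_opuc_lead A0 conjC0 mulr0.
  by rewrite nth_default// (leq_trans size_para_opuc_le).
have : ip A A = 0 by rewrite {2}AE ip_para_opuc_mulX0// size_poly.
by move/(ip_eq0 theta01 theta_nontrivial)/eqP; rewrite (negbTE para_opuc_neq0).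
Qed.

Lemma size_para_opuc : size A = n.+2.
Proof.
apply/eqP; rewrite eqn_leq size_para_opuc_le /= ltnNge; apply/negP => /leq_sizeP h.
have := coef_para_opuc_lead; rewrite h// => /esym/eqP; rewrite mulf_eq0 (negbTE eps0)/=.
by rewrite conjC_eq0 (negbTE para_opuc_coef0_neq0).
Qed.

Lemma root_para_opuc_neq0 z : root A z -> z != 0.
Proof.
apply: contraTneq => ->; rewrite rootE horner_coef0; exact: para_opuc_coef0_neq0.
Qed.

(** A zero and its reflection are not both zeros, counted with multiplicity.
    On the circle 1 - conj(z0) z = z conj(z - z0), so if
    A = (z - z0)(1 - conj(z0) z) g, then the inner product of A with z g, which
    is 0, would be the squared norm of (z - z0) g. *)
Lemma para_opuc_no_reflected_pair z k : z != 0 ->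
  A <> k * ('X - (z^*)^-1%:P) * ('X - z%:P).
Proof.
move=> z0 AE; have zc0 : z^* != 0 by rewrite conjC_eq0.
pose g := (- (z^*)^-1) *: k.
have k0 : k != 0.
  by apply/eqP => k0; have := para_opuc_neq0; rewrite AE k0 !mul0r eqxx.
have sk : (size k <= n)%N.
  have := size_para_opuc; rewrite AE size_mul ?mulf_neq0 ?polyXsubC_eq0//.
  rewrite size_mul ?polyXsubC_eq0// !size_XsubC addn2 /= addn2 /= => -[->].
  by [].
have g0 : ('X - z%:P) * g != 0.
  by rewrite mulf_neq0 ?polyXsubC_eq0// scaler_eq0 oppr_eq0 invr_eq0 negb_or zc0.
have := ip_gt0 theta01 theta_nontrivial g0.
suff -> : ip (('X - z%:P) * g) (('X - z%:P) * g) = ip A ('X * g).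
  by rewrite ip_para_opuc_mulX0 ?ltxx// (leq_trans (size_scale_leq _ _)).
apply: ip_ext => t; rewrite AE /g; set u := cexp t.
have uu : u * u^* = 1 by exact: cexp_mul_conj.
rewrite !hornerE !rmorphM !rmorphB /=.
set c' := (- _)^*; have cz : (z^*)^-1 * z^* = 1 by rewrite mulVf.
move: (z^*)^-1 cz => c cz.
have hc : - c * (u^* - z^*) = (u - c) * u^*.
  have -> : - c * (u^* - z^*) = c * z^* - c * u^* by ring.
  by rewrite cz -uu; ring.
transitivity ((- c * (u^* - z^*)) * ((u - z) * k.[u] * (c' * (k.[u])^*))); first by ring.
by rewrite hc; ring.
Qed.

(** A zero off the circle and its reflection are two distinct zeros. *)
Lemma root_para_opuc_unit z : root A z -> z * z^* = 1.
Proof.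
move=> rz; have z0 := root_para_opuc_neq0 rz; have zc0 : z^* != 0 by rewrite conjC_eq0.
apply/eqP; apply: contraT => hz.
have [k kE] := factor_theorem _ _ rz.
have : root A (z^*)^-1.
  by rewrite rootE horner_para_opuc_conj//; move: rz; rewrite rootE => /eqP ->;
    rewrite conjC0 mulr0.
rewrite {1}kE rootM root_XsubC => /orP[|/eqP h].
  move=> /factor_theorem[k' k'E]; exfalso.
  by apply: (@para_opuc_no_reflected_pair z k' z0); rewrite {1}kE k'E.
by move: hz; rewrite -{1}h mulVf ?eqxx.
Qed.

(** A double zero on the circle is its own reflection, so the zeros are
    simple. *)
Lemma para_opuc_roots : exists r : seq R[i],
  [/\ A = lead_coef A *: \prod_(z <- r) ('X - z%:P), uniq r, size r = n.+1 &
      forall z, z \in r -> z * z^* = 1].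
Proof.
have [r rE] := closed_field_poly_normal A.
have l0 : lead_coef A != 0 by rewrite lead_coef_eq0 para_opuc_neq0.
have rr z : root A z = (z \in r) by rewrite rE rootZ// root_prod_XsubC.
exists r; split => //; last by move=> z; rewrite -rr; exact: root_para_opuc_unit.
  apply/count_mem_uniq => z; have [zr|/count_memPn //] := boolP (z \in r).
  apply/eqP; rewrite eqn_leq -has_count has_pred1 zr andbT leqNgt; apply/negP => c2.
  have zrem : z \in rem z r.
    rewrite -has_pred1 has_count; move: c2; rewrite (permP (perm_to_rem zr)) /= eqxx.
    by rewrite add1n ltnS.
  have z0 : z != 0 by apply: root_para_opuc_neq0; rewrite rr.
  have zz : z * z^* = 1 by apply: root_para_opuc_unit; rewrite rr.
  apply: (@para_opuc_no_reflected_pair z (lead_coef A *: \prod_(w <- rem z (rem z r)) ('X - w%:P)) z0).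
  have -> : (z^*)^-1 = z.
    by apply: (mulIf (_ : z^* != 0)); rewrite ?conjC_eq0// zz mulVf// conjC_eq0.
  rewrite [LHS]rE (perm_big _ (perm_to_rem zr)) big_cons (perm_big _ (perm_to_rem zrem)) big_cons.
  by rewrite -!scalerAl; congr (_ *: _); rewrite [LHS]mulrA [LHS]mulrC [LHS]mulrA.
by have := size_para_opuc; rewrite rE size_scale// size_prod_XsubC => -[].
Qed.

(** In this section [w] is a zero of A on the unit circle and [k] is the cofactor
    A / (z - w). *)
Section Node.
Variables (w : R[i]) (k : {poly R[i]}).
Hypotheses (w1 : w * w^* = 1) (kE : A = k * ('X - w%:P)).

Let w0 : w != 0.
Proof. by apply/eqP => h; have := w1; rewrite h mul0r => /esym/eqP; rewrite oner_eq0. Qed.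
Let wc0 : w^* != 0. Proof. by rewrite conjC_eq0. Qed.

Lemma size_node_cofactor : size k = n.+1.
Proof.
have k0 : k != 0.
  by apply/eqP => k0; have := para_opuc_neq0; rewrite kE k0 mul0r eqxx.
have := size_para_opuc; rewrite kE size_mul ?polyXsubC_eq0// size_XsubC addn2 /=.
by case.
Qed.

(** On the circle conj(z - w) = - conj(w) conj(z) (z - w). *)
Lemma ip_node_cofactor r : ip k (r * ('X - w%:P)) = - w^* * ip A ('X * r).
Proof.
rewrite -ipZl; apply: ip_ext => t; rewrite kE; set u := cexp t.
have uu : u * u^* = 1 by exact: cexp_mul_conj.
rewrite !hornerE !rmorphM !rmorphB /=.
have -> : - w^* * k.[u] * (u - w) * (u^* * (r.[u])^*) =
   k.[u] * (r.[u])^* * ((w * w^*) * u^* - w^* * (u * u^*)) by ring.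
by rewrite uu w1; ring.
Qed.

(** Up to a factor, the cofactor represents the evaluation at w. *)
Lemma ip_node_cofactor_eval p : (size p <= n.+1)%N -> ip p k = p.[w] * ip 1 k.
Proof.
move=> sp.
have rt : root (p - (p.[w])%:P) w by rewrite rootE !hornerE subrr.
have [r rE] := factor_theorem _ _ rt.
have sr : (size r <= n)%N.
  have [->|r0] := eqVneq r 0; first by rewrite size_poly0.
  have : (size (p - (p.[w])%:P)%R <= n.+1)%N.
    apply: leq_trans (size_polyD _ _) _; rewrite geq_max sp size_polyN.
    exact: leq_trans (size_polyC_leq1 _) _.
  by rewrite rE size_mul ?polyXsubC_eq0// size_XsubC addn2 /= ltnS.
have := ip_node_cofactor r; rewrite -rE ip_para_opuc_mulX0// mulr0 ipBr => /eqP.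
rewrite subr_eq0 => /eqP h.
rewrite ipC h -ipC -[in LHS](mulr1 (p.[w])%:P) mul_polyC ipZl.
by [].
Qed.

(** The factor is found by testing against phi - phi(w), which vanishes at w and
    has degree n + 1, while phi is orthogonal to k. *)
Lemma ip_node_cofactor1 : (phi.[w])^* * ip k 1 = eps * w^*.
Proof.
have rt : root (phi - (phi.[w])%:P) w by rewrite rootE hornerD hornerN hornerC subrr.
have [r rE] := factor_theorem _ _ rt.
have sphi : size (phi - (phi.[w])%:P) = n.+2.
  by rewrite size_polyDl size_opuc// size_polyN (leq_ltn_trans (size_polyC_leq1 _)).
have r0 : r != 0.
  by apply/eqP => r0; move: sphi; rewrite rE r0 mul0r size_poly0.
have sr : size r = n.+1.
  by move: sphi; rewrite rE size_mul ?polyXsubC_eq0// size_XsubC addn2 /= => -[].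
have rn : r`_n = kappa.
  have := congr1 (fun p => p`_n.+1) rE; rewrite /= coefB coefC /= subr0 coef_opuc.
  rewrite mulrBr coefB coefMX /= mulrC mul_polyC coefZ [X in _ - w * X]nth_default ?sr//.
  by rewrite mulr0 subr0.
have := ip_node_cofactor r; rewrite -rE ip_para_opuc_mulX ?sr// rn conj_real.
rewrite [kappa * (eps / kappa)]mulrCA divff// mulr1 ipBr.
have -> : ip k phi = 0 by rewrite ipC ip_opuc_small ?conjC0// size_node_cofactor.
rewrite -[(phi.[w])%:P](mulr1) mul_polyC ipZr sub0r mulNr => /oppr_inj ->.
by rewrite mulrC.
Qed.

Lemma opuc_node_neq0 : phi.[w] != 0.
Proof.
apply/eqP => h; have := ip_node_cofactor1; rewrite h conjC0 mul0r => /esym/eqP.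
by rewrite mulf_eq0 (negbTE eps0) (negbTE wc0).
Qed.

(** The cofactor normalized as the reproducing kernel K_n(w, z). *)
Definition node_kernel : {poly R[i]} := (eps * w * (phi.[w])^*) *: k.
Local Notation K := node_kernel.

Lemma ip_node_kernel p : (size p <= n.+1)%N -> ip p K = p.[w].
Proof.
move=> sp; have h : ip K 1 = 1.
  rewrite ipZl -mulrA ip_node_cofactor1.
  have -> : eps * w * (eps * w^*) = (eps * eps) * (w * w^*) by ring.
  by rewrite eps2 w1 mul1r.
rewrite ipZr ip_node_cofactor_eval// mulrCA -ipZr ipC -/K h.
by rewrite conjC1 mulr1.
Qed.

Lemma size_node_kernel : (size K <= n.+1)%N.
Proof. by rewrite (leq_trans (size_scale_leq _ _))// size_node_cofactor. Qed.

Lemma node_kernel_gt0 : 0 < K.[w].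
Proof.
rewrite -ip_node_kernel ?size_node_kernel//; apply: (ip_gt0 theta01 theta_nontrivial).
rewrite scaler_eq0 !mulf_eq0 (negbTE eps0) (negbTE w0) conjC_eq0 (negbTE opuc_node_neq0)/=.
by rewrite -size_poly_eq0 size_node_cofactor.
Qed.

(** As phi^*(w) = - e phi(w), the numerator of the Christoffel-Darboux quotient is
    a multiple of A. *)
Lemma CD_quotient_node u : u != w -> CD_quotient phi w u = K.[u].
Proof.
move=> uw; rewrite /CD_quotient /K (hornerZ (eps * w * (phi.[w])^*)).
have Aw : phis.[w] = - (eps * phi.[w]).
  by apply/eqP; rewrite -addr_eq0 -horner_para_opuc kE !hornerE subrr mulr0.
have Au : phis.[u] = k.[u] * (u - w) - eps * phi.[u].
  have := congr1 (fun p => p.[u]) kE; rewrite horner_para_opuc hornerM hornerXsubC => <-.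
  by rewrite addrK.
have d : 1 - w^* * u = - w^* * (u - w).
  by rewrite -w1; ring.
have d0 : 1 - w^* * u != 0 by rewrite d mulf_neq0 ?oppr_eq0// subr_eq0.
apply: (mulIf d0); rewrite divfK// d Aw Au rmorphN rmorphM /= conj_real.
have -> : eps * w * (phi.[w])^* * k.[u] * (- w^* * (u - w)) =
  - (eps * (phi.[w])^* * (k.[u] * (u - w))) * (w * w^*) by ring.
rewrite w1 mulr1 mulrN mulrBl opprB.
have -> : eps * phi.[u] * (eps * (phi.[w])^*) = (eps * eps) * phi.[u] * (phi.[w])^* by ring.
rewrite eps2; ring.
Qed.

Lemma CD_kernel_node : CD_kernel phi w w = K.[w].
Proof.
rewrite /CD_kernel mulrC w1 eqxx; apply: (@cvg_lim _ (@norm_hausdorff _ R[i]^o)).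
have c : (K.[u] : R[i]^o) @[u --> (w : R[i]^o)^'] --> (K.[w] : R[i]^o).
  by apply: cvg_within_filter; exact: (@continuous_cpoly R[i] K w).
apply: cvg_trans c; apply: near_eq_cvg.
apply: filterS (@nbhs_dnbhs_neq R[i]^o w) => u uw.
by rewrite /= -CD_quotient_node.
Qed.

End Node.

End Sign.

End ParaOrthogonal.

(** * Quadrature at the zeros and sign of the nodal product *)

Section Quadrature.
Context {R : realType} (theta : probability (measurableTypeR R) R).
Hypothesis theta01 : theta [set` `[0%R, 1%R[] = 1%E.
Hypothesis theta_nontrivial : nontrivial_measure theta.
Variable n : nat.
Variable e : R.
Hypothesis e2 : e * e = 1.
Implicit Types (p : {poly R[i]}) (w : R[i]) (s : seq R).

Local Notation ip := (ip theta).
Local Notation phi := (opuc theta n.+1).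
Local Notation A := (para_opuc theta n e).
Local Notation eps := (e%:C)%C.

(** The weight 1/K_n(e(xi), e(xi)). *)
Definition weight (xi : R) : R :=
  (complex.Re (CD_kernel phi (cexp xi) (cexp xi)))^-1.

(** The zeros of A, listed by their parameters in [0, 1). *)
Lemma para_opuc_nodes : exists s, [/\ uniq s, size s = n.+1,
    all (fun xi => 0 <= xi < 1) s,
    (forall xi, (0 <= xi < 1) && (A.[cexp xi] == 0) = (xi \in s)) &
    A = lead_coef A *: \prod_(xi <- s) ('X - (cexp xi)%:P)].
Proof.
have [r [rE ur sr r1]] := para_opuc_roots theta01 theta_nontrivial n e2.
have /choice[g hg] (w : R[i]) : exists t : R, w \in r -> 0 <= t < 1 /\ cexp t = w.
  have [wr|wr] := boolP (w \in r); last by exists 0.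
  by have [t t01 tw] := cexp_onto (r1 _ wr); exists t.
have l0 : lead_coef A != 0 by rewrite lead_coef_eq0 para_opuc_neq0.
have rootr z : (A.[z] == 0) = (z \in r) by rewrite -rootE rE rootZ// root_prod_XsubC.
exists (map g r); split.
- rewrite map_inj_in_uniq// => w1 w2 h1 h2 h.
  by rewrite -(hg _ h1).2 h (hg _ h2).2.
- by rewrite size_map.
- by apply/allP => _ /mapP[w wr ->]; case: (hg _ wr).
- move=> xi; rewrite rootr; apply/andP/mapP => [[h1 h2]|[w wr ->]].
    exists (cexp xi) => //; apply: cexp_inj => //; first by case: (hg _ h2).
    by rewrite (hg _ h2).2.
  by have [h1 h2] := hg _ wr; rewrite h2.
rewrite big_map [LHS]rE; congr (_ *: _); apply: eq_big_seq => w wr.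
by rewrite (hg _ wr).2.
Qed.

Section Nodes.
Variable s : seq R.
Hypotheses (us : uniq s) (ss : size s = n.+1) (s01 : all (fun xi => 0 <= xi < 1) s).
Hypothesis memA : forall xi, (0 <= xi < 1) && (A.[cexp xi] == 0) = (xi \in s).
Hypothesis AE : A = lead_coef A *: \prod_(xi <- s) ('X - (cexp xi)%:P).

Lemma root_node xi : xi \in s -> root A (cexp xi).
Proof. by rewrite -memA rootE => /andP[]. Qed.

(** The cofactor A / (z - w) of a zero w. *)
Definition node_quotient w : {poly R[i]} := A %/ ('X - w%:P).

Lemma node_quotientE xi : xi \in s ->
  A = node_quotient (cexp xi) * ('X - (cexp xi)%:P).
Proof. by move=> /root_node; rewrite -dvdp_XsubCl => /divpK. Qed.

(** The kernel K_n(w, z) as a polynomial in z. *)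
Definition node_repr w : {poly R[i]} := node_kernel theta n e w (node_quotient w).

Lemma CD_kernel_nodeE xi : xi \in s ->
  CD_kernel phi (cexp xi) (cexp xi) = (node_repr (cexp xi)).[cexp xi].
Proof.
move=> h; apply: (CD_kernel_node e2 _ (node_quotientE h)).
exact: cexp_mul_conj.
Qed.

Lemma node_repr_gt0 xi : xi \in s -> 0 < (node_repr (cexp xi)).[cexp xi].
Proof.
move=> h; apply: (node_kernel_gt0 theta01 theta_nontrivial e2 _ (node_quotientE h)).
exact: cexp_mul_conj.
Qed.

Lemma weightE xi : xi \in s -> ((weight xi)%:C)%C = (node_repr (cexp xi)).[cexp xi]^-1.
Proof.
move=> h; rewrite /weight CD_kernel_nodeE// fmorphV /=; congr (_^-1).
have := node_repr_gt0 h; case: (_.[_]) => a b; rewrite ltcE /= => /andP[/eqP b0 _].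
by rewrite b0.
Qed.

Lemma weight_gt0 xi : xi \in s -> 0 < weight xi.
Proof. by move=> h; rewrite -ltcR weightE// invr_gt0 node_repr_gt0. Qed.

(** Expansion of [p] in the basis of kernels at the nodes, which vanish at all
    nodes but their own. *)
Lemma quadrature_poly p : (size p <= n.+1)%N ->
  ip p 1 = \sum_(xi <- s) p.[cexp xi] * ((weight xi)%:C)%C.
Proof.
move=> sp.
have pE : p = \sum_(xi <- s) (p.[cexp xi] * ((weight xi)%:C)%C) *: node_repr (cexp xi).
  apply/eqP; rewrite -subr_eq0; apply/eqP.
  apply: (@roots_geq_poly_eq0 _ _ (map cexp s)).
  - apply/allP => _ /mapP[xi xs ->]; rewrite rootE hornerD hornerN horner_sum.
    rewrite (bigD1_seq xi)//= hornerZ -mulrA weightE// mulVf ?mulr1; last first.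
      by rewrite gt_eqF// node_repr_gt0.
    rewrite big_seq_cond big1 ?addr0 ?subrr// => zeta /andP[zs ne].
    rewrite hornerZ.
    suff -> : (node_repr (cexp zeta)).[cexp xi] = 0 by rewrite mulr0.
    rewrite /node_repr /node_kernel hornerZ.
    have := root_node xs; rewrite rootE {1}(node_quotientE zs) hornerM hornerXsubC mulf_eq0.
    case/orP => [/eqP ->|]; first by rewrite mulr0.
    rewrite subr_eq0 => /eqP h; move: ne; rewrite (@cexp_inj R xi zeta) ?eqxx//.
      exact: (allP s01).
    exact: (allP s01).
  - rewrite map_inj_in_uniq// => a b ha hb; apply: cexp_inj; exact: (allP s01).
  - rewrite size_map ss; apply: leq_trans (size_polyD _ _) _; rewrite geq_max sp size_polyN.
    apply: (leq_trans (size_sum _ _ _)); apply/bigmax_leqP_seq => xi xs _.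
    apply: leq_trans (size_scale_leq _ _) _.
    apply: (size_node_kernel theta01 theta_nontrivial e2 (node_quotientE xs)).
rewrite [in LHS]pE ip_suml; apply: eq_big_seq => xi xs; rewrite ipZl.
suff -> : ip (node_repr (cexp xi)) 1 = 1 by rewrite mulr1.
rewrite ipC (ip_node_kernel theta01 theta_nontrivial e2 _ (node_quotientE xs)).
- by rewrite hornerC conjC1.
- exact: cexp_mul_conj.
- by rewrite size_poly1.
Qed.

Lemma quadrature_cexp (k : nat) : (k < (2 * n).+1)%N ->
  cintegral theta (fun t => cexp ((k%:R - n%:R) * t)) =
  \sum_(xi <- s) cexp ((k%:R - n%:R) * xi) * ((weight xi)%:C)%C.
Proof.
have key j : (j <= n)%N -> cintegral theta (fun t => cexp t ^+ j) =
    \sum_(xi <- s) cexp xi ^+ j * ((weight xi)%:C)%C.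
  move=> jn; have := @quadrature_poly 'X^j; rewrite size_polyXn ltnS => /(_ jn).
  under eq_bigr do rewrite hornerXn.
  move=> <-; congr cintegral; apply/funext => t.
  by rewrite hornerC conjC1 mulr1 hornerXn.
move=> kn; have [nk|kn'] := leqP n k.
  have kj : (k - n <= n)%N by rewrite leq_subLR addnn -mul2n -ltnS.
  rewrite -natrB//; under eq_bigr do rewrite cexpMn.
  by rewrite -key//; congr cintegral; apply/funext => t; rewrite cexpMn.
have ke (t : R) : cexp ((k%:R - n%:R) * t) = (cexp t ^+ (n - k))^*.
  by rewrite -cexpMn -cexpN; congr cexp; rewrite natrB ?(ltnW kn')// -mulNr opprB.
under eq_bigr do rewrite ke; under eq_fun do rewrite ke.
rewrite cintegral_conj; last first.
  have := bounded_measurable_horner ('X^(n - k) : {poly R[i]}).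
  by under eq_fun do rewrite hornerXn.
rewrite key ?leq_subr// rmorph_sum /=; apply: eq_bigr => xi _.
by rewrite rmorphM /= conj_real.
Qed.

Lemma bounded_measurable_cexpM (c : R) : bounded_measurable (fun t : R => cexp (c * t)).
Proof.
have cc : continuous (fun t : R => 2 * pi * (c * t)).
  by move=> t; apply: (@continuous_comp _ _ _ (fun t : R => c * t) (fun t => 2 * pi * t));
    exact: mulrl_continuous.
split.
- apply: continuous_measurable_fun => t.
  exact: (@continuous_comp _ _ _ (fun t : R => 2 * pi * (c * t)) cos _ (cc t) (@continuous_cos R _)).
- apply: continuous_measurable_fun => t.
  exact: (@continuous_comp _ _ _ (fun t : R => 2 * pi * (c * t)) sin _ (cc t) (@continuous_sin R _)).
- by exists 1 => t /=; rewrite cos_max sin_max.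
Qed.

Lemma quadrature_trig (l : R -> R) : real_trig_poly n l ->
  (\int[theta]_(t in `[0%R, 1%R[) (l t)%:E = (\sum_(xi <- s) l xi * weight xi)%:E)%E.
Proof.
move=> [a la].
have bm k : bounded_measurable (fun t => a k * cexp ((k%:R - n%:R) * t)).
  apply: bounded_measurableM; first exact: bounded_measurable_cst.
  exact: bounded_measurable_cexpM.
have [bs cs] := cintegral_sum theta bm.
have eI : cintegral theta (fun t => ((l t)%:C)%C) =
   ((\sum_(xi <- s) l xi * weight xi)%:C)%C.
  under eq_fun do rewrite la; rewrite cs rmorph_sum /=.
  under [RHS]eq_bigr do rewrite rmorphM /= la mulr_suml.
  rewrite exchange_big /=; apply: eq_bigr => k _.
  rewrite cintegralZ; last exact: bounded_measurable_cexpM.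
  by rewrite quadrature_cexp// mulr_sumr; apply: eq_bigr => xi _; rewrite mulrA.
have li : theta.-integrable `[0%R, 1%R[%classic (EFin \o l).
  have := integrable_Re theta bs; apply: eq_integrable; first exact: measurable_itv.
  by move=> t _; rewrite /= -la.
have := congr1 (@complex.Re R) eI; rewrite /= => <-.
by rewrite fineK//; apply: integrable_fin_num => //; exact: measurable_itv.
Qed.

End Nodes.

Hypothesis theta_even : even_measure theta.

Lemma opuc_real z : phi.[z^*] = (phi.[z])^*.
Proof.
rewrite opucE (hornerZ (opuc_scale theta n)%:C%C) (hornerZ (opuc_scale theta n)%:C%C).
rewrite rmorphM /= conj_real -horner_map /=.
by rewrite (monic_opuc_real theta01 theta_nontrivial theta_even).
Qed.

Lemma para_opuc_real z : z != 0 -> A.[z^*] = (A.[z])^*.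
Proof.
move=> z0; have zc0 : z^* != 0 by rewrite conjC_eq0.
rewrite !horner_para_opuc rmorphD rmorphM /= conj_real opuc_real.
congr (_ + _); rewrite !(horner_reverse_opuc theta01 theta_nontrivial)//.
by rewrite conjCK -opuc_real fmorphV /= rmorphM rmorphXn /= conjCK.
Qed.

Lemma lead_coef_para_opuc_real : (lead_coef A)^* = lead_coef A.
Proof.
have e0 i : (phi`_i)^* = phi`_i.
  rewrite opucE (coefZ (opuc_scale theta n)%:C%C) rmorphM /= conj_real; congr (_ * _).
  by rewrite -[in RHS](monic_opuc_real theta01 theta_nontrivial theta_even) coef_map.
have AE i : A`_i = (reverse_poly phi)`_i + eps * phi`_i by rewrite coefD (coefZ eps phi).
rewrite lead_coefE AE rmorphD rmorphM /= conj_real e0; congr (_ + _).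
rewrite /reverse_poly coef_poly; case: ifP => _; last exact: conjC0.
by rewrite conjCK e0.
Qed.

(** For z and w on the unit circle, (z - w)(z - conj w) conj(z) is the difference
    of the doubled real parts. *)
Lemma circle_abscissa_sub (t xi : R) :
  ((circle_abscissa t - circle_abscissa xi)%:C)%C =
  (cexp t - cexp xi) * (cexp t - (cexp xi)^*) * (cexp t)^* / 4.
Proof.
have h (u : R) : ((circle_abscissa u)%:C)%C = (2 + cexp u + (cexp u)^*) / 4.
  have e1 : cexp u + (cexp u)^* = ((2 * cos (2 * pi * u))%:C)%C.
    by apply: eq_ReIm; rewrite ?cReD ?cImD ?cRe_conj ?cIm_conj /=; ring.
  rewrite -addrA e1 /circle_abscissa !rmorphM rmorphD rmorph1 fmorphV /= rmorph_nat.
  by field.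
rewrite rmorphB /= !h; have t1 := cexp_mul_conj t; have x1 := cexp_mul_conj xi.
set z := cexp t in t1 *; set w := cexp xi in x1 *.
have -> : (z - w) * (z - w^*) * z^* = (z * z^*) * z - (w + w^*) * (z * z^*) + (w * w^*) * z^* by ring.
by rewrite t1 x1; field.
Qed.

(** The nodal product is |A|^2 up to a constant of the sign of e.  With the previous
    lemma it is conj(z)^(n+1) times the product of the z - w_j times that of the
    z - conj(w_j); both products are A(z)/a, a being the real leading
    coefficient, and conj(z)^(n+1) A(z) = e conj(A(z)). *)
Lemma nodal_product_sign s : size s = n.+1 ->
  A = lead_coef A *: \prod_(xi <- s) ('X - (cexp xi)%:P) ->
  exists c : R, 0 < c /\ forall t : R,
    e * \prod_(xi <- s) (circle_abscissa t - circle_abscissa xi) =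
    c * Normc.normc A.[cexp t] ^+ 2.
Proof.
move=> ss AE; set a := lead_coef A in AE *.
have a0 : a != 0 by rewrite lead_coef_eq0 para_opuc_neq0.
have aR : a^* = a by exact: lead_coef_para_opuc_real.
have are : a = ((complex.Re a)%:C)%C.
  by apply: eq_ReIm => //=; have := congr1 (@complex.Im R) aR; rewrite cIm_conj /=; lra.
have a0' : complex.Re a != 0.
  by apply: contra a0 => /eqP h; rewrite are h.
exists ((complex.Re a ^+ 2)^-1 / 4 ^+ n.+1); split.
  by rewrite divr_gt0 ?exprn_gt0// invr_gt0 exprn_even_gt0.
move=> t; set z := cexp t.
have Az : A.[z] = a * \prod_(xi <- s) (z - cexp xi).
  rewrite {1}AE hornerZ horner_prod; congr (_ * _); apply: eq_bigr => xi _.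
  by rewrite hornerXsubC.
have Azc : A.[z] = a * \prod_(xi <- s) (z - (cexp xi)^*).
  have := para_opuc_real (cexp_neq0 (- t)); rewrite cexpN conjCK -/z => ->.
  rewrite AE hornerZ horner_prod rmorphM /= aR rmorph_prod /=; congr (_ * _).
  by apply: eq_bigr => xi _; rewrite hornerXsubC rmorphB /= conjCK.
apply: (@complexI R); rewrite [LHS]rmorphM rmorph_prod /=.
under eq_bigr do rewrite circle_abscissa_sub -/z -mulrA.
rewrite !big_split /= big_const_seq count_predT ss iter_mulr_1.
have hP : \prod_(xi <- s) (z - cexp xi) = A.[z] / a by rewrite Az mulrC mulKf.
have hPc : \prod_(xi <- s) (z - (cexp xi)^*) = A.[z] / a by rewrite Azc mulrC mulKf.
rewrite hP hPc.
have hz := horner_para_opuc_cexp theta01 theta_nontrivial n e2 t; rewrite -/z in hz.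
have zz : z * z^* = 1 by exact: cexp_mul_conj.
have hz2 : eps * z^* ^+ n.+1 * A.[z] = (A.[z])^*.
  rewrite [in LHS]hz.
  have -> : eps * z^* ^+ n.+1 * (z ^+ n.+1 * eps * (A.[z])^*) =
    (eps * eps) * (z ^+ n.+1 * z^* ^+ n.+1) * (A.[z])^* by ring.
  by rewrite -rmorphM /= e2 -exprMn zz expr1n !mul1r.
rewrite big_const_seq count_predT ss iter_mulr_1 exprVn.
have -> : eps * (A.[z] / a * (A.[z] / a) * (z^* ^+ n.+1 / 4 ^+ n.+1)) =
  (eps * z^* ^+ n.+1 * A.[z]) * A.[z] / a ^+ 2 / 4 ^+ n.+1 by field; rewrite a0 expf_neq0.
rewrite hz2 normc_sqrE !rmorphM /= !fmorphV !rmorphXn /= -are rmorph_nat.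
have -> : ((complex.Re (A.[z] * (A.[z])^*))%:C)%C = A.[z] * (A.[z])^*.
  apply: eq_ReIm => //=; rewrite cImM cRe_conj cIm_conj; ring.
by ring.
Qed.

End Quadrature.

(** * Trigonometric polynomials and multiple zeros *)

Section TrigPoly.
Context {R : realType}.
Implicit Types (D P : {poly R[i]}) (t xi : R).

(** Elements of Lambda_n are z^(-n) D(z) with D a polynomial of degree at most
    2n. *)
Lemma trig_polyP n (g : R -> R[i]) : trig_poly n g <->
  exists2 D : {poly R[i]}, (size D <= (2 * n).+1)%N & forall t, g t = (cexp t)^* ^+ n * D.[cexp t].
Proof.
have ke (k : nat) t : cexp ((k%:R - n%:R) * t) = (cexp t)^* ^+ n * cexp t ^+ k.
  by rewrite mulrBl cexpD cexpN !cexpMn rmorphXn /= mulrC.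
split=> [[a ga]|[D sD gD]].
  exists (\poly_(k < (2 * n).+1) a (inord k)); first exact: size_poly.
  move=> t; rewrite ga horner_poly mulr_sumr; apply: eq_bigr => k _.
  by rewrite inord_val ke mulrCA.
exists (fun k => D`_k) => t; rewrite gD (horner_coef_wide _ sD) mulr_sumr.
by apply: eq_bigr => k _; rewrite ke mulrCA.
Qed.

Lemma circle_abscissa_cexp t :
  ((circle_abscissa t)%:C)%C = (cexp t + 1) ^+ 2 * (cexp t)^* / 4.
Proof.
have e1 : cexp t + (cexp t)^* = ((2 * cos (2 * pi * t))%:C)%C.
  by apply: eq_ReIm; rewrite ?cReD ?cImD ?cRe_conj ?cIm_conj /=; ring.
have -> : (cexp t + 1) ^+ 2 * (cexp t)^* =
  (cexp t * (cexp t)^*) * cexp t + 2 * (cexp t * (cexp t)^*) + (cexp t)^* by ring.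
rewrite cexp_mul_conj mul1r mulr1 addrAC e1.
by rewrite /circle_abscissa !rmorphM rmorphD rmorph1 fmorphV /= rmorph_nat; field.
Qed.

(** With x = (z + 1)^2 conj(z)/4, the power x^i is
    z^(-n) (z + 1)^(2i) z^(n-i) / 4^i. *)
Lemma real_trig_poly_abscissa n (p : {poly R}) : (size p <= n.+1)%N ->
  real_trig_poly n (fun t => p.[circle_abscissa t]).
Proof.
move=> sp; apply/trig_polyP.
exists (\sum_(i < n.+1) (((p`_i)%:C)%C / 4 ^+ i) *: (('X + 1%:P) ^+ (2 * i) * 'X^(n - i))).
  apply: (leq_trans (size_sum _ _ _)); apply/bigmax_leqP => i _.
  apply: leq_trans (size_scale_leq _ _) _.
  apply: leq_trans (size_polyMleq _ _) _.
  rewrite size_polyXn addnS /=.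
  have s1 : (size ((('X + 1%:P) : {poly R[i]}) ^+ (2 * i))%R <= (2 * i).+1)%N.
    by apply: leq_trans (size_poly_exp_leq _ _) _; rewrite size_XaddC mul1n.
  apply: (@leq_trans ((2 * i).+1 + (n - i))%N); first by rewrite leq_add2r.
  have := ltn_ord i; rewrite ltnS => iln.
  by rewrite addSn ltnS mul2n -addnn -addnA subnKC// mul2n -addnn leq_add2r.
move=> t; rewrite (horner_coef_wide _ sp) rmorph_sum /= horner_sum mulr_sumr.
apply: eq_bigr => i _; rewrite rmorphM rmorphXn /= circle_abscissa_cexp.
rewrite hornerZ hornerM horner_exp hornerD hornerX hornerC hornerXn.
have iln : (i <= n)%N by rewrite -ltnS ltn_ord.
set z := cexp t; have zz : z^* * z = 1 by rewrite mulrC cexp_mul_conj.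
have -> : z^* ^+ n = z^* ^+ i * z^* ^+ (n - i) by rewrite -exprD subnKC.
have -> : z^* ^+ i * z^* ^+ (n - i) *
    (((p`_i)%:C)%C / 4 ^+ i * ((z + 1) ^+ (2 * i) * z ^+ (n - i))) =
  ((p`_i)%:C)%C * (((z + 1) ^+ (2 * i) * z^* ^+ i) / 4 ^+ i) * (z^* ^+ (n - i) * z ^+ (n - i)) by ring.
by rewrite -exprMn zz expr1n mulr1 !exprMn exprM exprVn exprAC [in RHS]expr2.
Qed.

Lemma real_trig_polyB n (f g : R -> R) : real_trig_poly n f -> real_trig_poly n g ->
  real_trig_poly n (fun t => f t - g t).
Proof.
move=> [a fa] [b gb]; exists (fun k => a k - b k) => t.
by rewrite rmorphB /= fa gb -sumrB; apply: eq_bigr => k _; rewrite [RHS]mulrBl.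
Qed.

Lemma real_trig_polyZ n (c : R) (f : R -> R) : real_trig_poly n f ->
  real_trig_poly n (fun t => c * f t).
Proof.
move=> [a fa]; exists (fun k => (c%:C)%C * a k) => t.
by rewrite rmorphM /= fa mulr_sumr; apply: eq_bigr => k _; rewrite mulrA.
Qed.

Lemma is_derive_cos2pi (c t : R) :
  is_derive t 1 (fun t => cos (2 * pi * (t - c))) (- (2 * pi) * sin (2 * pi * (t - c))).
Proof.
apply: is_derive_eq; rewrite /GRing.scale /=; ring.
Qed.

Lemma cRe_cexp t : complex.Re (cexp t) = cos (2 * pi * t).
Proof. by []. Qed.

Lemma cIm_cexp t : complex.Im (cexp t) = sin (2 * pi * t).
Proof. by []. Qed.

Lemma is_derive_Re_cexp t :
  is_derive t 1 (fun t => complex.Re (cexp t)) (- (2 * pi) * complex.Im (cexp t)).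
Proof. by rewrite /cexp /=; apply: is_derive_eq; rewrite /GRing.scale /=; ring. Qed.

Lemma is_derive_Im_cexp t :
  is_derive t 1 (fun t => complex.Im (cexp t)) (2 * pi * complex.Re (cexp t)).
Proof. by rewrite /cexp /=; apply: is_derive_eq; rewrite /GRing.scale /=; ring. Qed.

(** The chain rule: the derivative of P(e(t)) is 2 pi i e(t) P'(e(t)). *)
Lemma is_derive_horner_cexp P t :
  is_derive t 1 (fun t => complex.Re (P.[cexp t])) (- (2 * pi) * complex.Im (cexp t * P^`().[cexp t])) /\
  is_derive t 1 (fun t => complex.Im (P.[cexp t])) (2 * pi * complex.Re (cexp t * P^`().[cexp t])).
Proof.
elim/poly_ind: P => [|P c [IHr IHi]].
  under eq_fun do rewrite horner0; under [X in _ /\ is_derive _ _ X _]eq_fun do rewrite horner0.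
  rewrite deriv0 horner0 mulr0 /= !mulr0.
  by split; exact: is_derive_cst.
have dr := is_derive_Re_cexp t; have di := is_derive_Im_cexp t.
rewrite derivD derivM derivX mulr1 derivC addr0.
have eR : (fun t => complex.Re (P * 'X + c%:P).[cexp t]) =
  (fun t => complex.Re (P.[cexp t]) * complex.Re (cexp t) -
            complex.Im (P.[cexp t]) * complex.Im (cexp t) + complex.Re c).
  by apply/funext => u; rewrite hornerMXaddC cReD cReM.
have eI : (fun t => complex.Im (P * 'X + c%:P).[cexp t]) =
  (fun t => complex.Re (P.[cexp t]) * complex.Im (cexp t) +
            complex.Im (P.[cexp t]) * complex.Re (cexp t) + complex.Im c).
  by apply/funext => u; rewrite hornerMXaddC cImD cImM.
rewrite eR eI hornerD hornerMX !cReM !cImM !cReD !cImD !cReM !cImM.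
split; apply: is_derive_eq; rewrite /GRing.scale /= !(cReM, cImM, cReD, cImD) !(cRe_cexp, cIm_cexp); ring.
Qed.

(** A zero of the trigonometric polynomial together with its derivative is a
    double zero of D, by differentiating D(e(t)) = e(t)^n g(t). *)
Lemma double_root_of_flat n (g : R -> R) D xi :
  (forall t, ((g t)%:C)%C = (cexp t)^* ^+ n * D.[cexp t]) ->
  g xi = 0 -> is_derive xi 1 g 0 -> D.[cexp xi] = 0 /\ D^`().[cexp xi] = 0.
Proof.
move=> gD g0 dg.
have DE t : D.[cexp t] = cexp t ^+ n * ((g t)%:C)%C.
  by rewrite gD mulrA -exprMn cexp_mul_conj expr1n mul1r.
have D0 : D.[cexp xi] = 0 by rewrite DE g0 mulr0.
split => //.
have [dr di] := is_derive_horner_cexp D xi.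
have [xr xi'] := is_derive_horner_cexp ('X^n) xi.
have dr0 : is_derive xi 1 (fun t => complex.Re (D.[cexp t])) 0.
  have -> : (fun t => complex.Re (D.[cexp t])) = (fun t => complex.Re ('X^n).[cexp t] * g t).
    by apply/funext => t; rewrite DE hornerXn cReM /= mulr0 subr0.
  by apply: is_derive_eq; rewrite /GRing.scale /= g0 mulr0 mul0r addr0.
have di0 : is_derive xi 1 (fun t => complex.Im (D.[cexp t])) 0.
  have -> : (fun t => complex.Im (D.[cexp t])) = (fun t => complex.Im ('X^n).[cexp t] * g t).
    by apply/funext => t; rewrite DE hornerXn cImM /= mulr0 add0r.
  by apply: is_derive_eq; rewrite /GRing.scale /= g0 mulr0 mul0r addr0.
have pi0 : 2 * pi != 0 :> R by rewrite mulf_neq0// gt_eqF// pi_gt0.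
have hr : complex.Im (cexp xi * D^`().[cexp xi]) = 0.
  apply: (mulfI (_ : - (2 * pi) != 0)); first by rewrite oppr_eq0.
  by rewrite mulr0 -(@derive_val _ _ _ _ _ _ _ dr) (@derive_val _ _ _ _ _ _ _ dr0).
have hi : complex.Re (cexp xi * D^`().[cexp xi]) = 0.
  apply: (mulfI pi0).
  by rewrite mulr0 -(@derive_val _ _ _ _ _ _ _ di) (@derive_val _ _ _ _ _ _ _ di0).
apply: (mulfI (cexp_neq0 xi)); rewrite mulr0.
exact: eq_ReIm.
Qed.

Lemma derivable_real_trig n (g : R -> R) D t :
  (forall t, ((g t)%:C)%C = (cexp t)^* ^+ n * D.[cexp t]) -> derivable g t 1.
Proof.
move=> gD.
have -> : g = (fun t => complex.Re ('X^n).[cexp t] * complex.Re (D.[cexp t]) +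
   complex.Im ('X^n).[cexp t] * complex.Im (D.[cexp t])).
  apply/funext => u; have := congr1 (@complex.Re R) (gD u).
  rewrite -rmorphXn /= cReM cRe_conj cIm_conj hornerXn => ->; ring.
have [dr di] := is_derive_horner_cexp D t.
have [xr xi'] := is_derive_horner_cexp ('X^n) t.
exact: ex_derive.
Qed.

(** If g vanishes at xi and is bounded above near xi by a multiple of
    |e(t) - e(xi)|^2, then the difference has a local maximum at xi. *)
Lemma flat_of_quadratic_bound (g : R -> R) (M xi : R) :
  (forall t, derivable g t 1) -> g xi = 0 ->
  (\forall t \near xi, g t <= M * (2 - 2 * cos (2 * pi * (t - xi)))) ->
  is_derive xi 1 g 0.
Proof.
move=> dg g0 /nbhs_ballP[d /= d0 hd].
pose q t := M * (2 - 2 * cos (2 * pi * (t - xi))).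
have dq t : is_derive t 1 q (M * (2 * (2 * pi * sin (2 * pi * (t - xi))))).
  have h := is_derive_cos2pi xi t.
  rewrite /q; apply: is_derive_eq; rewrite /GRing.scale /=; ring.
have dgq t : is_derive t 1 g ('D_1 g t) by apply: derivableP; exact: dg.
have h : is_derive xi 1 (g - q) 0.
  apply: (@derive1_at_max _ _ (xi - d) (xi + d)); first lra.
  - move=> t _; apply: derivableB => //; exact: ex_derive.
  - by rewrite in_itv/=; apply/andP; split; lra.
  - move=> t; rewrite in_itv/= => /andP[t1 t2]; rewrite !fctE g0 /q subrr mulr0 cos0.
    rewrite mulr1 subrr mulr0 subrr subr_le0; apply: hd.
    by rewrite /ball /= ltr_norml; apply/andP; split; lra.
have -> : g = (g - q) + q by apply/funext => t; rewrite !fctE subrK.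
rewrite -[0]addr0; apply: is_deriveD => //.
apply: is_derive_eq; rewrite subrr mulr0 sin0; ring.
Qed.

Lemma deriv_horner_mulXsubC P (w : R[i]) : (P * ('X - w%:P))^`().[w] = P.[w].
Proof.
by rewrite derivM derivXsubC mulr1 hornerD hornerM hornerXsubC subrr mulr0 add0r.
Qed.

(** n + 1 zeros, all of them double except possibly the one at 0, are too many for
    a nonzero element of Lambda_n. *)
Lemma real_trig_poly_eq0 n (s : seq R) (g : R -> R) :
  uniq s -> size s = n.+1 -> all (fun xi => 0 <= xi < 1) s ->
  real_trig_poly n g ->
  (forall xi, xi \in s -> g xi = 0) ->
  (forall xi, xi \in s -> xi != 0 -> is_derive xi 1 g 0) ->
  forall t, g t = 0.
Proof.
move=> us ss s01 /trig_polyP[D sD gD] g0 dg t.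
suff D0 : D = 0.
  by have := gD t; rewrite D0 horner0 mulr0 => /(@complexI R).
have root_s xi : xi \in s -> D.[cexp xi] = 0.
  by move=> xs; have := gD xi; rewrite g0// => /esym/eqP;
    rewrite mulf_eq0 expf_eq0 conjC_eq0 (negbTE (cexp_neq0 xi)) andbF/= => /eqP.
have inj_s : {in s &, injective (@cexp R)}.
  by move=> x y xs ys; apply: cexp_inj; exact: (allP s01).
have [q qE] : exists q : {poly R[i]}, D = q * \prod_(z <- map cexp s) ('X - z%:P).
  apply/dvdpP; apply: uniq_roots_dvdp.
    by apply/allP => _ /mapP[xi xs ->]; rewrite rootE root_s.
  by rewrite uniq_rootsE map_inj_in_uniq.
set N := \prod_(z <- _) _ in qE.
have sN : size N = n.+2 by rewrite size_prod_XsubC size_map ss.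
have q0 xi : xi \in s -> xi != 0 -> q.[cexp xi] = 0.
  move=> xs x0; have [_] := double_root_of_flat gD (g0 _ xs) (dg _ xs x0).
  have NE : N = \prod_(z <- map cexp (rem xi s)) ('X - z%:P) * ('X - (cexp xi)%:P).
    by rewrite /N !big_map (perm_big _ (perm_to_rem xs)) big_cons mulrC.
  rewrite qE NE mulrA deriv_horner_mulXsubC hornerM => /eqP.
  rewrite mulf_eq0 => /orP[/eqP //|].
  rewrite horner_prod prodf_seq_eq0 => /hasP[_ /mapP[zeta zs ->]] /=.
  rewrite hornerXsubC subr_eq0 => /eqP /inj_s.
  have zs' : zeta \in s by exact: mem_rem zs.
  move=> /(_ xs zs') e; move: zs; rewrite -e mem_rem_uniq// inE eqxx.
  by [].
(* q has degree less than n and vanishes at the nodes other than 0, of which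
   there are at least n. *)
have : q = 0.
  have [//|qn0] := eqVneq q 0.
  apply: (@roots_geq_poly_eq0 _ _ (map cexp [seq xi <- s | xi != 0])).
  - apply/allP => _ /mapP[xi + ->]; rewrite mem_filter /= => /andP[x0 xs].
    by rewrite rootE q0.
  - rewrite map_inj_in_uniq ?filter_uniq// => x y; rewrite !mem_filter => /andP[_ xs] /andP[_ ys].
    exact: inj_s.
  - rewrite size_map.
    have hq : (size q <= n)%N.
      have N0 : N != 0 by rewrite -size_poly_eq0 sN.
      by move: sD; rewrite qE size_mul// sN !addnS /= ltnS mul2n -addnn leq_add2r.
    apply: (leq_trans hq).
    have := count_predC (pred1 (0 : R)) s; rewrite ss size_filter.
    have c1 : (count_mem (0%R : R) s <= 1)%N by rewrite count_uniq_mem//; case: (_ \in _).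
    by move=> h; rewrite -(leq_add2l 1) add1n -h leq_add2r.
by rewrite qE => ->; rewrite mul0r.
Qed.

End TrigPoly.

(** * The extremal problem *)

Section Extremal.
Context {R : realType} (theta : probability (measurableTypeR R) R).
Hypothesis theta01 : theta [set` `[0%R, 1%R[] = 1%E.
Hypothesis theta_nontrivial : nontrivial_measure theta.
Hypothesis theta_even : even_measure theta.
Variable n : nat.
Implicit Types (xi t : R).

Local Notation phi := (opuc theta n.+1).

Lemma circle_abscissa_lt1 xi : 0 <= xi < 1 -> xi != 0 -> circle_abscissa xi < 1.
Proof.
move=> h x0; rewrite lt_neqAle; case/andP: (circle_abscissa_itv xi) => _ ->.
rewrite andbT; apply: contra x0 => /eqP hx; apply/eqP.
have c1 : cos (2 * pi * xi) = 1 by move: hx; rewrite /circle_abscissa; lra.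
have s0 : sin (2 * pi * xi) = 0 by apply: cos1sin0; rewrite c1 normr1.
apply: cexp_inj => //; first lra.
by rewrite cexp0; apply: eq_ReIm.
Qed.

Lemma cexp_dist t xi :
  Normc.normc (cexp t - cexp xi) ^+ 2 = 2 - 2 * cos (2 * pi * (t - xi)).
Proof.
rewrite normc_sqrE.
have -> : (cexp t - cexp xi) * (cexp t - cexp xi)^* =
  cexp t * (cexp t)^* + cexp xi * (cexp xi)^* -
  (cexp t * (cexp xi)^* + (cexp t * (cexp xi)^*)^* ).
  by rewrite rmorphB rmorphM /= conjCK; ring.
rewrite !cexp_mul_conj -cexpN -cexpD cReD.
have -> : complex.Re (- (cexp (t - xi) + (cexp (t - xi))^*)) = - (2 * cos (2 * pi * (t - xi))).
  by rewrite -mulN1r cReM cReD cImD cRe_conj cIm_conj /=; ring.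
by rewrite cReD /=; ring.
Qed.

Lemma normc_sqrM (z w : R[i]) :
  Normc.normc (z * w) ^+ 2 = Normc.normc z ^+ 2 * Normc.normc w ^+ 2.
Proof. by rewrite Normc.normcM exprMn. Qed.

Lemma horner_cexp_bounded (k : {poly R[i]}) :
  exists2 M : R, 0 <= M & forall t, Normc.normc k.[cexp t] ^+ 2 <= M.
Proof.
have [_ _ [M hM]] := bounded_measurable_horner k.
have M0 : 0 <= M by have [h _] := hM 0; exact: le_trans h.
exists (M ^+ 2 + M ^+ 2); first by rewrite addr_ge0 ?sqr_ge0.
move=> t; rewrite normc_sqrE cReM cRe_conj cIm_conj mulrN opprK -!expr2.
have [h1 h2] := hM t.
by rewrite lerD// -real_normK ?num_real// lerXn2r// nnegrE.
Qed.

Section Sign.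
Variable e : R.
Hypothesis e2 : e * e = 1.
Local Notation A := (para_opuc theta n e).
Variable s : seq R.
Hypotheses (us : uniq s) (ss : size s = n.+1) (s01 : all (fun xi => 0 <= xi < 1) s).
Hypothesis memA : forall xi, (0 <= xi < 1) && (A.[cexp xi] == 0) = (xi \in s).
Hypothesis AE : A = lead_coef A *: \prod_(xi <- s) ('X - (cexp xi)%:P).

(** The nodal product prod_xi (x(t) - x(xi)). *)
Definition nodal t : R := \prod_(xi <- s) (circle_abscissa t - circle_abscissa xi).

Lemma nodal_sign t : 0 <= e * nodal t.
Proof.
have [c [c0 ->]] := nodal_product_sign theta01 theta_nontrivial e2 theta_even ss AE.
by rewrite mulr_ge0 ?sqr_ge0// ltW.
Qed.

Lemma nodal_node xi : xi \in s -> nodal xi = 0.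
Proof. by move=> xs; rewrite /nodal (bigD1_seq xi)//= subrr mul0r. Qed.

(** A one-sided bound by the nodal product forces tangency at the nodes, since
    near xi that product is O(|e(t) - e(xi)|^2) and the power series is
    bounded. *)
Lemma tangent_at_node (b : nat -> R) (g : R -> R) : nonneg_power_series b ->
  real_trig_poly n g ->
  (forall t, circle_abscissa t < 1 -> g t <= e * nodal t * power_series b (circle_abscissa t)) ->
  forall xi, xi \in s -> xi != 0 -> g xi = 0 -> is_derive xi 1 g 0.
Proof.
move=> hb gT gle xi xs x0 g0.
have xi1 : circle_abscissa xi < 1 by apply: circle_abscissa_lt1 => //; exact: (allP s01).
have [D _ gD] := (trig_polyP n _).1 gT.
have [c [c0 hc]] := nodal_product_sign theta01 theta_nontrivial e2 theta_even ss AE.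
have [k kE] : exists k, A = k * ('X - (cexp xi)%:P).
  by apply/factor_theorem; rewrite rootE; have := xs; rewrite -memA => /andP[].
have [M M0 hM] := horner_cexp_bounded k.
(* The series is bounded by its value at x1 as long as x(t) < x1. *)
pose x1 := (1 + circle_abscissa xi) / 2.
have x11 : x1 < 1 by rewrite /x1; lra.
have x1pos : 0 <= x1 by case/andP: (circle_abscissa_itv xi) => h _; rewrite /x1; lra.
apply: (@flat_of_quadratic_bound _ g (c * M * power_series b x1)) => //.
  by move=> t; exact: (@derivable_real_trig _ n g D t gD).
have cx : {for xi, continuous (fun t : R => circle_abscissa t)}.
  rewrite /circle_abscissa; apply: cvgM; last exact: cvg_cst.
  apply: cvgD; first exact: cvg_cst.
  apply: (@continuous_comp _ _ _ (fun t : R => 2 * pi * t) cos); last exact: continuous_cos.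
  exact: mulrl_continuous.
have nx : \forall t \near xi, circle_abscissa t < x1.
  have h : circle_abscissa xi < x1 by rewrite /x1; lra.
  exact: (cvgr_lt _ cx _ h).
apply: filterS nx => t tx1.
have t1 : circle_abscissa t < 1 by exact: lt_trans tx1 x11.
have t0 : 0 <= circle_abscissa t by case/andP: (circle_abscissa_itv t).
apply: (le_trans (gle t t1)); rewrite hc -cexp_dist kE hornerM hornerXsubC normc_sqrM.
set d := Normc.normc (cexp t - cexp xi) ^+ 2; have d0 : 0 <= d by exact: sqr_ge0.
have Q0 : 0 <= power_series b (circle_abscissa t) by apply: power_series_ge0; rewrite ?t0.
have Qle : power_series b (circle_abscissa t) <= power_series b x1.
  by apply: power_series_le => //; exact: ltW.
have -> : c * M * power_series b x1 * d = (c * (M * d)) * power_series b x1 by ring.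
apply: ler_pM => //.
  by apply: mulr_ge0; [exact: ltW|apply: mulr_ge0; exact: sqr_ge0].
by rewrite ler_pM2l// ler_wpM2r.
Qed.

Lemma extremal_uniqueness (b : nat -> R) (l l0 : R -> R) : nonneg_power_series b ->
  real_trig_poly n l -> real_trig_poly n l0 ->
  (forall t, circle_abscissa t < 1 ->
     e * (l t - l0 t) <= e * nodal t * power_series b (circle_abscissa t)) ->
  (forall xi, xi \in s -> l xi = l0 xi) -> l = l0.
Proof.
move=> hb lT l0T hle hs.
have gT : real_trig_poly n (fun t => e * (l t - l0 t)).
  by apply: real_trig_polyZ; exact: real_trig_polyB.
have gs xi : xi \in s -> e * (l xi - l0 xi) = 0 by move=> /hs ->; rewrite subrr mulr0.
have h := real_trig_poly_eq0 us ss s01 gT gs.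
apply/funext => t; have e0 : e != 0.
  by apply/eqP => e0; have := e2; rewrite e0 mul0r => /esym/eqP; rewrite oner_eq0.
apply/eqP; rewrite -subr_eq0; apply/eqP; apply: (mulfI e0); rewrite mulr0.
apply: h => xi xs x0; apply: (tangent_at_node hb gT hle) => //; exact: gs.
Qed.

Local Notation weight := (weight theta n).

(** The common form of both problems, multiplied by e = 1 for minorants and by
    e = -1 for majorants: [p] is the interpolating polynomial and [l] the
    competitor. *)
Lemma extremal_problem (p : {poly R}) (b : nat -> R) (l : R -> R) :
  (size p <= n.+1)%N -> nonneg_power_series b -> real_trig_poly n l ->
  (forall t, circle_abscissa t < 1 ->
     e * (l t - p.[circle_abscissa t]) <= e * nodal t * power_series b (circle_abscissa t)) ->
  (forall xi, xi \in s -> e * l xi <= e * p.[circle_abscissa xi]) ->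
  e * \sum_(xi <- s) l xi * weight xi <=
    e * \sum_(xi <- s) p.[circle_abscissa xi] * weight xi /\
  (\sum_(xi <- s) l xi * weight xi = \sum_(xi <- s) p.[circle_abscissa xi] * weight xi ->
   l = (fun t => p.[circle_abscissa t])).
Proof.
move=> sp hb lT hle hs.
have w0 xi : xi \in s -> 0 < weight xi by move=> xs;
  apply: (weight_gt0 theta01 theta_nontrivial e2 memA xs).
have pT := real_trig_poly_abscissa sp.
split.
  rewrite !mulr_sumr big_seq [leRHS]big_seq; apply: ler_sum => xi xs.
  by rewrite !mulrA ler_pM2r ?w0// hs.
move=> heq; apply: (extremal_uniqueness hb lT pT hle) => xi xs.
have e0 : e != 0.
  by apply/eqP => e0; have := e2; rewrite e0 mul0r => /esym/eqP; rewrite oner_eq0.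
have : \sum_(xi <- s | xi \in s) (e * p.[circle_abscissa xi] - e * l xi) * weight xi = 0.
  rewrite -big_seq; under eq_bigr do rewrite mulrBl -!mulrA.
  by rewrite sumrB -!mulr_sumr heq subrr.
move=> /eqP; rewrite psumr_eq0; last first.
  by move=> z zs; rewrite mulr_ge0 ?subr_ge0 ?hs// ltW// w0.
move=> /allP/(_ _ xs); rewrite xs /= mulf_eq0 (gt_eqF (w0 _ xs)) orbF subr_eq0.
by move=> /eqP/(mulfI e0).
Qed.

Lemma quadrature_sum (H : R -> \bar R) (F : R -> R) : 
  (forall xi, xi \in s -> H xi = (F xi)%:E) ->
  (\sum_(xi \in [set` s]) H xi * (weight xi)%:E)%E = (\sum_(xi <- s) F xi * weight xi)%:E.
Proof.
move=> hH; rewrite -fsbig_seq//= -sumEFin; apply: eq_big_seq => xi xs.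
by rewrite hH// EFinM.
Qed.

End Sign.

Lemma circle_zerosE (e : R) (P : {poly R[i]}) (c : R[i]) (s : seq R) : c != 0 ->
  P = c *: para_opuc theta n e ->
  (forall xi, (0 <= xi < 1) && ((para_opuc theta n e).[cexp xi] == 0) = (xi \in s)) ->
  circle_zeros P = [set` s].
Proof.
move=> c0 -> memA; apply/seteqP; split => xi; rewrite /circle_zeros /= -memA (hornerZ c).
  by move=> [-> /eqP]; rewrite mulf_eq0 (negbTE c0).
by move=> /andP[-> /eqP ->]; rewrite mulr0.
Qed.

Lemma companionAE : companionA phi = 2^-1 *: para_opuc theta n 1.
Proof. by rewrite /companionA /para_opuc scale1r. Qed.

Lemma companionBE : companionB phi = ('i%C / 2) *: para_opuc theta n (-1).
Proof. by rewrite /companionB /para_opuc rmorphN1 scaleN1r. Qed.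

(** At z = 1, where phi is real, phi^* and phi agree.  Hence 1 is a zero of
    phi^* - phi and not of phi^* + phi. *)
Lemma opuc1_real : (reverse_poly phi).[1] = phi.[1].
Proof.
rewrite (horner_reverse_opuc theta01 theta_nontrivial) ?oner_neq0//.
by rewrite expr1n mul1r -(opuc_real theta01 theta_nontrivial n theta_even) fmorphV /= conjCK invr1.
Qed.

Lemma para_opuc_at1_neq0 : (para_opuc theta n 1).[1] != 0.
Proof.
apply/eqP => h.
have rt : root (para_opuc theta n 1) 1 by rewrite rootE h.
have [k kE] := factor_theorem _ _ rt.
have w1 : (1 : R[i]) * 1^* = 1 by rewrite conjC1 mulr1.
have := opuc_node_neq0 theta01 theta_nontrivial (mulr1 1) w1 kE.
move: h; rewrite horner_para_opuc mul1r opuc1_real -mulr2n -mulr_natl => /eqP.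
by rewrite mulf_eq0 pnatr_eq0 /= => ->.
Qed.

Lemma para_opuc_at1_eq0 : (para_opuc theta n (-1)).[1] = 0.
Proof. by rewrite horner_para_opuc rmorphN1 mulN1r opuc1_real subrr. Qed.

End Extremal.

Theorem theorem29 (R : realType) (n : nat)
    (theta : probability (measurableTypeR R) R)
    (theta01 : theta [set` `[0%R, 1%R[] = 1%E)
    (theta_nontrivial : nontrivial_measure theta)
    (theta_even : even_measure theta) :
  let phi := opuc theta n.+1 in
  let SA := quadrature phi (circle_zeros (companionA phi)) in
  let SB := quadrature phi (circle_zeros (companionB phi)) in
  (forall sigma : {measure set (measurableTypeR R) -> \bar R},
     (forall a : R, 0 < a ->
        (\int[sigma]_(lam in `]0%R, +oo[) (lam * expR (- (a * lam)))%:E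
          < +oo)%E) ->
     (forall l : R -> R, minorant_trig_poly n sigma l ->
        (\int[theta]_(t in `[0%R, 1%R[) (l t)%:E <= SA sigma)%E)
     /\ (exists! l : R -> R, minorant_trig_poly n sigma l /\
           (\int[theta]_(t in `[0%R, 1%R[) (l t)%:E = SA sigma)%E))
  /\
  (forall sigma : {measure set (measurableTypeR R) -> \bar R},
     (\int[sigma]_(lam in `]0%R, +oo[) (lam / (1 + lam))%:E < +oo)%E ->
     (forall m : R -> R, majorant_trig_poly n sigma m ->
        (SB sigma <= \int[theta]_(t in `[0%R, 1%R[) (m t)%:E)%E)
     /\ (exists! m : R -> R, majorant_trig_poly n sigma m /\
           (\int[theta]_(t in `[0%R, 1%R[) (m t)%:E = SB sigma)%E)).
Proof.
move=> phi SA SB; split=> sigma hsigma.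
- have e2 : (1 : R) * 1 = 1 by rewrite mulr1.
  have [s [us ss s01 memA AE]] := para_opuc_nodes theta01 theta_nontrivial n e2.
  have x_lt1 xi : xi \in s -> circle_abscissa xi < 1.
    move=> xs; apply: circle_abscissa_lt1; first exact: (allP s01).
    apply: contraTneq xs => ->; rewrite -memA cexp0 negb_and.
    by rewrite (para_opuc_at1_neq0 theta01 theta_nontrivial theta_even n) orbT.
  have nod t : 0 <= nodal s t.
    by rewrite -[nodal s t]mul1r (nodal_sign theta01 theta_nontrivial theta_even e2 ss AE).
  have hfin t : circle_abscissa t < 1 -> (h_ sigma t < +oo)%E by exact: h_lty_of_exp.
  have s_lt1 : all (fun xi => circle_abscissa xi < 1) s by apply/allP => xi /x_lt1.
  have [p [b [sp hb hE h1]]] := lower_interpolation hfin s_lt1 nod.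
  rewrite ss in sp.
  have hnode xi : xi \in s -> h_ sigma xi = (p.[circle_abscissa xi])%:E.
    by move=> xs; rewrite hE ?x_lt1// -/(nodal s xi) nodal_node// mul0r addr0.
  have SAE : SA sigma = (\sum_(xi <- s) p.[circle_abscissa xi] * weight theta n xi)%:E.
    rewrite /SA /quadrature (circle_zerosE _ (companionAE theta n) memA) ?invr_eq0 ?pnatr_eq0//.
    by rewrite -(quadrature_sum theta n us hnode).
  have quad l := @quadrature_trig _ _ theta01 theta_nontrivial n _ e2 s us ss s01 memA l.
  have ext l : minorant_trig_poly n sigma l -> _ := fun hl =>
    @extremal_problem _ _ theta01 theta_nontrivial theta_even n _ e2 s us ss s01 memA AE p b l
      sp hb hl.1.
  have hyp1 l : minorant_trig_poly n sigma l -> forall t, circle_abscissa t < 1 ->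
     1 * (l t - p.[circle_abscissa t]) <= 1 * nodal s t * power_series b (circle_abscissa t).
    by move=> [_ hl] t t1; have := hl t; rewrite hE// lee_fin -/(nodal s t) !mul1r lerBlDl.
  have hyp2 l : minorant_trig_poly n sigma l -> forall xi, xi \in s ->
      1 * l xi <= 1 * p.[circle_abscissa xi].
    by move=> [_ hl] xi xs; have := hl xi; rewrite hnode// lee_fin !mul1r.
  have pmin : minorant_trig_poly n sigma (fun t => p.[circle_abscissa t]).
    split; first exact: real_trig_poly_abscissa.
    move=> t; case/andP: (circle_abscissa_itv t) => t0; rewrite le_eqVlt => /predU1P[t1|t1].
      by rewrite t1 h1.
    rewrite hE// lee_fin lerDl mulr_ge0//; first exact: nod.
    by apply: power_series_ge0 => //; rewrite t0.
  split.
    move=> l hl; rewrite quad; last exact: hl.1.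
    rewrite SAE lee_fin; have [h _] := ext l hl (hyp1 l hl) (hyp2 l hl).
    by rewrite !mul1r in h.
  exists (fun t => p.[circle_abscissa t]); split.
    by split => //; rewrite quad ?SAE//; exact: pmin.1.
  move=> l [hl]; rewrite quad; last exact: hl.1.
  rewrite SAE => -[heq]; have [_ h] := ext l hl (hyp1 l hl) (hyp2 l hl).
  by rewrite h.
- have e2 : (-1 : R) * -1 = 1 by rewrite mulrNN mulr1.
  have [s [us ss s01 memA AE]] := para_opuc_nodes theta01 theta_nontrivial n e2.
  have zs : 0 \in s.
    by rewrite -memA cexp0 (para_opuc_at1_eq0 theta01 theta_nontrivial theta_even) lexx ltr01 eqxx.
  have hfin t : (h_ sigma t < +oo)%E by exact: h_lty_of_frac.
  have s_lt1 : all (fun xi => circle_abscissa xi < 1) (rem 0 s).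
    apply/allP => xi; rewrite mem_rem_uniq// inE => /andP[x0 xs].
    by apply: circle_abscissa_lt1 => //; exact: (allP s01).
  have [p [b [sp hb hE h1]]] := upper_interpolation hfin s_lt1.
  rewrite size_rem// ss in sp.
  have {}hE t : circle_abscissa t < 1 -> h_ sigma t =
      (p.[circle_abscissa t] + nodal s t * power_series b (circle_abscissa t))%:E.
    by move=> t1; rewrite hE// /nodal (perm_big _ (perm_to_rem zs)).
  have nod t : nodal s t <= 0.
    by rewrite -oppr_ge0 -mulN1r (nodal_sign theta01 theta_nontrivial theta_even e2 ss AE).
  have hnode xi : xi \in s -> h_ sigma xi = (p.[circle_abscissa xi])%:E.
    move=> xs; have [->|x0] := eqVneq xi 0; first by rewrite h1 circle_abscissa0.
    rewrite hE; first by rewrite nodal_node// mul0r addr0.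
    by apply: circle_abscissa_lt1 => //; exact: (allP s01).
  have SBE : SB sigma = (\sum_(xi <- s) p.[circle_abscissa xi] * weight theta n xi)%:E.
    rewrite /SB /quadrature (circle_zerosE _ (companionBE theta n) memA); last first.
      rewrite mulf_neq0 ?invr_eq0 ?pnatr_eq0//.
      by apply/eqP => /(congr1 (@complex.Im R)) /eqP; rewrite /= oner_eq0.
    by rewrite -(quadrature_sum theta n us hnode).
  have quad l := @quadrature_trig _ _ theta01 theta_nontrivial n _ e2 s us ss s01 memA l.
  have ext l : majorant_trig_poly n sigma l -> _ := fun hl =>
    @extremal_problem _ _ theta01 theta_nontrivial theta_even n _ e2 s us ss s01 memA AE p b l
      sp hb hl.1.
  have hyp1 l : majorant_trig_poly n sigma l -> forall t, circle_abscissa t < 1 ->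
     -1 * (l t - p.[circle_abscissa t]) <= -1 * nodal s t * power_series b (circle_abscissa t).
    move=> [_ hl] t t1; have := hl t; rewrite hE// lee_fin; lra.
  have hyp2 l : majorant_trig_poly n sigma l -> forall xi, xi \in s ->
      -1 * l xi <= -1 * p.[circle_abscissa xi].
    by move=> [_ hl] xi xs; have := hl xi; rewrite hnode// lee_fin !mulN1r lerN2.
  have pmaj : majorant_trig_poly n sigma (fun t => p.[circle_abscissa t]).
    split; first exact: real_trig_poly_abscissa.
    move=> t; case/andP: (circle_abscissa_itv t) => t0; rewrite le_eqVlt => /predU1P[t1|t1].
      by rewrite t1 h1.
    rewrite hE// lee_fin gerDl mulr_le0_ge0//.
    by apply: power_series_ge0 => //; rewrite t0.
  split.
    move=> l hl; rewrite quad; last exact: hl.1.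
    rewrite SBE lee_fin; have [h _] := ext l hl (hyp1 l hl) (hyp2 l hl).
    by rewrite !mulN1r lerN2 in h.
  exists (fun t => p.[circle_abscissa t]); split.
    by split => //; rewrite quad ?SBE//; exact: pmaj.1.
  move=> l [hl]; rewrite quad; last exact: hl.1.
  rewrite SBE => -[heq]; have [_ h] := ext l hl (hyp1 l hl) (hyp2 l hl).
  by rewrite h.
Qed.
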